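(* Let $A,B\in\mathcal{CR}$ and let $\mathcal{J}$ be a proper operator ideal. The following conditions are equivalent: (i) $B=GAK^{-1}$ for some $G,K\in\mathcal{G}\ell_{\mathcal J}$; (ii) $A-B\in\mathcal{J}$ and $[P_{N(A)}:P_{N(B)}]=0$; (iii) $A-B\in\mathcal{J}$ and $P_{N(B)}=UP_{N(A)}U^*$ for some $U\in\mathcal{U}_{\mathcal J}$. Moreover, if $\mathcal{J}$ is in addition arithmetic mean closed, then the conditions above are also equivalent to: (iv) $|A|-|B|\in\mathcal{J}$, $V_A-V_B\in\mathcal{J}$ and $[V_A^*V_A:V_B^*V_B]=0$, where $A=V_A|A|$ and $B=V_B|B|$ are the polar decompositions.
   Context: $\mathcal{H}$ is a separable infinite-dimensional complex Hilbert space, $\mathcal{B}(\mathcal{H})$ the algebra of bounded operators on it. $R(A)$, $N(A)$ denote range and nullspace of $A$; $P_{\mathcal S}$ is the orthogonal projection onto a closed subspace $\mathcal{S}$. $\mathcal{CR}=\{A\in\mathcal{B}(\mathcal{H}): R(A)\text{ is closed}\}$. An operator ideal is a two-sided ideal $\mathcal{J}$ of $\mathcal{B}(\mathcal{H})$; it is proper if $\{0\}\ne\mathcal{J}\neq\mathcal{B}(\mathcal{H})$. $\mathcal{G}\ell_{\mathcal J}=\{G\in\mathcal{B}(\mathcal{H}): G\text{ invertible in }\mathcal{B}(\mathcal{H}),\ G-I\in\mathcal{J}\}$ and $\mathcal{U}_{\mathcal J}=\{U \text{ unitary on }\mathcal{H}: U-I\in\mathcal{J}\}$. Polar decomposition: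 $A=V_A|A|$, $|A|=(A^*A)^{1/2}$, $V_A$ the partial isometry uniquely determined by this identity and $N(V_A)=N(A)$. Essential codimension: a pair $(P,Q)$ of orthogonal projections is a Fredholm pair if $QP|_{R(P)}:R(P)\to R(Q)$ is a Fredholm operator, and then $[P:Q]$ is its index, i.e. $[P:Q]=\dim(N(Q)\cap R(P))-\dim(R(Q)\cap N(P))$. Writing $[P:Q]=0$ includes that $(P,Q)$ is a Fredholm pair. For a compact operator $A$, $s(A)=\{s_n(A)\}_{n\ge1}$ is the sequence of singular values (eigenvalues of $|A|$) in non-increasing order with multiplicity. For compact $A,B$, $s(B)\prec_w s(A)$ means $\sum_{i=1}^n s_i(B)\le\sum_{i=1}^n s_i(A)$ for every $n\ge1$. An operator ideal $\mathcal{J}$ is arithmetic mean closed if $A\in\mathcal{J}$ and $s(B)\prec_w s(A)$ imply $B\in\mathcal{J}$ (for compact $A,B$). *)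

(* Defs.v *)
From HB Require Import structures.
From mathcomp Require Import all_boot all_order all_algebra.
From mathcomp Require Import complex.
From mathcomp Require Import all_classical all_reals all_analysis.

Set Implicit Arguments.
Unset Strict Implicit.
Unset Printing Implicit Defensive.

Import Order.TTheory GRing.Theory Num.Theory.
Import numFieldNormedType.Exports.

Local Open Scope classical_set_scope.
Local Open Scope complex_scope.
Local Open Scope ring_scope.

(* [dotp] is linear in its first argument and conjugate-linear in the second. *)
HB.mixin Record isHilbert (R : realType) H of CompleteNormedModule R[i] H := {
  dotp : {dot H for (Num.conj : R[i] -> R[i])} ;
  normr_dotp : forall x : H, `|x| ^+ 2 = dotp x x }.

#[short(type="hilbertType")]
HB.structure Definition Hilbert (R : realType) :=
  {H of isHilbert R H & CompleteNormedModule R[i] H}.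

Notation "'<|' x , y '|>'" := (dotp x y)
  (at level 0, x at level 99, y at level 99, format "<| x ,  y |>") : ring_scope.

Definition separable_space (T : topologicalType) :=
  exists2 D : set T, countable D & dense D.

Section Operators.
Context {R : realType} {H : hilbertType R}.
Implicit Types (A B T U V P Q : H -> H) (M N S : set H) (J : set (H -> H)).

(* [S] is a linear subspace of [H] of finite dimension [n]. *)
Definition has_dim S (n : nat) := exists2 b : 'I_n -> H,
  (forall c : 'I_n -> R[i], \sum_i c i *: b i = 0 -> forall i, c i = 0) &
  S = [set \sum_i c i *: b i | c in [set: 'I_n -> R[i]]].

Definition finite_dim S := exists n, has_dim S n.

Definition bounded_op A :=
  linear A /\ exists C : R, forall x, `|A x| <= C%:C * `|x|.

Definition nullspace A : set H := [set x | A x = 0].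

Definition closed_range_op A := bounded_op A /\ closed (range A).

Definition orthogonal_to S : set H := [set x | forall y, S y -> <|x, y|> = 0].

(* In the definitions below [get] selects the object that is characterised by
   the set; it is meaningful when [S] is a closed subspace for [orthoproj S], when
   [A] is bounded for [adjoint A], [opabs A] and [polar_iso A], when [A] is
   invertible for [op_inv A], and when [A] is compact for [sing_val A]. *)

Definition orthoproj S : H -> H :=
  fun x => get [set y | S y /\ orthogonal_to S (x - y)].

Definition adjoint A : H -> H :=
  fun y => get [set z | forall x, <|A x, y|> = <|x, z|>].

Definition is_inverse A B := [/\ bounded_op B, B \o A = id & A \o B = id].

Definition invertible_op A := bounded_op A /\ exists B, is_inverse A B.

Definition op_inv A : H -> H := get [set B | is_inverse A B].

Definition unitary U :=
  [/\ bounded_op U, adjoint U \o U = id & U \o adjoint U = id].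

(* In the order of [R[i]], [0 <= z] means that [z] is real and nonnegative. *)
Definition positive_op T := bounded_op T /\ forall x, 0 <= <|T x, x|>.

Definition opabs A : H -> H :=
  get [set T | positive_op T /\ T \o T = adjoint A \o A].

Definition partial_isometry V :=
  bounded_op V /\ forall x, orthogonal_to (nullspace V) x -> `|V x| = `|x|.

Definition polar_iso A : H -> H := get [set V |
  [/\ partial_isometry V, A = V \o opabs A & nullspace V = nullspace A]].

Definition orth_projection P := [/\ bounded_op P, P \o P = P & adjoint P = P].

(* [T] restricts to a Fredholm operator from [M] to [N]; the finite-dimensional
   [F] accounts for the finite codimension of [T @` M] in [N]. *)
Definition fredholm T M N :=
  [/\ T @` M `<=` N,
      finite_dim (M `&` nullspace T),
      closed (T @` M) &
      exists2 F : set H, finite_dim F &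
        forall y, N y -> exists2 x, M x & F (y - T x)].

Definition fredholm_pair P Q :=
  [/\ orth_projection P, orth_projection Q & fredholm (Q \o P) (range P) (range Q)].

(* [P : Q] = k, including that [(P, Q)] is a Fredholm pair. *)
Definition ess_codim P Q (k : int) :=
  fredholm_pair P Q /\ exists m n : nat,
    [/\ has_dim (nullspace Q `&` range P) m,
        has_dim (range Q `&` nullspace P) n & k = m%:Z - n%:Z].

Definition compact_op A := bounded_op A /\ precompact (A @` [set x | `|x| <= 1]).

(* Indices start at 0. Each positive eigenvalue of [opabs A] occurs as many
   times as its multiplicity, and the sequence is completed with zeros when
   there are only finitely many. *)
Definition is_sing_val A (s : nat -> R) :=
  [/\ forall n, 0 <= s n,
      forall m n, (m <= n)%N -> s n <= s m &
      forall l : R, 0 < l -> exists2 d : nat,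
        has_dim [set x | opabs A x = l%:C *: x] d & ([set n | s n = l] #= `I_d)%card].

Definition sing_val A : nat -> R := get [set s | is_sing_val A s].

Definition weakly_majorized (t s : nat -> R) :=
  forall n : nat, \sum_(i < n) t i <= \sum_(i < n) s i.

Definition op_ideal J :=
  [/\ J `<=` bounded_op, J (fun=> 0),
      forall A B, J A -> J B -> J (A \+ B),
      forall A T, J A -> bounded_op T -> J (T \o A) &
      forall A T, J A -> bounded_op T -> J (A \o T)].

Definition proper_op_ideal J :=
  [/\ op_ideal J, J <> [set (fun=> 0)] & J <> bounded_op].

Definition am_closed J := forall A B, compact_op A -> compact_op B ->
  J A -> weakly_majorized (sing_val B) (sing_val A) -> J B.

Definition Gl_ideal J : set (H -> H) :=
  [set G | invertible_op G /\ J (G \- id)].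

Definition U_ideal J : set (H -> H) := [set U | unitary U /\ J (U \- id)].

End Operators.

(* Main.v *)
Require Import Defs.
From mathcomp Require Import all_boot all_order all_algebra.
From mathcomp Require Import complex.
From mathcomp Require Import all_classical all_reals all_analysis.
From mathcomp Require Import ring lra zify.

(* A proper ideal consists of compact operators (Calkin): if [T] is a
   non-compact element, there is an orthonormal sequence [e] such that the
   [T (e n)] are orthogonal and bounded below, so that [Y T X = 1] for suitable
   [X], [Y].

   (i) => (ii): compressing [K^-1] to [K (N(A))] gives [1 + compact], of index 0.

   (ii) => (iii): for [P], [Q] the null projections and [W] a finite-rank swap of
   [R(P) `&` N(Q)] and [N(P) `&` R(Q)], the operator [QP + (1-Q)(1-P) + W] is
   injective, is the identity modulo [J], and intertwines [P] and [Q]; [U] is its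
   unitary polar factor.

   (iii) => (i): take [K = U], so that [B' = B U] has the nullspace of [A]. With
   [P], [Q] the projections onto [R(A)] and [R(B')], the operator
   [B' A^+ + (1-Q)(1-P)] equals [1] modulo [J] and maps [A] to [B']; a finite-rank
   correction vanishing on [R(A)] makes it invertible.

   (iv): [a = |A| + P] and [b = |B| + Q] are invertible, and [D = a - b] solves
   [a D + D b = a^2 - b^2], with right-hand side in [J]. Rewriting this equation as
   a contraction bounds the Ky Fan norms of [D] by a multiple of those of
   [a^2 - b^2], so [D] is in [J] when [J] is arithmetic mean closed. *)

Set Implicit Arguments.
Unset Strict Implicit.
Unset Printing Implicit Defensive.

Import Order.TTheory GRing.Theory Num.Theory.
Import numFieldNormedType.Exports.

Local Open Scope classical_set_scope.
Local Open Scope complex_scope.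
Local Open Scope ring_scope.

(** [J] carries no norm, so membership in [J] is obtained from algebraic identities in which every
    term has a factor in [J]: [T - 1 = (1 + T)^-1 (T^2 - 1)] for the positive root [T] of [G^* G],
    or a telescoping form of [V_A - V_B]. For [|A| - |B|] such a factorization breaks down because
    the two roots need not commute; an operator equation and majorization take its place, and this
    is where arithmetic mean closedness enters. Closed ranges act through lower bounds: they provide
    bounded pseudo-inverses, which turn [A - B] in [J] into statements about null and range
    projections. Compactness is handled as approximability by finite-rank operators ([fapprox]).
    Fredholm theory then reduces to a square matrix and its conjugate transpose, whose equal ranks
    give index 0. Square roots come from an iteration whose limit commutes with everything that
    commutes with the data; this stands in for functional calculus. *)

Section InnerProduct.
Context {R : realType} {H : hilbertType R}.
Implicit Types (x y z : H) (a b : R[i]).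

(** * Inner product, real-valued norms and the Cauchy-Schwarz inequality *)

Lemma ipDl x y z : <|x + y, z|> = <|x, z|> + <|y, z|>.
Proof. exact: linearDl. Qed.
Lemma ipDr x y z : <|x, y + z|> = <|x, y|> + <|x, z|>.
Proof. exact: linearDr. Qed.
Lemma ipNl x y : <|- x, y|> = - <|x, y|>.
Proof. exact: linearNl. Qed.
Lemma ipNr x y : <|x, - y|> = - <|x, y|>.
Proof. exact: linearNr. Qed.
Lemma ipBl x y z : <|x - y, z|> = <|x, z|> - <|y, z|>.
Proof. exact: linearBl. Qed.
Lemma ipBr x y z : <|x, y - z|> = <|x, y|> - <|x, z|>.
Proof. exact: linearBr. Qed.
Lemma ipZl a x y : <|a *: x, y|> = a * <|x, y|>.
Proof. exact: linearZl_LR. Qed.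
Lemma ipZr a x y : <|x, a *: y|> = Num.conj a * <|x, y|>.
Proof. exact: linearZr_LR. Qed.
Lemma ip0l x : <|0, x|> = 0.
Proof. exact: linear0l. Qed.
Lemma ip0r x : <|x, 0|> = 0.
Proof. exact: linear0r. Qed.
Lemma ipC x y : <|x, y|> = Num.conj <|y, x|>.
Proof. by rewrite hermC expr0 mul1r. Qed.
Lemma ip_suml I (r : seq I) (P : pred I) (F : I -> H) y :
  <|\sum_(i <- r | P i) F i, y|> = \sum_(i <- r | P i) <|F i, y|>.
Proof. by rewrite linear_sumlz. Qed.
Lemma ip_sumr I (r : seq I) (P : pred I) (F : I -> H) y :
  <|y, \sum_(i <- r | P i) F i|> = \sum_(i <- r | P i) <|y, F i|>.
Proof. exact: linear_sumr. Qed.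
Lemma ip_eq0C x y : <|x, y|> = 0 -> <|y, x|> = 0.
Proof. by move=> h; rewrite ipC h rmorph0. Qed.

(** Norms of a module over [R[i]] take values in [R[i]]; the real parts live in an ordered field
    where [lra] and suprema are available. *)
Definition nrm x : R := complex.Re `|x|.
Definition cabs a : R := complex.Re `|a|.

Lemma real_normE (V : normedZmodType R[i]) (v : V) :
  `|v| = (complex.Re `|v|)%:C.
Proof. by rewrite RRe_real // ger0_real. Qed.

Lemma nrmE x : `|x| = (nrm x)%:C. Proof. exact: real_normE. Qed.
Lemma cabsE a : `|a| = (cabs a)%:C. Proof. exact: real_normE. Qed.

Lemma nrm_ge0 x : 0 <= nrm x.
Proof. by rewrite -ler0c -nrmE normr_ge0. Qed.
Lemma cabs_ge0 a : 0 <= cabs a.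
Proof. by rewrite -ler0c -cabsE normr_ge0. Qed.

Lemma ip_nrm x : <|x, x|> = (nrm x ^+ 2)%:C.
Proof. by rewrite -normr_dotp nrmE rmorphXn. Qed.


Lemma ip_eq0 x : <|x, x|> = 0 -> x = 0.
Proof.
move=> h; apply/eqP; rewrite -normr_eq0 -sqrf_eq0 normr_dotp.
exact/eqP.
Qed.

Lemma nrm_eq0 x : nrm x = 0 -> x = 0.
Proof. by move=> h; apply/eqP; rewrite -normr_eq0 nrmE h. Qed.

Lemma nrm0 : nrm (0 : H) = 0. Proof. by rewrite /nrm normr0. Qed.
Lemma nrmN x : nrm (- x) = nrm x. Proof. by rewrite /nrm normrN. Qed.
Lemma nrmBC x y : nrm (x - y) = nrm (y - x). Proof. by rewrite /nrm distrC. Qed.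
Lemma nrmZ a x : nrm (a *: x) = cabs a * nrm x.
Proof. by apply: (@complexI R); rewrite -nrmE normrZ cabsE nrmE rmorphM. Qed.
Lemma nrmD x y : nrm (x + y) <= nrm x + nrm y.
Proof. by rewrite -lecR rmorphD /= -!nrmE ler_normD. Qed.
Lemma nrmB x y : nrm (x - y) <= nrm x + nrm y.
Proof. by rewrite (le_trans (nrmD _ _))// nrmN. Qed.
Lemma nrm_triB x y z : nrm (x - z) <= nrm (x - y) + nrm (y - z).
Proof. by rewrite (le_trans _ (nrmD _ _))// addrA subrK. Qed.
Lemma nrm_sum I (r : seq I) (P : pred I) (F : I -> H) :
  nrm (\sum_(i <- r | P i) F i) <= \sum_(i <- r | P i) nrm (F i).
Proof.
elim/big_rec2 : _ => [|i u v _ h]; first by rewrite nrm0.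
by rewrite (le_trans (nrmD _ _))// lerD2l.
Qed.

Lemma cabs0 : cabs (0 : R[i]) = 0. Proof. by rewrite /cabs normr0. Qed.
Lemma cabsN a : cabs (- a) = cabs a. Proof. by rewrite /cabs normrN. Qed.
Lemma cabsM a b : cabs (a * b) = cabs a * cabs b.
Proof. by apply: (@complexI R); rewrite -cabsE normrM !cabsE rmorphM. Qed.
Lemma cabsD a b : cabs (a + b) <= cabs a + cabs b.
Proof. by rewrite -lecR rmorphD /= -!cabsE ler_normD. Qed.
Lemma cabs_eq0 a : cabs a = 0 -> a = 0.
Proof. by move=> h; apply/eqP; rewrite -normr_eq0 cabsE h. Qed.
Lemma cabsR (r : R) : cabs r%:C = `|r|.
Proof.
by apply: (@complexI R); rewrite -cabsE normc_def /= expr0n /= addr0 sqrtr_sqr.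
Qed.
Lemma cabs_pos (r : R) : 0 <= r -> cabs r%:C = r.
Proof. by move=> h; rewrite cabsR ger0_norm. Qed.
Lemma cabsJ a : cabs (Num.conj a) = cabs a.
Proof. by rewrite /cabs norm_conjC. Qed.
Lemma mulconj a : a * Num.conj a = (cabs a ^+ 2)%:C.
Proof. by rewrite -normCK cabsE rmorphXn. Qed.
Lemma mulconjC a : Num.conj a * a = (cabs a ^+ 2)%:C.
Proof. by rewrite mulrC mulconj. Qed.
Lemma Re_conj a : complex.Re (Num.conj a) = complex.Re a.
Proof. by case: a. Qed.
Lemma conjR (r : R) : Num.conj r%:C = r%:C :> R[i].
Proof. exact: conjc_real. Qed.
Lemma Re_le_cabs a : complex.Re a <= cabs a.
Proof.
rewrite /cabs normc_def /= (le_trans (ler_norm _))// -sqrtr_sqr.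
by rewrite ler_sqrt ?addr_ge0 ?sqr_ge0// lerDl sqr_ge0.
Qed.
Lemma ReD a b : complex.Re (a + b) = complex.Re a + complex.Re b.
Proof. by case: a => ? ?; case: b. Qed.
Lemma ReN a : complex.Re (- a) = - complex.Re a.
Proof. by case: a. Qed.
Lemma ReM_real (r : R) a : complex.Re (r%:C * a) = r * complex.Re a.
Proof. by case: a => u v /=; rewrite mul0r subr0. Qed.
Lemma Re_sum I (r : seq I) (P : pred I) (F : I -> R[i]) :
  complex.Re (\sum_(i <- r | P i) F i) = \sum_(i <- r | P i) complex.Re (F i).
Proof. by apply: big_morph => // ? ?; rewrite ReD. Qed.

Lemma Re_ip x : complex.Re <|x, x|> = nrm x ^+ 2. Proof. by rewrite ip_nrm. Qed.

Lemma nrm_sqD x y :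
  nrm (x + y) ^+ 2 = nrm x ^+ 2 + nrm y ^+ 2 + 2 * complex.Re <|x, y|>.
Proof.
rewrite -!Re_ip ipDl !ipDr !ReD (ipC y x) Re_conj; ring.
Qed.

Lemma nrm_sqB x y :
  nrm (x - y) ^+ 2 = nrm x ^+ 2 + nrm y ^+ 2 - 2 * complex.Re <|x, y|>.
Proof. by rewrite nrm_sqD nrmN ipNr ReN mulrN. Qed.

Lemma pythagoras x y : <|x, y|> = 0 ->
  nrm (x + y) ^+ 2 = nrm x ^+ 2 + nrm y ^+ 2.
Proof. by move=> h; rewrite nrm_sqD h mulr0 addr0. Qed.

Lemma parallelogram x y :
  nrm (x + y) ^+ 2 + nrm (x - y) ^+ 2 = 2 * nrm x ^+ 2 + 2 * nrm y ^+ 2.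
Proof. rewrite nrm_sqD nrm_sqB; ring. Qed.

Lemma cauchy_schwarz x y : cabs <|x, y|> <= nrm x * nrm y.
Proof.
have [->|y0] := eqVneq y 0; first by rewrite ip0r cabs0 nrm0 mulr0.
have ny : 0 < nrm y.
  by rewrite lt_neqAle nrm_ge0 andbT eq_sym; apply/eqP => /nrm_eq0/eqP; exact/negP.
pose c := <|x, y|> / (nrm y ^+ 2)%:C; pose z := x - c *: y.
have yC : (nrm y ^+ 2)%:C != 0 :> R[i].
  by rewrite (inj_eq (@complexI R) _ 0) expf_neq0// gt_eqF.
have zy : <|z, c *: y|> = 0.
  by rewrite ipZr ipBl ipZl ip_nrm divfK// subrr mulr0.
have xE : x = z + c *: y by rewrite subrK.
rewrite -(@ler_pXn2r _ 2)// ?nnegrE ?cabs_ge0 ?mulr_ge0 ?nrm_ge0// exprMn.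
rewrite {2}xE (pythagoras zy) nrmZ.
have -> : cabs <|x, y|> = cabs c * nrm y ^+ 2.
  by rewrite -[X in _ * X]cabs_pos ?sqr_ge0// -cabsM divfK.
rewrite -subr_ge0 [leRHS](_ : _ = nrm z ^+ 2 * nrm y ^+ 2); last by ring.
by rewrite mulr_ge0 ?sqr_ge0.
Qed.

Lemma le_nrm_sqr x (c : R) : 0 <= c -> nrm x ^+ 2 <= c ^+ 2 -> nrm x <= c.
Proof. by move=> c0; rewrite ler_pXn2r// ?nnegrE ?nrm_ge0. Qed.

Lemma ip_ext x y : (forall z, <|x, z|> = <|y, z|>) -> x = y.
Proof.
by move=> h; apply/eqP; rewrite -subr_eq0; apply/eqP/ip_eq0; rewrite ipBl h subrr.
Qed.
Lemma ip_extr x y : (forall z, <|z, x|> = <|z, y|>) -> x = y.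
Proof. by move=> h; apply: ip_ext => z; rewrite ipC h -ipC. Qed.

End InnerProduct.

(** * Sequential limits, completeness and closed sets *)

Section Convergence.
Context {R : realType} {H : hilbertType R}.
Implicit Types (x y z : H) (u v : nat -> H) (S : set H).

Definition tends u x := forall e : R, 0 < e ->
  exists N, forall n, (N <= n)%N -> nrm (u n - x) <= e.

Lemma complex_gt0 (e : R[i]) : 0 < e -> exists2 r : R, 0 < r & e = r%:C.
Proof.
move=> e0; exists (complex.Re e); last by rewrite RRe_real// ger0_real// ltW.
by rewrite -ltcR RRe_real// ger0_real// ltW.
Qed.

Lemma small_invn (e : R) : 0 < e ->
  exists N, forall n, (N <= n)%N -> n.+1%:R^-1 <= e.
Proof.
move=> e0; have [k] := ltr_add_invr e0; rewrite add0r => hk.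
exists k => n kn; apply: le_trans (ltW hk).
by rewrite lef_pV2 ?posrE// ler_nat.
Qed.

Lemma tends_unique u x y : tends u x -> tends u y -> x = y.
Proof.
move=> ux uy; apply/eqP; rewrite -subr_eq0; apply/eqP/nrm_eq0/eqP.
rewrite eq_le nrm_ge0 andbT; apply/ler_addgt0Pr => e e0; rewrite add0r.
have e2 : 0 < e / 2 by rewrite divr_gt0.
have [N1 h1] := ux _ e2; have [N2 h2] := uy _ e2.
apply: (le_trans (nrm_triB _ (u (maxn N1 N2)) _)).
rewrite [leRHS]splitr lerD// 1?nrmBC; first by apply: h1; rewrite leq_maxl.
by rewrite nrmBC; apply: h2; rewrite leq_maxr.
Qed.

Lemma nrm_complete u :
  (forall e : R, 0 < e -> exists N, forall m n, (N <= m)%N -> (N <= n)%N ->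
     nrm (u m - u n) <= e) ->
  exists x, tends u x.
Proof.
move=> hu.
have /cauchy_cvg /cvg_ex [x ux] : cauchy (u @ \oo).
  apply/cauchyP => e e0; have [r r0 ->] := complex_gt0 e0.
  have r2 : 0 < r / 2 by rewrite divr_gt0.
  have [N hN] := hu _ r2.
  exists (u N); exists N => // n /= Nn.
  rewrite -ball_normE /ball_ /= nrmE ltcR.
  by rewrite (le_lt_trans (hN _ _ _ _))// ltr_pdivrMr// ltr_pMr// ltr1n.
exists x => e e0.
have eC : 0 < e%:C :> R[i] by rewrite ltcR.
have /cvgrPdist_le /(_ _ eC) [N _ hN] := ux.
by exists N => n /hN /=; rewrite nrmE lecR nrmBC.
Qed.

Lemma closedP S : closed S <->
  forall x, (forall e : R, 0 < e -> exists2 y, S y & nrm (x - y) <= e) -> S x.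
Proof.
split=> [cS x hx|hS].
  apply: cS => B /nbhs_ballP [e e0 eB].
  have [r r0 re] := complex_gt0 e0.
  have r2 : 0 < r / 2 by rewrite divr_gt0.
  have [y Sy xy] := hx _ r2; exists y; split=> //; apply: eB.
  rewrite -ball_normE /ball_ /= nrmE re ltcR.
  by rewrite (le_lt_trans xy)// ltr_pdivrMr// ltr_pMr// ltr1n.
move=> x clx; apply: hS => e e0.
have eC : 0 < e%:C :> R[i] by rewrite ltcR.
have [y [Sy xy]] := clx _ (nbhsx_ballx x _ eC).
exists y => //; move: xy.
by rewrite -ball_normE /ball_ /= nrmE ltcR => /ltW.
Qed.

Lemma closed_tends S u x : closed S -> (forall n, S (u n)) -> tends u x -> S x.
Proof.
move=> /closedP cS Su ux; apply: cS => e /ux[N hN].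
by exists (u N) => //; rewrite nrmBC; exact: hN.
Qed.

End Convergence.

(** * Orthogonal projection onto closed subspaces *)

Section Projection.
Context {R : realType} {H : hilbertType R}.
Implicit Types (x y z : H) (a b : R[i]) (S : set H).

Definition is_subspace S := S 0 /\ forall a x y, S x -> S y -> S (a *: x + y).
Definition closed_subspace S := closed S /\ is_subspace S.

Lemma subspaceD S x y : is_subspace S -> S x -> S y -> S (x + y).
Proof. by move=> [_ h] Sx Sy; rewrite -[x]scale1r; exact: h. Qed.
Lemma subspaceZ S a x : is_subspace S -> S x -> S (a *: x).
Proof. by move=> [h0 h] Sx; rewrite -[_ *: _]addr0; exact: h. Qed.
Lemma subspaceN S x : is_subspace S -> S x -> S (- x).
Proof. by move=> h Sx; rewrite -scaleN1r; exact: subspaceZ. Qed.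
Lemma subspaceB S x y : is_subspace S -> S x -> S y -> S (x - y).
Proof. by move=> h Sx Sy; apply: subspaceD => //; exact: subspaceN. Qed.
Lemma subspace_sum S I (r : seq I) (P : pred I) (F : I -> H) : is_subspace S ->
  (forall i, P i -> S (F i)) -> S (\sum_(i <- r | P i) F i).
Proof.
move=> hS hF; elim/big_rec : _ => [|i u Pi Su]; first exact: hS.1.
by apply: subspaceD => //; exact: hF.
Qed.

Lemma orthogonal_to_closed S : closed_subspace (orthogonal_to S).
Proof.
split.
  apply/closedP => x hx y Sy; apply: cabs_eq0; apply/eqP.
  rewrite eq_le cabs_ge0 andbT; apply/ler_addgt0Pr => e e0; rewrite add0r.
  have n0 : 0 < nrm y + 1 by rewrite ltr_wpDl ?nrm_ge0.
  have [z Sz xz] := hx _ (divr_gt0 e0 n0).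
  have -> : <|x, y|> = <|x - z, y|> by rewrite ipBl (Sz _ Sy) subr0.
  apply: (le_trans (cauchy_schwarz _ _)); rewrite -(@ler_pM2r _ (nrm y + 1)^-1) ?invr_gt0//.
  rewrite -mulrA; apply: le_trans xz; rewrite ler_piMr ?nrm_ge0//.
  by rewrite ler_pdivrMr// mul1r lerDl.
split=> [y _|a x y Sx Sy z Sz]; first by rewrite ip0l.
by rewrite ipDl ipZl Sx// Sy// mulr0 addr0.
Qed.

Lemma orthogonal_to_sub S : is_subspace (orthogonal_to S).
Proof. exact: (orthogonal_to_closed S).2. Qed.

Lemma nearest_point S x : closed_subspace S ->
  exists2 y, S y & forall z, S z -> nrm (x - y) <= nrm (x - z).
Proof.
move=> [cS sS].
pose D := [set (nrm (x - y)) | y in S].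
have D0 : lbound D 0 by move=> _ [y _ <-]; exact: nrm_ge0.
have hD : has_inf D by split; [exists (nrm (x - 0)), 0 => //; exact: sS.1|exists 0].
pose d := inf D.
have d0 : 0 <= d by apply: lb_le_inf => //; exact: hD.1.
have dle z : S z -> d <= nrm (x - z) by move=> Sz; apply: ge_inf; [exists 0|exists z].
(* Parallelogram law for [x - y] and [x - z]: their midpoint is still at distance at least [d] from
   0, so two nearly minimizing points are close to each other. *)
have dm y z : S y -> S z ->
    nrm (y - z) ^+ 2 <= 2 * nrm (x - y) ^+ 2 + 2 * nrm (x - z) ^+ 2 - 4 * d ^+ 2.
  move=> Sy Sz; have := parallelogram (x - z) (x - y).
  have -> : x - z - (x - y) = y - z by rewrite opprB addrC addrA subrK.
  have -> : x - z + (x - y) = 2%:R%:C *: (x - 2^-1%:C *: (y + z)).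
    rewrite scalerBr scalerA -rmorphM /= divff// scale1r.
    by rewrite rmorph_nat scaler_nat mulr2n addrACA -opprD (addrC z).
  rewrite nrmZ cabs_pos// exprMn => E.
  have := dle _ (subspaceZ 2^-1%:C sS (subspaceD sS Sy Sz)).
  rewrite -(@ler_pXn2r _ 2)// ?nnegrE ?nrm_ge0// => h.
  lra.
have /choice [u hu] : forall n : nat, exists y, S y /\
    nrm (x - y) ^+ 2 <= d ^+ 2 + n.+1%:R^-1.
  move=> n.
  have h : d < Num.sqrt (d ^+ 2 + n.+1%:R^-1).
    have p : 0 < d ^+ 2 + n.+1%:R^-1 by rewrite ltr_wpDl ?sqr_ge0.
    by rewrite -{1}(ger0_norm d0) -sqrtr_sqr ltr_sqrt// ltrDl invr_gt0.
  have [_ [y Sy <-] hy] := inf_lt hD.1 h.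
  exists y; split=> //; rewrite -(@sqr_sqrtr _ (_ + _)) ?addr_ge0 ?sqr_ge0//.
  by rewrite ler_pXn2r ?nnegrE ?nrm_ge0 ?sqrtr_ge0 ?ltW.
have [y uy] : exists y, tends u y.
  apply: nrm_complete => e e0.
  have e4 : 0 < e ^+ 2 / 4 by rewrite divr_gt0// exprn_gt0.
  have [N hN] := small_invn e4; exists N => m n Nm Nn.
  apply: le_nrm_sqr; first exact: ltW.
  have [Sm um] := hu m; have [Sn un] := hu n.
  have {}um : nrm (x - u m) ^+ 2 <= d ^+ 2 + e ^+ 2 / 4 by rewrite (le_trans um)// lerD2l hN.
  have {}un : nrm (x - u n) ^+ 2 <= d ^+ 2 + e ^+ 2 / 4 by rewrite (le_trans un)// lerD2l hN.
  apply: (le_trans (dm _ _ Sm Sn)); move: um un.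
  move: (nrm _ ^+ 2) (nrm _ ^+ 2) (d ^+ 2) (e ^+ 2) => p q r t; lra.
have Sy : S y by apply: (closed_tends cS _ uy) => n; exact: (hu n).1.
exists y => // z Sz; apply: le_trans (dle _ Sz).
apply/ler_addgt0Pr => e e0.
have e2 : 0 < e / 2 by rewrite divr_gt0.
have [N1 h1] := uy _ e2.
have e3 : 0 < (e / 2) ^+ 2 by rewrite exprn_gt0.
have [N2 h2] := small_invn e3.
pose n := maxn N1 N2.
have {}h1 := h1 n (leq_maxl _ _); have {}h2 := h2 n (leq_maxr _ _).
apply: (le_trans (nrm_triB _ (u n) _)); rewrite [e]splitr addrA lerD//.
apply: le_nrm_sqr; first by rewrite addr_ge0// ltW.
apply: (le_trans (hu n).2); rewrite sqrrD lerD// lerDl mulrn_wge0//.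
by rewrite mulr_ge0// ltW.
Qed.

Lemma nrm_gt0 x : x <> 0 -> 0 < nrm x.
Proof.
by move=> x0; rewrite lt_neqAle nrm_ge0 andbT eq_sym; apply/eqP => /nrm_eq0.
Qed.

Lemma realC_neq0 (r : R) : r != 0 -> r%:C != 0 :> R[i].
Proof. by rewrite (inj_eq (@complexI R) _ 0). Qed.

Lemma projection_theorem S x : closed_subspace S ->
  exists y, S y /\ orthogonal_to S (x - y).
Proof.
move=> hS; have [y Sy hy] := nearest_point x hS; exists y; split=> // z Sz.
have [->|/eqP/nrm_gt0 z0] := eqVneq z 0; first by rewrite ip0r.
pose w := x - y; pose c := <|w, z|> / (nrm z ^+ 2)%:C.
have zC : (nrm z ^+ 2)%:C != 0 :> R[i].
  by rewrite realC_neq0// expf_neq0// gt_eqF.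
have wz0 : <|w - c *: z, z|> = 0 by rewrite ipBl ipZl ip_nrm divfK// subrr.
have wz : <|w - c *: z, c *: z|> = 0 by rewrite ipZr wz0 mulr0.
(* Moving [y] by the component [c *: z] of [w] along [z] would shorten the distance, unless this
   component is 0. *)
have := hy _ (subspaceD hS.2 Sy (subspaceZ c hS.2 Sz)).
rewrite opprD addrA -/w -(@ler_pXn2r _ 2)// ?nnegrE ?nrm_ge0//.
rewrite -{1}(subrK (c *: z) w) (pythagoras wz) gerDl => h.
have {h} : nrm (c *: z) ^+ 2 = 0 by apply/eqP; rewrite eq_le h sqr_ge0.
move=> /eqP; rewrite sqrf_eq0 => /eqP/nrm_eq0 cz.
by move: wz0; rewrite cz subr0.
Qed.

Lemma orthoproj_in S x : closed_subspace S -> S (orthoproj S x).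
Proof.
move=> hS; exact: (getPex (projection_theorem x hS)).1.
Qed.

Lemma orthoproj_orth S x y : closed_subspace S -> S y ->
  <|x - orthoproj S x, y|> = 0.
Proof.
move=> hS; exact: (getPex (projection_theorem x hS)).2.
Qed.

Lemma orthoproj_uniq S x y : closed_subspace S -> S y ->
  orthogonal_to S (x - y) -> orthoproj S x = y.
Proof.
move=> hS Sy hy; apply/eqP; rewrite -subr_eq0; apply/eqP/ip_eq0.
have Sd := subspaceB hS.2 (orthoproj_in x hS) Sy.
have E : orthoproj S x - y = x - y - (x - orthoproj S x).
  by rewrite opprB [RHS]addrC addrA subrK.
by rewrite {1}E ipBl hy// orthoproj_orth// subrr.
Qed.

Lemma orthoproj_id S x : closed_subspace S -> S x -> orthoproj S x = x.
Proof.
by move=> hS Sx; apply: orthoproj_uniq => // y _; rewrite subrr ip0l.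
Qed.

Lemma orthoproj0 S x : closed_subspace S -> orthogonal_to S x -> orthoproj S x = 0.
Proof.
by move=> hS Sx; apply: orthoproj_uniq => //; [exact: hS.2.1|rewrite subr0].
Qed.

Lemma ortho_ortho S : closed_subspace S -> orthogonal_to (orthogonal_to S) = S.
Proof.
move=> hS; apply/seteqP; split=> x; last by move=> Sx y Sy; apply/ip_eq0C/Sy.
move=> hx; rewrite -(_ : orthoproj S x = x); first exact: orthoproj_in.
apply/eqP; rewrite eq_sym -subr_eq0; apply/eqP/ip_eq0.
have d : orthogonal_to S (x - orthoproj S x) by move=> y; exact: orthoproj_orth.
rewrite {1}ipBl hx// sub0r; apply/eqP; rewrite oppr_eq0; apply/eqP/ip_eq0C/d.
exact: orthoproj_in.
Qed.

Lemma orthoprojC S x : closed_subspace S ->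
  orthoproj (orthogonal_to S) x = x - orthoproj S x.
Proof.
move=> hS; apply: orthoproj_uniq.
- exact: orthogonal_to_closed.
- by move=> y; exact: orthoproj_orth.
- by rewrite subKr => y hy; apply: ip_eq0C; apply: hy; exact: orthoproj_in.
Qed.

End Projection.

(** * Bounded operators, Riesz representation and adjoints *)

Section BoundedOperators.
Context {R : realType} {H : hilbertType R}.
Implicit Types (x y z : H) (a b : R[i]) (S : set H) (A B T : H -> H).

Lemma linD A (lA : linear A) x y : A (x + y) = A x + A y.
Proof. by have := lA 1 x y; rewrite !scale1r. Qed.
Lemma lin0 A (lA : linear A) : A 0 = 0.
Proof. by apply: (addrI (A 0)); rewrite -(linD lA) !addr0. Qed.
Lemma linZ A (lA : linear A) a x : A (a *: x) = a *: A x.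
Proof. by have := lA a x 0; rewrite !addr0 (lin0 lA) addr0. Qed.
Lemma linN A (lA : linear A) x : A (- x) = - A x.
Proof. by rewrite -scaleN1r (linZ lA) scaleN1r. Qed.
Lemma linB A (lA : linear A) x y : A (x - y) = A x - A y.
Proof. by rewrite (linD lA) (linN lA). Qed.
Lemma lin_sum A (lA : linear A) I (r : seq I) (P : pred I) (F : I -> H) :
  A (\sum_(i <- r | P i) F i) = \sum_(i <- r | P i) A (F i).
Proof. by apply: big_morph => [x y|]; [exact: linD|exact: lin0]. Qed.

Definition bound_by A (c : R) := forall x, nrm (A x) <= c * nrm x.

Lemma bounded_opE A (c : R) : linear A -> bound_by A c -> bounded_op A.
Proof.
move=> lA hc; split=> //; exists c => x.
by rewrite !nrmE -rmorphM lecR.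
Qed.

Lemma bounded_bound A : bounded_op A -> exists2 c : R, 0 < c & bound_by A c.
Proof.
move=> [lA [c hc]]; exists (`|c| + 1); first by rewrite ltr_wpDl.
move=> x; have := hc x; rewrite !nrmE -rmorphM lecR => /le_trans; apply.
rewrite ler_wpM2r ?nrm_ge0// (le_trans (ler_norm c))// lerDl//.
Qed.

Lemma bounded_id : bounded_op (id : H -> H).
Proof. by apply: (@bounded_opE _ 1) => // x; rewrite mul1r. Qed.

Lemma bounded_cst0 : bounded_op (fun _ : H => 0 : H).
Proof.
apply: (@bounded_opE _ 0) => [a x y|x]; first by rewrite scaler0 addr0.
by rewrite nrm0 mul0r.
Qed.

Lemma bounded_comp A B : bounded_op A -> bounded_op B -> bounded_op (A \o B).
Proof.
move=> hA hB; have [c c0 hc] := bounded_bound hA; have [d d0 hd] := bounded_bound hB.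
apply: (@bounded_opE _ (c * d)) => [a x y|x] /=.
  by rewrite (linD hB.1) (linZ hB.1) (linD hA.1) (linZ hA.1).
by rewrite (le_trans (hc _))// -mulrA ler_pM2l.
Qed.

Lemma bounded_add A B : bounded_op A -> bounded_op B -> bounded_op (A \+ B).
Proof.
move=> hA hB; have [c c0 hc] := bounded_bound hA; have [d d0 hd] := bounded_bound hB.
apply: (@bounded_opE _ (c + d)) => [a x y|x] /=.
  by rewrite hA.1 hB.1 scalerDr addrACA.
by rewrite (le_trans (nrmD _ _))// mulrDl lerD.
Qed.

Lemma bounded_scale a A : bounded_op A -> bounded_op (a \*: A).
Proof.
move=> hA; have [c c0 hc] := bounded_bound hA.
apply: (@bounded_opE _ (cabs a * c)) => [b x y|x] /=.
  by rewrite hA.1 scalerDr !scalerA (mulrC a).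
by rewrite nrmZ -mulrA ler_wpM2l ?cabs_ge0.
Qed.

Lemma sub_funE A B : A \- B = A \+ (-1 \*: B).
Proof. by apply/funext => x /=; rewrite scaleN1r. Qed.

Lemma bounded_sub A B : bounded_op A -> bounded_op B -> bounded_op (A \- B).
Proof.
by move=> hA hB; rewrite sub_funE; apply: bounded_add => //; exact: bounded_scale.
Qed.

Lemma tends_op A (u : nat -> H) x : bounded_op A -> tends u x -> tends (A \o u) (A x).
Proof.
move=> hA ux e e0; have [c c0 hc] := bounded_bound hA.
have [N hN] := ux _ (divr_gt0 e0 c0); exists N => n /hN h /=.
by rewrite -(linB hA.1) (le_trans (hc _))// mulrC -ler_pdivlMr.
Qed.

Lemma nullspace_closed A : bounded_op A -> closed_subspace (nullspace A).
Proof.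
move=> hA; have lA := hA.1; split; last first.
  split=> [|a x y]; rewrite /nullspace /=; first exact: (lin0 lA).
  by move=> Ax Ay; rewrite lA Ax Ay scaler0 addr0.
have [c c0 hc] := bounded_bound hA; apply/closedP => x hx.
apply/nrm_eq0/eqP; rewrite eq_le nrm_ge0 andbT; apply/ler_addgt0Pr => e e0.
rewrite add0r; have [y Ay xy] := hx _ (divr_gt0 e0 c0).
rewrite -[A x]subr0 -[X in _ - X]Ay -(linB lA) (le_trans (hc _))//.
by rewrite mulrC -ler_pdivlMr.
Qed.

Lemma range_subspace A : linear A -> is_subspace (range A).
Proof.
move=> lA; split; first by exists 0 => //; rewrite (lin0 lA).
by move=> a _ _ [x _ <-] [y _ <-]; exists (a *: x + y) => //; rewrite linD// linZ.
Qed.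

Lemma orthoproj_bounded S : closed_subspace S -> bounded_op (orthoproj S).
Proof.
move=> hS; apply: (@bounded_opE _ 1) => [a x y|x].
  apply: orthoproj_uniq => //; first by apply: hS.2.2; exact: orthoproj_in.
  move=> z Sz; rewrite opprD addrACA -scalerBr ipDl ipZl !orthoproj_orth//.
  by rewrite mulr0 addr0.
rewrite mul1r; apply: le_nrm_sqr; first exact: nrm_ge0.
rewrite -[in leRHS](subrK (orthoproj S x) x) pythagoras ?lerDr ?sqr_ge0//.
by rewrite orthoproj_orth//; exact: orthoproj_in.
Qed.

Lemma orthoproj_idem S : closed_subspace S ->
  orthoproj S \o orthoproj S = orthoproj S.
Proof.
by move=> hS; apply/funext => x /=; rewrite orthoproj_id//; exact: orthoproj_in.
Qed.

Lemma orthoproj_sym S x y : closed_subspace S ->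
  <|orthoproj S x, y|> = <|x, orthoproj S y|>.
Proof.
move=> hS; have px := orthoproj_in x hS; have py := orthoproj_in y hS.
rewrite -[in LHS](subrK (orthoproj S y) y) -[in RHS](subrK (orthoproj S x) x).
by rewrite ipDr ipDl orthoproj_orth// (ip_eq0C (orthoproj_orth _ _ px)).
Qed.

Lemma range_orthoproj S : closed_subspace S -> range (orthoproj S) = S.
Proof.
move=> hS; apply/seteqP; split=> [_ [x _ <-]|x Sx]; first exact: orthoproj_in.
by exists x => //; rewrite orthoproj_id.
Qed.

Lemma nullspace_orthoproj S : closed_subspace S ->
  nullspace (orthoproj S) = orthogonal_to S.
Proof.
move=> hS; apply/seteqP; split=> x; last exact: orthoproj0.
by rewrite /nullspace /= => h y Sy; rewrite -[x]subr0 -h orthoproj_orth.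
Qed.

Lemma riesz (f : H -> R[i]) (c : R) :
  (forall a x y, f (a *: x + y) = a * f x + f y) ->
  (forall x, cabs (f x) <= c * nrm x) -> exists z, forall x, f x = <|x, z|>.
Proof.
move=> lf hc.
have f0 : f 0 = 0 by apply: (addrI (f 0)); have := lf 1 0 0; rewrite scale1r mul1r !addr0.
have fB x y : f (x - y) = f x - f y.
  by rewrite addrC -scaleN1r lf mulN1r addrC.
have hS : closed_subspace [set x | f x = 0].
  split; last by split=> //= a x y fx fy; rewrite lf fx fy mulr0 addr0.
  apply/closedP => x hx /=; apply: cabs_eq0; apply/eqP.
  rewrite eq_le cabs_ge0 andbT; apply/ler_addgt0Pr => e e0; rewrite add0r.
  have c0 : 0 < `|c| + 1 by rewrite ltr_wpDl.
  have [y /= fy xy] := hx _ (divr_gt0 e0 c0).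
  rewrite -[f x]subr0 -fy -fB (le_trans (hc _))//.
  rewrite (@le_trans _ _ ((`|c| + 1) * nrm (x - y)))//.
    by rewrite ler_wpM2r ?nrm_ge0// (le_trans (ler_norm c))// lerDl.
  by rewrite mulrC -ler_pdivlMr.
have [h|] := pselect (forall x, f x = 0).
  by exists 0 => x; rewrite h ip0r.
move=> /existsNP [x0 fx0]; set K := [set x | _] in hS.
pose w := x0 - orthoproj K x0.
have fw : f w <> 0 by rewrite /w fB (orthoproj_in x0 hS) subr0.
have w0 : 0 < nrm w by apply: nrm_gt0 => w0; apply: fw; rewrite w0.
have wC : (nrm w ^+ 2)%:C != 0 :> R[i].
  by rewrite realC_neq0// expf_neq0// gt_eqF.
(* [w] is orthogonal to the kernel of [f] and [x - (f x / f w) w] lies in it, which determines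
   [<x, w>] and hence the scalar. *)
exists (Num.conj (f w / (nrm w ^+ 2)%:C) *: w) => x.
have Kx : K (x - (f x / f w) *: w).
  have fZ a y : f (a *: y) = a * f y by have := lf a y 0; rewrite f0 !addr0.
  by rewrite /K /= fB fZ divfK ?subrr//; exact/eqP.
have := ip_eq0C (orthoproj_orth x0 hS Kx).
rewrite -/w ipBl ipZl ip_nrm => /eqP; rewrite subr_eq0 => /eqP h.
rewrite ipZr h conjCK; move/eqP: fw; move: wC; move: (_%:C) (f w) => n d n0 d0.
by field; rewrite n0 d0.
Qed.

Lemma adjoint_exists A y : bounded_op A -> exists z, forall x, <|A x, y|> = <|x, z|>.
Proof.
move=> hA; have [c c0 hc] := bounded_bound hA; have lA := hA.1.
apply: (@riesz (fun x => <|A x, y|>) (c * nrm y)) => [a x z|x].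
  by rewrite lA ipDl ipZl.
by rewrite (le_trans (cauchy_schwarz _ _))// mulrAC ler_wpM2r ?nrm_ge0.
Qed.

Lemma adjP A x y : bounded_op A -> <|A x, y|> = <|x, adjoint A y|>.
Proof. by move=> hA; exact: (getPex (adjoint_exists y hA)). Qed.

Lemma adjPr A x y : bounded_op A -> <|x, A y|> = <|adjoint A x, y|>.
Proof. by move=> hA; rewrite ipC adjP// -ipC. Qed.

Lemma adjoint_uniq A B : bounded_op A ->
  (forall x y, <|A x, y|> = <|x, B y|>) -> adjoint A = B.
Proof.
by move=> hA h; apply/funext => y; apply: ip_extr => z; rewrite -adjP.
Qed.

Lemma adjoint_linear A : bounded_op A -> linear (adjoint A).
Proof.
move=> hA a x y; apply: ip_extr => z.
by rewrite -adjP// !ipDr !ipZr !adjP.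
Qed.

Lemma adjoint_bound A c : bounded_op A -> bound_by A c -> bound_by (adjoint A) c.
Proof.
move=> hA hc x; set y := adjoint A x.
have [->|/eqP/nrm_gt0 y0] := eqVneq y 0.
  have [->|/eqP/nrm_gt0 x0] := eqVneq x 0; first by rewrite nrm0 mulr0.
  have := le_trans (nrm_ge0 _) (hc x); rewrite nrm0 => /le_trans; apply.
  by rewrite lexx.
(* [nrm y ^+ 2 = <A y, x>] for [y = adjoint A x]. *)
rewrite -(ler_pM2r y0) -expr2 -Re_ip {2}/y -adjP//.
rewrite (le_trans (Re_le_cabs _))// (le_trans (cauchy_schwarz _ _))//.
by rewrite mulrAC ler_wpM2r ?nrm_ge0.
Qed.

Lemma adjoint_bounded A : bounded_op A -> bounded_op (adjoint A).
Proof.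
move=> hA; have [c c0 hc] := bounded_bound hA.
by apply: (@bounded_opE _ c); [exact: adjoint_linear|exact: adjoint_bound].
Qed.

Lemma adjointK A : bounded_op A -> adjoint (adjoint A) = A.
Proof.
move=> hA; apply: adjoint_uniq => [|x y]; first exact: adjoint_bounded.
by rewrite ipC -adjP// -ipC.
Qed.

Lemma adjoint_comp A B : bounded_op A -> bounded_op B ->
  adjoint (A \o B) = adjoint B \o adjoint A.
Proof.
move=> hA hB; apply: adjoint_uniq => [|x y /=]; first exact: bounded_comp.
by rewrite !adjP.
Qed.

Lemma adjoint_add A B : bounded_op A -> bounded_op B ->
  adjoint (A \+ B) = adjoint A \+ adjoint B.
Proof.
move=> hA hB; apply: adjoint_uniq => [|x y /=]; first exact: bounded_add.
by rewrite ipDl ipDr !adjP.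
Qed.

Lemma adjoint_sub A B : bounded_op A -> bounded_op B ->
  adjoint (A \- B) = adjoint A \- adjoint B.
Proof.
move=> hA hB; apply: adjoint_uniq => [|x y /=]; first exact: bounded_sub.
by rewrite ipBl ipBr !adjP.
Qed.

Lemma adjoint_id : adjoint (id : H -> H) = id.
Proof. exact: adjoint_uniq bounded_id _. Qed.

Lemma adjoint_orthoproj S : closed_subspace S -> adjoint (orthoproj S) = orthoproj S.
Proof.
move=> hS; apply: adjoint_uniq => [|x y]; first exact: orthoproj_bounded.
exact: orthoproj_sym.
Qed.

Lemma range_orthoC A : bounded_op A -> orthogonal_to (range A) = nullspace (adjoint A).
Proof.
move=> hA; apply/seteqP; split=> y /=.
  move=> h; apply: ip_extr => x; rewrite -adjP// ip0r; apply/ip_eq0C/h.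
  by exists x.
by move=> h _ [x _ <-]; rewrite adjPr// h ip0l.
Qed.

End BoundedOperators.

(** * Uniform boundedness, lower bounds, closed ranges and inverses *)

Section ClosedRange.
Context {R : realType} {H : hilbertType R}.
Implicit Types (x y z : H) (a b : R[i]) (S : set H) (A B T : H -> H).

Lemma le_eps_scaled (u v c : R) : 0 <= c ->
  (forall e : R, 0 < e -> u <= v + c * e) -> u <= v.
Proof.
move=> c0 h; apply/ler_addgt0Pr => e e0.
have c1 : 0 < c + 1 by rewrite ltr_wpDl.
apply: (le_trans (h _ (divr_gt0 e0 c1))); rewrite lerD2l mulrA ler_pdivrMr// mulrC.
by rewrite ler_pM2l// lerDl.
Qed.

Lemma tends_le (u : nat -> H) x y (c : R) N : tends u x ->
  (forall n, (N <= n)%N -> nrm (u n - y) <= c) -> nrm (x - y) <= c.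
Proof.
move=> ux hc; apply/ler_addgt0Pr => e /ux[M hM].
rewrite [leRHS]addrC (le_trans (nrm_triB _ (u (maxn N M)) _))// lerD//.
  by rewrite nrmBC hM// leq_maxr.
by rewrite hc// leq_maxl.
Qed.

(** The bound is the tail of the geometric series of ratio 1/3. With this ratio, all moves after the
    [n]-th amount to at most half of it, which the gliding hump below relies on. *)
Lemma geometric_tends (u : nat -> H) :
  (forall n, nrm (u n.+1 - u n) <= 3^-1 ^+ n) ->
  exists x, forall n, nrm (x - u n) <= 3 / 2 * 3^-1 ^+ n.
Proof.
move=> hu.
have hk n k : nrm (u (n + k)%N - u n) <= 3 / 2 * 3^-1 ^+ n - 3 / 2 * 3^-1 ^+ (n + k).
  elim: k => [|k ih]; first by rewrite addn0 !subrr nrm0.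
  apply: (le_trans (nrm_triB _ (u (n + k)%N) _)); rewrite addnS.
  apply: (le_trans (lerD (hu _) ih)); rewrite (exprS _ (n + k)).
  by move: (_ ^+ n) (_ ^+ (n + k)) => p q; lra.
have hm n m : (n <= m)%N -> nrm (u m - u n) <= 3 / 2 * 3^-1 ^+ n.
  move=> nm; rewrite -(subnKC nm) (le_trans (hk _ _))// gerBl.
  by rewrite mulr_ge0// exprn_ge0.
have [x ux] : exists x, tends u x.
  apply: nrm_complete => e e0.
  have e3 : 0 < e / 3 by rewrite divr_gt0.
  have [N hN] := small_invn e3.
  have pN k : 3^-1 ^+ k <= k.+1%:R^-1 :> R.
    rewrite exprVn lef_pV2 ?posrE ?exprn_gt0//.
    elim: k => // k ih; rewrite exprS (le_trans _ (ler_wpM2l _ ih))//.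
    by rewrite -natrM ler_nat; lia.
  have {hN} := le_trans (pN N) (hN N (leqnn N)) => hN.
  exists N => m n Nm Nn; apply: (le_trans (nrm_triB _ (u N) _)).
  rewrite [X in _ + X <= _]nrmBC; have := hm _ _ Nm; have := hm _ _ Nn; lra.
by exists x => n; apply: (tends_le ux) => m; exact: hm.
Qed.

(* Sokal's gliding hump: for every x, one of x +- xi has |<x +- xi, z>| >= |<xi, z>|. *)
Lemma uniform_boundedness S :
  (forall w, exists M : R, forall z, S z -> cabs <|w, z|> <= M) ->
  exists M : R, forall z, S z -> nrm z <= M.
Proof.
move=> hS; apply: contrapT => /forallNP hM.
(* The factor [2 * 3 ^+ n] compensates the step size [3^-n] and the half lost to later steps, so
   that a pairing of size at least [n] survives. *)
have /choice [z hz] : forall n : nat, exists z, S z /\ n%:R * 2 * 3 ^+ n < nrm z.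
  move=> n; apply: contrapT => /forallNP h; apply: (hM (n%:R * 2 * 3 ^+ n)) => y Sy.
  by rewrite leNgt; apply/negP => hy; apply: (h y).
have z0 n : 0 < nrm (z n) by apply: le_lt_trans (hz n).2; rewrite !mulr_ge0// exprn_ge0.
have step (n : nat) x : exists x', nrm (x' - x) <= 3^-1 ^+ n /\
    3^-1 ^+ n * nrm (z n) <= cabs <|x', z n|>.
  pose w := (3^-1 ^+ n / nrm (z n))%:C *: z n.
  have p3 : 0 <= 3^-1 ^+ n :> R by rewrite exprn_ge0.
  have pw : 0 <= 3^-1 ^+ n / nrm (z n) by rewrite divr_ge0// ltW.
  have nw : nrm w = 3^-1 ^+ n by rewrite nrmZ cabs_pos// divfK// gt_eqF.
  have wz : cabs <|w, z n|> = 3^-1 ^+ n * nrm (z n).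
    rewrite ipZl ip_nrm -rmorphM cabs_pos; last exact: mulr_ge0 pw (sqr_ge0 _).
    by rewrite expr2 mulrA divfK// gt_eqF.
  have [h|h] := lerP (cabs <|w, z n|>) (cabs <|x + w, z n|>).
    by exists (x + w); rewrite -wz addrAC subrr add0r nw.
  exists (x - w); rewrite addrAC subrr add0r nrmN nw -wz; split=> //.
  have : cabs (<|x + w, z n|> - <|x - w, z n|>) <= cabs <|x + w, z n|> + cabs <|x - w, z n|>.
    by rewrite (le_trans (cabsD _ _))// cabsN.
  have -> : <|x + w, z n|> - <|x - w, z n|> = 2%:R%:C * <|w, z n|>.
    by rewrite ipDl ipBl rmorph_nat opprB addrC addrA subrK mulr_natl mulr2n.
  by rewrite cabsM cabs_pos//; move: h; lra.
have /choice [f hf] : forall nx : nat * H, exists x', nrm (x' - nx.2) <= 3^-1 ^+ nx.1 /\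
    3^-1 ^+ nx.1 * nrm (z nx.1) <= cabs <|x', z nx.1|> by move=> [n x]; exact: step.
pose fix u n := if n is m.+1 then f (m, u m) else 0.
have [x hx] := @geometric_tends u (fun n => (hf (n, u n)).1).
have [M hMx] := hS x.
have [n hn] : exists n : nat, M < n%:R.
  by exists (Num.truncn M).+1; exact: truncnS_gt.
have := hMx _ (hz n).1; apply/negP; rewrite -ltNge; apply: (lt_le_trans hn).
have := (hf (n, u n)).2; rewrite /= -/(u n.+1).
have -> : 3^-1 ^+ n * nrm (z n) = 2 * (2^-1 * 3^-1 ^+ n * nrm (z n)).
  by rewrite -!mulrA mulVKf.
move=> h.
(* [3 / 2 * 3^-(n+1)] is half of [3^-n]: the later steps destroy at most half of the pairing gained
   at step [n]. *)
have d : cabs <|u n.+1 - x, z n|> <= 2^-1 * 3^-1 ^+ n * nrm (z n).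
  rewrite (le_trans (cauchy_schwarz _ _))// ler_pM2r// nrmBC (le_trans (hx _))//.
  by rewrite exprS; move: (_ ^+ n) => p; lra.
have : cabs <|u n.+1, z n|> <= cabs <|x, z n|> + cabs <|u n.+1 - x, z n|>.
  by rewrite (le_trans _ (cabsD _ _))// -ipDl addrC subrK.
have : n%:R <= 2^-1 * 3^-1 ^+ n * nrm (z n).
  rewrite exprVn -invfM mulrC ler_pdivlMr ?mulr_gt0 ?exprn_gt0// mulrA.
  exact: ltW (hz n).2.
by move: d h; move: (2^-1 * 3^-1 ^+ n * nrm (z n)) => d; lra.
Qed.

Definition norm_closure S : set H := [set x | forall e : R, 0 < e -> exists2 y, S y & nrm (x - y) <= e].

Lemma sub_norm_closure S : S `<=` norm_closure S.
Proof. by move=> x Sx e e0; exists x; rewrite ?subrr ?nrm0// ltW. Qed.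

Lemma norm_closure_closed S : is_subspace S -> closed_subspace (norm_closure S).
Proof.
move=> hS; split.
  apply/closedP => x hx e e0; have e2 : 0 < e / 2 by rewrite divr_gt0.
  have [y cy xy] := hx _ e2; have [z Sz yz] := cy _ e2.
  by exists z => //; rewrite (le_trans (nrm_triB _ y _))// [e]splitr lerD.
split; first exact: sub_norm_closure hS.1.
move=> a x y cx cy e e0; have e2 : 0 < e / 2 by rewrite divr_gt0.
have a1 : 0 < cabs a + 1 by rewrite ltr_wpDl ?cabs_ge0.
have [x' Sx xx] := cx _ (divr_gt0 e2 a1); have [y' Sy yy] := cy _ e2.
exists (a *: x' + y'); first exact: hS.2.
rewrite opprD addrACA -scalerBr (le_trans (nrmD _ _))// [e]splitr lerD// nrmZ.
apply: (@le_trans _ _ ((cabs a + 1) * nrm (x - x'))).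
  by rewrite ler_wpM2r ?nrm_ge0// lerDl.
by rewrite mulrC -ler_pdivlMr.
Qed.

Definition bounded_below A S (c : R) := forall x, S x -> c * nrm x <= nrm (A x).

Lemma bounded_below_closure A S c : bounded_op A -> 0 <= c -> bounded_below A S c -> bounded_below A (norm_closure S) c.
Proof.
move=> hA c0 hc x cx; have [C C0 hC] := bounded_bound hA.
apply: (@le_eps_scaled _ _ (C + c)) => [|e e0]; first by rewrite addr_ge0// ltW.
have [y Sy xy] := cx _ e0.
have h1 : nrm x <= nrm y + e.
  by rewrite -(subrK y x) addrC (le_trans (nrmD _ _))// lerD2l.
have h2 : nrm (A y) <= nrm (A x) + C * e.
  rewrite -(subrK (A x) (A y)) addrC (le_trans (nrmD _ _))// lerD2l -(linB hA.1).
  by rewrite (le_trans (hC _))// nrmBC ler_pM2l.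
have := hc _ Sy; have := ler_wpM2l c0 h1; rewrite mulrDr mulrDl; lra.
Qed.

(** The lower bound makes preimages of a convergent sequence Cauchy. *)
Lemma below_image_closed A S c : bounded_op A -> closed_subspace S -> 0 < c ->
  bounded_below A S c -> closed (A @` S).
Proof.
move=> hA hS c0 hc; apply/closedP => y hy.
have /choice [x hx] : forall n : nat, exists x, S x /\ nrm (y - A x) <= n.+1%:R^-1.
  move=> n; have [|_ [x Sx <-] h] := hy n.+1%:R^-1; first by rewrite invr_gt0.
  by exists x.
have [l xl] : exists l, tends x l.
  apply: nrm_complete => e e0.
  have ce : 0 < c * (e / 2) by rewrite mulr_gt0// divr_gt0.
  have [N hN] := small_invn ce; exists N => m n Nm Nn.
  rewrite -(ler_pM2l c0) (le_trans (hc _ (subspaceB hS.2 (hx m).1 (hx n).1)))//.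
  rewrite (linB hA.1) (le_trans (nrm_triB _ y _))// nrmBC [e]splitr mulrDr lerD//.
    by rewrite (le_trans (hx m).2)// hN.
  by rewrite (le_trans (hx n).2)// hN.
exists l; first by apply: (closed_tends hS.1 _ xl) => n; exact: (hx n).1.
apply: (tends_unique (tends_op hA xl)) => e e0.
have [N hN] := small_invn e0; exists N => n Nn /=.
by rewrite nrmBC (le_trans (hx n).2)// hN.
Qed.

(* Uniform boundedness, applied to the [z] in [R(A)] with [|A^* z| <= 1], bounds
   [A^*] below on [R(A)], hence [A] below on [A^* (R(A))], which is dense in the
   orthogonal complement of [N(A)]. *)
Lemma closed_range_below A : bounded_op A -> closed (range A) ->
  exists2 c : R, 0 < c & bounded_below A (orthogonal_to (nullspace A)) c.
Proof.
move=> hA cA; have hA' := adjoint_bounded hA.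
have [M hM] : exists M : R, forall z, [set z | range A z /\ nrm (adjoint A z) <= 1] z -> nrm z <= M.
  apply: uniform_boundedness => w.
  have hR : closed_subspace (range A) by split=> //; exact: range_subspace hA.1.
  have [x _ xE] := orthoproj_in w hR.
  exists (nrm x) => z [Rz Az].
  (* Only the component [A x] of [w] in [R(A)] sees [z], and [<A x, z> = <x, adjoint A z>] is
     bounded by [nrm x]. *)
  have -> : <|w, z|> = <|A x, z|>.
    by rewrite xE; apply/eqP; rewrite -subr_eq0 -ipBl orthoproj_orth.
  rewrite adjP// (le_trans (cauchy_schwarz _ _))// ler_piMr ?nrm_ge0//.
have {}hM z : range A z -> nrm z <= (`|M| + 1) * nrm (adjoint A z).
  move=> Rz; have [Az|/eqP/nrm_gt0 Az] := eqVneq (adjoint A z) 0.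
    have : orthogonal_to (range A) z by rewrite range_orthoC.
    by move=> /(_ _ Rz)/ip_eq0 ->; rewrite (lin0 hA'.1) nrm0 mulr0.
  have p : 0 <= (nrm (adjoint A z))^-1 by rewrite invr_ge0 ltW.
  have := hM ((nrm (adjoint A z))^-1%:C *: z); rewrite /= (linZ hA'.1) !nrmZ cabs_pos//.
  rewrite mulVf ?gt_eqF// => /(_ _)/le_trans h; rewrite -ler_pdivrMr// mulrC.
  apply: h; last by rewrite (le_trans (ler_norm _))// lerDl.
  split=> //; exact: subspaceZ (range_subspace hA.1) Rz.
have M1 : 0 < `|M| + 1 by rewrite ltr_wpDl.
exists (`|M| + 1)^-1; first by rewrite invr_gt0.
pose S := adjoint A @` range A.
have sS : is_subspace S.
  split; first by exists 0; [exact: (range_subspace hA.1).1|exact: (lin0 hA'.1)].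
  move=> a _ _ [z Rz <-] [w Rw <-]; exists (a *: z + w); last by rewrite hA'.1.
  exact: (range_subspace hA.1).2 _ _ _ Rz Rw.
have bS : bounded_below A S (`|M| + 1)^-1.
  move=> _ [z Rz <-]; set x := adjoint A z.
  have [->|/eqP/nrm_gt0 x0] := eqVneq x 0; first by rewrite nrm0 mulr0 nrm_ge0.
  rewrite ler_pdivrMl// -(ler_pM2l x0) -expr2 -Re_ip {1}/x -adjPr//.
  rewrite (le_trans (Re_le_cabs _))// (le_trans (cauchy_schwarz _ _))//.
  by rewrite mulrA ler_wpM2r ?nrm_ge0// [leRHS]mulrC hM.
(* If [x] is orthogonal to [adjoint A (A x)], then [A x = 0]; hence [S] is dense in the orthogonal
   complement of [N(A)]. *)
have N : nullspace A = orthogonal_to (norm_closure S).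
  apply/seteqP; split=> x; last first.
    move=> h; apply: ip_eq0; rewrite adjP//; apply: h; apply: sub_norm_closure.
    by exists (A x) => //; exists x.
  move=> Ax; have cN := nullspace_closed hA.
  have : norm_closure S `<=` orthogonal_to (nullspace A).
    move=> y cy; move: (orthogonal_to_closed (nullspace A)).1 => /closedP; apply.
    move=> e /cy[_ [z Rz <-] h]; exists (adjoint A z) => // t At.
    by rewrite -adjPr// At ip0r.
  by move=> h y /h hy; apply/ip_eq0C/hy.
by rewrite N (ortho_ortho (norm_closure_closed sS)); apply: bounded_below_closure => //; rewrite invr_ge0 ltW.
Qed.

Lemma inverse_exists A c : bounded_op A -> 0 < c -> bounded_below A setT c ->
  (forall y, exists x, A x = y) -> invertible_op A.
Proof.
move=> hA c0 hc /choice [B hB].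
have inj x y : A x = A y -> x = y.
  move=> xy; apply/eqP; rewrite -subr_eq0; apply/eqP/nrm_eq0/eqP.
  rewrite eq_le nrm_ge0 andbT -(ler_pM2l c0) mulr0 (le_trans (hc _ _))//.
  by rewrite (linB hA.1) xy subrr nrm0.
split=> //; exists B; split; last first.
- by apply/funext => x /=; rewrite hB.
- by apply/funext => x /=; apply: inj; rewrite hB.
apply: (@bounded_opE _ _ _ c^-1) => [a x y|x].
  by apply: inj; rewrite hA.1 !hB.
by rewrite ler_pdivlMl// (le_trans (hc _ _))// hB.
Qed.

(** The lower bound closes the range, and the orthogonal complement of the range is the nullspace of
    the adjoint. *)
Lemma lax_milgram A c : bounded_op A -> 0 < c -> bounded_below A setT c ->
  (forall x, adjoint A x = 0 -> x = 0) -> invertible_op A.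
Proof.
move=> hA c0 hc hN; apply: (inverse_exists hA c0 hc) => y.
have hR : closed_subspace (range A).
  split; last exact: range_subspace hA.1.
  exact: (@below_image_closed _ _ c).
have : range A y.
  rewrite -(ortho_ortho hR) range_orthoC// => x /hN ->; exact: ip0r.
by case=> x _ <-; exists x.
Qed.

(** The bounded inverse theorem: a surjective operator has closed range, so [closed_range_below]
    supplies a lower bound, valid everywhere because the nullspace is trivial. *)
Lemma bijective_invertible A : bounded_op A -> (forall x, A x = 0 -> x = 0) ->
  (forall y, exists x, A x = y) -> invertible_op A.
Proof.
move=> hA inj sur.
have cR : closed (range A).
  rewrite (_ : range A = setT); first exact: closedT.
  by apply/seteqP; split=> // y _; have [x <-] := sur y; exists x.
have [c c0 hc] := closed_range_below hA cR.
apply: (inverse_exists hA c0) => // x _; apply: hc => y Ay.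
by rewrite (inj _ Ay) ip0r.
Qed.

Lemma op_invP A : invertible_op A -> is_inverse A (op_inv A).
Proof. by move=> [_ h]; exact: (getPex h). Qed.

Lemma op_inv_bounded A : invertible_op A -> bounded_op (op_inv A).
Proof. by move=> /op_invP[]. Qed.

Lemma op_invK A x : invertible_op A -> op_inv A (A x) = x.
Proof. by move=> /op_invP[_ h _]; have := congr1 (@^~ x) h. Qed.

Lemma op_invKr A x : invertible_op A -> A (op_inv A x) = x.
Proof. by move=> /op_invP[_ _ h]; have := congr1 (@^~ x) h. Qed.

Lemma op_inv_uniq A B : is_inverse A B -> invertible_op A -> op_inv A = B.
Proof.
move=> [hB BA AB] iA; apply/funext => x.
by rewrite -[x in LHS]/(id x) -AB /= op_invK.
Qed.

(** The Moore-Penrose inverse: [B y] is the preimage, orthogonal to [N(A)], of the projection of [y]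
    onto [R(A)]. The lower bound of a closed-range operator makes it bounded. *)
Lemma pseudo_inverse A : closed_range_op A -> exists B, [/\ bounded_op B,
  forall x, B (A x) = x - orthoproj (nullspace A) x &
  forall y, A (B y) = orthoproj (range A) y].
Proof.
move=> [hA cA]; have [c c0 hc] := closed_range_below hA cA.
have hN := nullspace_closed hA.
have hR : closed_subspace (range A) by split=> //; exact: range_subspace hA.1.
set M := orthogonal_to _ in hc.
have sM : is_subspace M := orthogonal_to_sub _.
have inj x y : M x -> M y -> A x = A y -> x = y.
  move=> Mx My xy; apply/eqP; rewrite -subr_eq0; apply/eqP/nrm_eq0/eqP.
  rewrite eq_le nrm_ge0 andbT -(ler_pM2l c0) mulr0 (le_trans (hc _ _))//.
    exact: subspaceB sM Mx My.
  by rewrite (linB hA.1) xy subrr nrm0.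
have hM x : M (x - orthoproj (nullspace A) x) by move=> y; exact: orthoproj_orth.
have AM x : A (x - orthoproj (nullspace A) x) = A x.
  by rewrite (linB hA.1) (orthoproj_in x hN) subr0.
have /choice [B hB] : forall y, exists x, M x /\ A x = orthoproj (range A) y.
  by move=> y; have [x _ <-] := orthoproj_in y hR; exists (x - orthoproj (nullspace A) x).
exists B; split.
- apply: (@bounded_opE _ _ _ c^-1) => [a x y|x].
    apply: inj; [exact: (hB _).1|by apply: sM.2; exact: (hB _).1|].
    by rewrite hA.1 !(hB _).2 (orthoproj_bounded hR).1.
  rewrite ler_pdivlMl// (le_trans (hc _ (hB _).1))// (hB _).2.
  apply: le_nrm_sqr; first exact: nrm_ge0.
  rewrite -[in leRHS](subrK (orthoproj (range A) x) x) pythagoras ?lerDr ?sqr_ge0//.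
  by rewrite orthoproj_orth//; exact: orthoproj_in.
- move=> x; apply: inj; [exact: (hB _).1|exact: hM|].
  by rewrite AM (hB _).2 orthoproj_id//; exists x.
- by move=> y; exact: (hB _).2.
Qed.

End ClosedRange.

(** * Finite-dimensional subspaces, finite-rank operators and their norm limits *)

Section FiniteDimension.
Context {R : realType} {H : hilbertType R}.
Implicit Types (x y z : H) (a b : R[i]) (S : set H) (A B T : H -> H).

Definition lspan n (v : 'I_n -> H) : set H :=
  [set \sum_i c i *: v i | c in [set: 'I_n -> R[i]]].

Definition orthon n (e : 'I_n -> H) := forall i j, <|e i, e j|> = (i == j)%:R.

Definition rank_sum n (u v : 'I_n -> H) x := \sum_i <|x, u i|> *: v i.

Lemma lspan_sub n (v : 'I_n -> H) : is_subspace (lspan v).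
Proof.
split; first by exists (fun=> 0) => //; rewrite big1// => i _; rewrite scale0r.
move=> a _ _ [c _ <-] [d _ <-]; exists (fun i => a * c i + d i) => //.
rewrite scaler_sumr -big_split; apply: eq_bigr => i _ /=.
by rewrite scalerDl scalerA.
Qed.

Lemma lspan_mem n (v : 'I_n -> H) i : lspan v (v i).
Proof.
exists (fun j => (i == j)%:R) => //; rewrite (bigD1 i)//= eqxx scale1r big1 ?addr0//.
by move=> j ji; rewrite eq_sym (negbTE ji) scale0r.
Qed.

Lemma lspan_min n (v : 'I_n -> H) S : is_subspace S -> (forall i, S (v i)) ->
  lspan v `<=` S.
Proof.
move=> hS Sv _ [c _ <-]; apply: subspace_sum => // i _; exact: subspaceZ.
Qed.

Lemma rank_sum_in n (u v : 'I_n -> H) x : lspan v (rank_sum u v x).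
Proof. by exists (fun i => <|x, u i|>). Qed.

Lemma rank_sum_bounded n (u v : 'I_n -> H) : bounded_op (rank_sum u v).
Proof.
apply: (@bounded_opE _ _ _ (\sum_i nrm (u i) * nrm (v i))) => [a x y|x].
  rewrite scaler_sumr -big_split; apply: eq_bigr => i _ /=.
  by rewrite ipDl ipZl scalerDl scalerA.
rewrite mulr_suml (le_trans (nrm_sum _ _ _))// ler_sum// => i _.
rewrite nrmZ mulrAC ler_wpM2r ?nrm_ge0// mulrC; exact: cauchy_schwarz.
Qed.

Lemma rank_sum_adjoint n (u v : 'I_n -> H) : adjoint (rank_sum u v) = rank_sum v u.
Proof.
apply: adjoint_uniq => [|x y]; first exact: rank_sum_bounded.
rewrite ip_suml ip_sumr; apply: eq_bigr => i _.
by rewrite ipZl ipZr -ipC mulrC.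
Qed.

Lemma orthon_coef n (e : 'I_n -> H) (c : 'I_n -> R[i]) j : orthon e ->
  <|\sum_i c i *: e i, e j|> = c j.
Proof.
move=> he; rewrite ip_suml (bigD1 j)//= ipZl he eqxx mulr1 big1 ?addr0//.
by move=> i ij; rewrite ipZl he (negbTE ij) mulr0.
Qed.

Lemma orthon_nrm n (e : 'I_n -> H) i : orthon e -> nrm (e i) = 1.
Proof.
by move=> he; apply/eqP; rewrite -(@eqrXn2 _ 2)// ?nrm_ge0// expr1n -Re_ip he eqxx.
Qed.

Lemma rank_sum_id n (e : 'I_n -> H) x : orthon e -> lspan e x -> rank_sum e e x = x.
Proof.
by move=> he [c _ <-]; apply: eq_bigr => i _; rewrite orthon_coef.
Qed.

Lemma rank_sum_orth n (e : 'I_n -> H) x i : orthon e -> <|x - rank_sum e e x, e i|> = 0.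
Proof. by move=> he; rewrite ipBl orthon_coef// subrr. Qed.

Lemma orthogonal_to_lspan n (v : 'I_n -> H) x :
  (forall i, <|x, v i|> = 0) -> orthogonal_to (lspan v) x.
Proof.
move=> h _ [c _ <-]; rewrite ip_sumr big1// => i _; by rewrite ipZr h mulr0.
Qed.

Definition cons_fam n (w : H) (e : 'I_n -> H) (i : 'I_n.+1) : H :=
  if unlift ord0 i is Some j then e j else w.

Lemma cons_fam0 n w (e : 'I_n -> H) : cons_fam w e ord0 = w.
Proof. by rewrite /cons_fam unlift_none. Qed.
Lemma cons_famS n w (e : 'I_n -> H) i : cons_fam w e (lift ord0 i) = e i.
Proof. by rewrite /cons_fam liftK. Qed.

Lemma lspan_recl n (v : 'I_n.+1 -> H) x :
  lspan v x <-> exists a y, lspan (v \o lift ord0) y /\ x = a *: v ord0 + y.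
Proof.
split=> [[c _ <-]|[a [y [[c _ <-] ->]]]].
  exists (c ord0), (\sum_i c (lift ord0 i) *: v (lift ord0 i)).
  by rewrite big_ord_recl; split=> //; exists (c \o lift ord0).
exists (fun i => if unlift ord0 i is Some j then c j else a) => //.
rewrite big_ord_recl unlift_none; congr (_ + _); apply: eq_bigr => i _.
by rewrite liftK.
Qed.

Lemma orthon_cons n (e : 'I_n -> H) w : orthon e -> ~ lspan e w ->
  exists u : H, orthon (cons_fam u e) /\ exists a b y,
    [/\ lspan e y, w = a *: u + y & u = b *: (w - y)].
Proof.
move=> he hw; pose y := rank_sum e e w.
have ly : lspan e y by exact: rank_sum_in.
have d0 : 0 < nrm (w - y).
  apply: nrm_gt0 => /eqP; rewrite subr_eq0 => /eqP wy; apply: hw; by rewrite wy.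
have dC : (nrm (w - y))%:C != 0 :> R[i] by rewrite realC_neq0// gt_eqF.
exists ((nrm (w - y))^-1%:C *: (w - y)); split; last first.
  exists (nrm (w - y))%:C, (nrm (w - y))^-1%:C, y; split=> //.
  by rewrite scalerA -rmorphM mulfV ?gt_eqF// scale1r subrK.
have o i : <|(nrm (w - y))^-1%:C *: (w - y), e i|> = 0.
  by rewrite ipZl rank_sum_orth// mulr0.
move=> i j; case: (unliftP ord0 i) => [i' ->|->]; case: (unliftP ord0 j) => [j' ->|->];
  rewrite ?cons_famS ?cons_fam0.
- by rewrite he (inj_eq lift_inj).
- by rewrite ipC o rmorph0 eq_sym (negbTE (neq_lift _ _)).
- by rewrite o (negbTE (neq_lift _ _)).
- rewrite eqxx ipZl ipZr conjR ip_nrm -!rmorphM expr2 mulrA mulrA.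
  by rewrite -!mulrA mulKf ?gt_eqF// mulVf ?gt_eqF.
Qed.

(** The last clause preserves the length of an independent family, so that [has_dim] can be read off
    orthonormal bases. *)
Lemma gram_schmidt n (v : 'I_n -> H) : exists m (e : 'I_m -> H),
  [/\ orthon e, lspan e = lspan v &
   (forall c : 'I_n -> R[i], \sum_i c i *: v i = 0 -> forall i, c i = 0) -> m = n].
Proof.
elim: n v => [|n ih] v.
  exists 0%N, v; split=> //; by case.
have [m [e [he lE hm]]] := ih (v \o lift ord0).
have [lw|lw] := pselect (lspan e (v ord0)).
  exists m, e; split=> //.
    apply/seteqP; split=> x.
      by rewrite lE => lx; apply/lspan_recl; exists 0, x; rewrite scale0r add0r.
    move=> /lspan_recl[a [y [ly ->]]]; apply: (lspan_sub e).2 => //.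
    by rewrite lE.
  move=> ind; exfalso; move: lw; rewrite lE => -[c _ cE].
  (* The linear relation that expresses [v ord0] through the other vectors. *)
  pose d (i : 'I_n.+1) : R[i] := if unlift ord0 i is Some j then c j else -1.
  have := ind d; rewrite big_ord_recl {1}/d unlift_none scaleN1r.
  have -> : \sum_(i < n) d (lift ord0 i) *: v (lift ord0 i) = v ord0.
    by rewrite -[RHS]cE; apply: eq_bigr => i _; rewrite /d liftK.
  rewrite addrC subrr => /(_ erefl ord0); rewrite /d unlift_none => /eqP.
  by rewrite oppr_eq0 oner_eq0.
have [u [hu [a [b [y [ly wE uE]]]]]] := orthon_cons he lw.
have cE : cons_fam u e \o lift ord0 = e.
  by apply/funext => i /=; rewrite cons_famS.
exists m.+1, (cons_fam u e); split=> //.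
  apply/seteqP; split=> x /lspan_recl[c [z [lz ->]]]; apply/lspan_recl.
    exists (c * b), (z - (c * b) *: y); split.
      by rewrite -lE; apply: subspaceB (lspan_sub e) _ (subspaceZ _ (lspan_sub e) ly); rewrite -cE.
    by rewrite cons_fam0 uE scalerA scalerBr addrAC -addrA.
  exists (c * a), (c *: y + z); split.
    by rewrite cE; apply: (lspan_sub e).2 => //; rewrite lE.
  by rewrite cons_fam0 wE scalerDr scalerA addrA.
move=> ind; congr S; apply: hm => c c0 i.
have := ind (fun i => if unlift ord0 i is Some j then c j else 0).
rewrite big_ord_recl unlift_none scale0r add0r => h.
have := h _ (lift ord0 i); rewrite liftK; apply.
by rewrite -[RHS]c0; apply: eq_bigr => j _; rewrite liftK.
Qed.

Lemma lspan_orthon_closed n (e : 'I_n -> H) : orthon e -> closed_subspace (lspan e).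
Proof.
move=> he; have hP := rank_sum_bounded e e.
have -> : lspan e = nullspace (id \- rank_sum e e).
  apply/seteqP; split=> x; rewrite /nullspace /=.
    by move=> lx; rewrite rank_sum_id// subrr.
  by move=> /eqP; rewrite subr_eq0 => /eqP ->; exact: rank_sum_in.
apply: nullspace_closed; exact: bounded_sub bounded_id hP.
Qed.

Lemma lspan_closed n (v : 'I_n -> H) : closed_subspace (lspan v).
Proof. by have [m [e [he <- _]]] := gram_schmidt v; exact: lspan_orthon_closed. Qed.

Lemma has_dim_orthon S n : has_dim S n <-> exists2 e : 'I_n -> H, orthon e & S = lspan e.
Proof.
split=> [[b ind ->]|[e he ->]].
  have [m [e [he lE hm]]] := gram_schmidt b; move: (hm ind) => mn.
  by subst m; exists e.
exists e => // c c0 i; rewrite -(orthon_coef c i he) c0; exact: ip0l.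
Qed.

Lemma has_dim_image S n B : linear B -> (forall x, S x -> B x = 0 -> x = 0) ->
  has_dim S n -> has_dim (B @` S) n.
Proof.
move=> lB inj [b ind SE]; exists (B \o b).
  move=> c; rewrite (eq_bigr (fun i => B (c i *: b i))) => [|i _]; last by rewrite (linZ lB).
  rewrite -(lin_sum lB) => /inj h; apply: ind; apply: h.
  by rewrite SE; exists c.
rewrite SE; apply/seteqP; split=> [_ [_ [c _ <-] <-]|_ [c _ <-]].
  exists c => //; rewrite (lin_sum lB); apply: eq_bigr => i _; by rewrite (linZ lB).
exists (\sum_i c i *: b i); first by exists c.
by rewrite (lin_sum lB); apply: eq_bigr => i _; rewrite (linZ lB).
Qed.

Lemma has_dim0 S n : has_dim S n -> (forall x, S x -> x = 0) -> n = 0%N.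
Proof.
move=> /has_dim_orthon[e he ->] h; case: n e he h => // n e he h.
have := he ord0 ord0; rewrite eqxx (h _ (lspan_mem e ord0)) ip0l => /esym/eqP.
by rewrite oner_eq0.
Qed.

Lemma has_dim_zero S : has_dim S 0 -> forall x, S x -> x = 0.
Proof. by move=> [b _ ->] _ [c _ <-]; rewrite big_ord0. Qed.

(** Rank-nullity for [M], carried into [H] by the injective map [phi] from row vectors to
    combinations of the [e i]. *)
Lemma lspan_kernel n (e : 'I_n -> H) (M : 'M[R[i]]_n) : orthon e ->
  has_dim [set \sum_i c 0 i *: e i | c in [set c : 'rV_n | c *m M = 0]] (n - \rank M).
Proof.
move=> he; rewrite -mxrank_ker.
pose phi (c : 'rV[R[i]]_n) := \sum_i c 0 i *: e i.
have phi_inj c : phi c = 0 -> c = 0.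
  move=> c0; apply/rowP => i; rewrite mxE -(orthon_coef (fun i => c 0 i) i he).
  by rewrite -/(phi c) c0 ip0l.
have phi_sum k (c : 'I_k -> R[i]) (K : 'M[R[i]]_(k, n)) :
    \sum_i c i *: phi (row i K) = phi (\row_i c i *m K).
  rewrite /phi; under eq_bigr do rewrite scaler_sumr.
  rewrite exchange_big; apply: eq_bigr => j _ /=.
  rewrite mxE scaler_suml; apply: eq_bigr => i _.
  by rewrite !mxE scalerA.
exists (fun i => phi (row i (row_base (kermx M)))).
  move=> c; rewrite phi_sum => /phi_inj/eqP.
  rewrite mulmx_free_eq0 ?row_base_free// => /eqP/rowP c0 i.
  by have := c0 i; rewrite !mxE.
apply/seteqP; split=> [_ [c /sub_kermxP cM <-]|_ [c _ <-]].
  have /submxP[d ->] : (c <= row_base (kermx M))%MS by rewrite eq_row_base.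
  exists (fun i => d 0 i) => //; rewrite phi_sum; congr (phi (_ *m _)).
  by apply/rowP => i; rewrite mxE.
exists (\row_i c i *m row_base (kermx M)); last by rewrite phi_sum.
apply/sub_kermxP; rewrite (submx_trans (submxMl _ _))// eq_row_base//.
Qed.

Definition finrank T := bounded_op T /\ exists n (v : 'I_n -> H), forall x, lspan v (T x).

Lemma lspan_cat m n (u : 'I_m -> H) (v : 'I_n -> H) x y : lspan u x -> lspan v y ->
  lspan (fun i => match fintype.split i with inl i => u i | inr i => v i end) (x + y).
Proof.
set w := (fun i => _) => lu lv; apply: subspaceD; first exact: lspan_sub.
  apply: (lspan_min (lspan_sub w) _ lu) => i.
  by have := lspan_mem w (lshift n i); rewrite /w (unsplitK (inl i)).
apply: (lspan_min (lspan_sub w) _ lv) => i.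
by have := lspan_mem w (rshift m i); rewrite /w (unsplitK (inr i)).
Qed.

Lemma finrank_add A B : finrank A -> finrank B -> finrank (A \+ B).
Proof.
move=> [hA [m [u hu]]] [hB [n [v hv]]]; split; first exact: bounded_add.
by eexists; eexists => x; exact: lspan_cat (hu x) (hv x).
Qed.

Lemma finrank_compl A B : bounded_op A -> finrank B -> finrank (A \o B).
Proof.
move=> hA [hB [n [v hv]]]; split; first exact: bounded_comp.
exists n, (A \o v) => x /=; have [c _ <-] := hv x; exists c => //.
by rewrite (lin_sum hA.1); apply: eq_bigr => i _; rewrite (linZ hA.1).
Qed.

Lemma finrank_compr A B : finrank A -> bounded_op B -> finrank (A \o B).
Proof.
move=> [hA [n [v hv]]] hB; split; first exact: bounded_comp.
by exists n, v => x /=.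
Qed.

Lemma finrank_rank_sum n (u v : 'I_n -> H) : finrank (rank_sum u v).
Proof.
by split; [exact: rank_sum_bounded|exists n, v => x; exact: rank_sum_in].
Qed.

Lemma finrankE A : finrank A -> exists n (e : 'I_n -> H), orthon e /\
  A = rank_sum (adjoint A \o e) e.
Proof.
move=> [hA [n [v hv]]]; have [m [e [he lE _]]] := gram_schmidt v.
exists m, e; split=> //; apply/funext => x.
rewrite -[LHS](rank_sum_id he) ?lE//; apply: eq_bigr => i _.
by rewrite adjP.
Qed.

(** In a Hilbert space these are the compact operators. The finite-rank approximants are what the
    Fredholm and spectral arguments consume. *)
Definition fapprox A := bounded_op A /\
  forall e : R, 0 < e -> exists2 F, finrank F & bound_by (A \- F) e.

Lemma finrank_fapprox A : finrank A -> fapprox A.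
Proof.
move=> hA; split; first exact: hA.1.
move=> e e0; exists A => // x /=; rewrite subrr nrm0 mulr_ge0 ?nrm_ge0 ?ltW//.
Qed.

Lemma fapprox_add A B : fapprox A -> fapprox B -> fapprox (A \+ B).
Proof.
move=> [hA aA] [hB aB]; split; first exact: bounded_add.
move=> e e0; have e2 : 0 < e / 2 by rewrite divr_gt0.
have [F fF hF] := aA _ e2; have [G fG hG] := aB _ e2.
exists (F \+ G); first exact: finrank_add.
move=> x /=; rewrite opprD addrACA (le_trans (nrmD _ _))// [e]splitr mulrDl.
exact: lerD (hF x) (hG x).
Qed.

Lemma fapprox_compl A B : bounded_op A -> fapprox B -> fapprox (A \o B).
Proof.
move=> hA [hB aB]; split; first exact: bounded_comp.
have [c c0 hc] := bounded_bound hA => e e0.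
have [F fF hF] := aB _ (divr_gt0 e0 c0).
exists (A \o F); first exact: finrank_compl.
move=> x /=; rewrite -(linB hA.1) (le_trans (hc _))//.
by rewrite -ler_pdivlMl// mulrA [_^-1 * _]mulrC; exact: hF.
Qed.

Lemma fapprox_compr A B : fapprox A -> bounded_op B -> fapprox (A \o B).
Proof.
move=> [hA aA] hB; split; first exact: bounded_comp.
have [c c0 hc] := bounded_bound hB => e e0.
have [F fF hF] := aA _ (divr_gt0 e0 c0).
exists (F \o B); first exact: finrank_compr.
move=> x /=; rewrite (le_trans (hF _))//.
by rewrite mulrAC ler_pdivrMr// -mulrA ler_pM2l// mulrC; exact: hc.
Qed.

Lemma fapprox_scale a A : fapprox A -> fapprox (a \*: A).
Proof.
move=> hA; have -> : a \*: A = (a \*: id) \o A by [].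
by apply: fapprox_compl => //; exact/bounded_scale/bounded_id.
Qed.

Lemma fapprox_limit A : bounded_op A ->
  (forall e : R, 0 < e -> exists2 F, fapprox F & bound_by (A \- F) e) -> fapprox A.
Proof.
move=> hA h; split=> // e e0; have e2 : 0 < e / 2 by rewrite divr_gt0.
have [F [_ aF] hF] := h _ e2; have [G fG hG] := aF _ e2.
exists G => // x; rewrite [e]splitr mulrDl (le_trans (nrm_triB _ (F x) _))//.
exact: lerD (hF x) (hG x).
Qed.

End FiniteDimension.

(** * Norm limits of finite-rank operators are compact *)

Section Compactness.
Context {R : realType} {H : hilbertType R}.
Implicit Types (x y z : H) (a b : R[i]) (S : set H) (A B T : H -> H).

Definition totally_bounded S := forall e : R, 0 < e ->
  exists s : seq H, forall x, S x -> exists2 y, y \in s & nrm (x - y) <= e.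

(** An ultrafilter containing [S] must contain one of the finitely many balls covering it, at every
    radius; it is therefore Cauchy and converges by completeness. *)
Lemma totally_bounded_precompact S : totally_bounded S -> precompact S.
Proof.
move=> hS; rewrite precompactE compact_ultra => F UF FS.
have cF : cauchy F.
  apply/cauchy_exP => e e0; have [r r0 ->] := complex_gt0 e0.
  have r2 : 0 < r / 4 by rewrite divr_gt0.
  have [s hs] := hS _ r2.
  have sub : closure S `<=` [set x | exists2 y, y \in s & nrm (x - y) <= r / 2].
    move=> x clx; have rC : 0 < (r / 4)%:C :> R[i] by rewrite ltcR.
    have [z [Sz xz]] := clx _ (nbhsx_ballx x _ rC); have [y ys zy] := hs _ Sz.
    exists y => //; rewrite (le_trans (nrm_triB _ z _))//.
    by move: xz; rewrite -ball_normE /ball_ /= nrmE ltcR; move: zy; lra.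
  have Fs : F [set x | exists2 y, y \in s & nrm (x - y) <= r / 2] by exact: filterS sub FS.
  suff [y Fy] : exists y, F [set x | nrm (x - y) <= r / 2].
    exists y; apply: filterS Fy => x /= h; rewrite -ball_normE /ball_ /= nrmE ltcR nrmBC.
    by rewrite (le_lt_trans h)// ltr_pdivrMr// ltr_pMr// ltr1n.
  elim: s {hs sub} Fs => [|y s ih] Fs.
    have [x [y]] := filter_ex Fs; by rewrite in_nil.
  have [F1|F1] := in_ultra_setVsetC [set x | nrm (x - y) <= r / 2] UF; first by exists y.
  apply: ih; apply: filterS (filterI Fs F1) => x [[z]].
  by rewrite inE => /orP[/eqP ->//|zs h _]; exists z.
move: cF => /cauchy_cvg/cvg_ex[x Fx].
by exists x; split=> //; apply: (@closed_cvg _ _ F _ id) Fx; [exact: closed_closure|].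
Qed.

Lemma totally_bounded_sub S S' : S `<=` S' -> totally_bounded S' -> totally_bounded S.
Proof. by move=> h hS e /hS[s hs]; exists s => x /h; exact: hs. Qed.

Lemma totally_bounded_sum S S' : totally_bounded S -> totally_bounded S' ->
  totally_bounded [set x | exists y z, [/\ S y, S' z & x = y + z]].
Proof.
move=> hS hS' e e0; have e2 : 0 < e / 2 by rewrite divr_gt0.
have [s hs] := hS _ e2; have [t ht] := hS' _ e2.
exists [seq y + z | y <- s, z <- t] => x [y [z [Sy Sz ->]]].
have [y' ys yy] := hs _ Sy; have [z' zt zz] := ht _ Sz.
exists (y' + z'); first exact: allpairs_f.
by rewrite opprD addrACA (le_trans (nrmD _ _))// [e]splitr lerD.
Qed.

Lemma totally_bounded_line (M : R) y :
  totally_bounded [set t%:C *: y | t in [set t : R | `|t| <= M]].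
Proof.
move=> e e0; have y1 : 0 < nrm y + 1 by rewrite ltr_wpDl ?nrm_ge0.
pose d := e / (nrm y + 1); have d0 : 0 < d by rewrite divr_gt0.
have [K hK] : exists K, K = (Num.truncn (2 * M / d)).+1 by eexists.
exists [seq (k%:R * d - M)%:C *: y | k <- iota 0 K].
move=> _ [t /= tM <-]; move: (tM); rewrite ler_norml => /andP[t1 t2].
have p : 0 <= (t + M) / d by rewrite divr_ge0 ?(ltW d0)//; move: t1; lra.
pose k := Num.truncn ((t + M) / d).
exists ((k%:R * d - M)%:C *: y).
  apply: (@map_f _ _ (fun k : nat => (k%:R * d - M)%:C *: y)); rewrite mem_iota leq0n add0n hK ltnS.
  apply: le_truncn; rewrite ler_pM2r ?invr_gt0//.
  by move: t2; lra.
rewrite -scalerBl -rmorphB nrmZ cabsR.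
have h : `|t - (k%:R * d - M)| <= d.
  have /andP[] := truncn_itv p; rewrite -/k ler_pdivlMr// ltr_pdivrMr// -natr1 mulrDl mul1r.
  by rewrite ler_norml => h1 h2; apply/andP; split; move: h1 h2; lra.
rewrite (@le_trans _ _ (d * (nrm y + 1)))//; last by rewrite divfK// gt_eqF.
by rewrite ler_pM ?nrm_ge0// lerDl.
Qed.

Lemma totally_bounded_box n (v : 'I_n -> H) (M : R) :
  totally_bounded [set \sum_i c i *: v i | c in [set c : 'I_n -> R[i] | forall i, cabs (c i) <= M]].
Proof.
elim: n v => [|n ih] v.
  move=> e e0; exists [:: 0] => _ [c _ <-]; exists 0; first by rewrite inE.
  by rewrite big_ord0 subrr nrm0 ltW.
(* The complex coefficient of [v ord0] is split into two real ones, along [v ord0] and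
   ['i *: v ord0]. *)
apply: totally_bounded_sub (totally_bounded_sum (ih (v \o lift ord0))
  (totally_bounded_sum (totally_bounded_line M (v ord0))
     (totally_bounded_line M ('i%C *: v ord0)))) => _ [c hc <-].
have cR (b : R[i]) : cabs b <= M -> `|complex.Re b| <= M /\ `|complex.Im b| <= M.
  rewrite /cabs normc_def /= => h.
  by split; apply: le_trans h; rewrite -sqrtr_sqr ler_sqrt ?addr_ge0 ?sqr_ge0//
    ?lerDl ?lerDr sqr_ge0.
have [h1 h2] := cR _ (hc ord0).
rewrite big_ord_recl addrC.
exists (\sum_(i < n) c (lift ord0 i) *: v (lift ord0 i)), (c ord0 *: v ord0); split=> //.
  by exists (c \o lift ord0) => // i; exact: hc.
exists ((complex.Re (c ord0))%:C *: v ord0), ((complex.Im (c ord0))%:C *: ('i%C *: v ord0)).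
split; [by exists (complex.Re (c ord0))|by exists (complex.Im (c ord0))|].
by rewrite scalerA -scalerDl mulrC -complexE.
Qed.

Lemma fapprox_compact A : fapprox A -> compact_op A.
Proof.
move=> [hA aA]; split=> //; apply: totally_bounded_precompact => e e0.
have e2 : 0 < e / 2 by rewrite divr_gt0.
have [F /[dup] [[hF _]] /finrankE[n [f [hf FE]]] hAF] := aA _ e2.
have [c c0 hc] := bounded_bound hF.
(* On the unit ball the coefficients of [F x] in the basis [f] are bounded by [c], so the image of
   the ball lies in a box. *)
have [s hs] := totally_bounded_box f c e2.
exists s => _ [x /= x1 <-]; have {}x1 : nrm x <= 1 by move: x1; rewrite nrmE lecR.
have [|y ys Fy] := hs (F x).
  exists (fun i => <|F x, f i|>).
    move=> i; rewrite (le_trans (cauchy_schwarz _ _))//.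
    by rewrite (orthon_nrm i hf) mulr1 (le_trans (hc _))// ler_piMr// ltW.
  by rewrite [RHS](_ : _ = rank_sum f f (F x))// rank_sum_id// FE; exact: rank_sum_in.
exists y => //; rewrite (le_trans (nrm_triB _ (F x) _))// [e]splitr lerD//.
by rewrite (le_trans (hAF _))// ler_piMr// ltW.
Qed.

End Compactness.

(** * The Fredholm alternative for perturbations of the identity *)

Section Fredholm.
Context {R : realType} {H : hilbertType R}.
Implicit Types (x y z : H) (a b : R[i]) (S : set H) (A B C F T : H -> H).

(** A null vector satisfies [x = - F x] and so lies in the span of [e], where [1 + F] acts on
    coordinate rows by the matrix. *)
Lemma nullspace_matrix n (e : 'I_n -> H) F : orthon e -> linear F ->
  (forall x, lspan e (F x)) ->
  has_dim (nullspace (id \+ F)) (n - \rank (\matrix_(i, j) <|e i + F (e i), e j|>)).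
Proof.
move=> he lF hF; set M := \matrix_(i, j) _.
have TM (c : 'rV_n) : let x := \sum_i c 0 i *: e i in x + F x = \sum_j (c *m M) 0 j *: e j.
  move=> x; have lx : lspan e x by exists (fun i => c 0 i).
  rewrite -[LHS](rank_sum_id he); last exact: subspaceD (lspan_sub e) lx (hF x).
  apply: eq_bigr => j _; congr (_ *: _); rewrite !mxE /x (lin_sum lF) -big_split /=.
  by rewrite ip_suml; apply: eq_bigr => i _; rewrite !mxE (linZ lF) -scalerDr ipZl.
have := lspan_kernel M he; congr has_dim; apply/seteqP; split=> [_ [c /= cM <-]|x Tx].
  by rewrite /nullspace /= TM cM big1// => i _; rewrite mxE scale0r.
have lx : lspan e x.
  have -> : x = - F x by apply/eqP; rewrite -addr_eq0; apply/eqP.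
  exact: subspaceN (lspan_sub e) (hF x).
have [c _ cx] := lx; exists (\row_i c i); last first.
  by rewrite -cx; apply: eq_bigr => i _; rewrite mxE.
have xE : x = \sum_i (\row_i c i) 0 i *: e i.
  by rewrite -cx; apply: eq_bigr => i _; rewrite mxE.
have := TM (\row_i c i); rewrite /= -xE [LHS]Tx => h.
apply/rowP => j; rewrite [RHS]mxE -[LHS](orthon_coef (fun j => (\row_i c i *m M) 0 j) j he).
by rewrite -h ip0l.
Qed.

Lemma fredholm_finrank F : finrank F -> closed (range (id \+ F)) /\
  exists n, has_dim (nullspace (id \+ F)) n /\ has_dim (orthogonal_to (range (id \+ F))) n.
Proof.
move=> fF; have hF := fF.1; have [m [f [hf FE]]] := finrankE fF.
have FE' : adjoint F = rank_sum f (adjoint F \o f) by rewrite {1}FE rank_sum_adjoint.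
(* The basis spans the ranges of both [F] and its adjoint: [F] then vanishes on the orthogonal
   complement of the span, and the same basis serves for the adjoint. *)
have [n [e [he lE _]]] := gram_schmidt
  (fun i : 'I_(m + m) => match fintype.split i with inl i => f i | inr i => adjoint F (f i) end).
have l0 k (v : 'I_k -> H) : lspan v 0 by exact: (lspan_sub v).1.
have eF x : lspan e (F x).
  rewrite lE -[F x]addr0; apply: (@lspan_cat _ _ _ _ f (adjoint F \o f)) => //.
  by rewrite {1}FE; exact: rank_sum_in.
have eF' x : lspan e (adjoint F x).
  rewrite lE -[adjoint F x]add0r; apply: (@lspan_cat _ _ _ _ f (adjoint F \o f)) => //.
  have -> : adjoint F x = rank_sum f (adjoint F \o f) x by rewrite {1}FE'.
  exact: rank_sum_in.
have hT : bounded_op (id \+ F) by exact: bounded_add bounded_id hF.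
split.
  have cS := lspan_closed (fun i => e i + F (e i)).
  (* [1 + F] is the identity on the complement of the span, so only the component in the span
     restricts membership in the range. *)
  have -> : range (id \+ F) = [set y | lspan (fun i => e i + F (e i)) (rank_sum e e y)].
    have eq x : x = rank_sum e e x -> lspan (fun i => e i + F (e i)) (x + F x).
      move=> ->; rewrite (lin_sum hF.1) -big_split /=; exists (fun i => <|x, e i|>) => //.
      by apply: eq_bigr => i _; rewrite (linZ hF.1) scalerDr.
    have F0 x : F x = F (rank_sum e e x).
      apply/eqP; rewrite -subr_eq0 -(linB hF.1); apply/eqP; apply: ip_ext => z.
      have o : orthogonal_to (lspan e) (x - rank_sum e e x).
        by apply: orthogonal_to_lspan => i; exact: rank_sum_orth.
      by rewrite adjP// ip0l; exact: o (eF' z).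
    apply/seteqP; split=> [_ [x _ <-]|y] /=.
      rewrite (linD (rank_sum_bounded e e).1) (rank_sum_id he (eF x)) F0.
      by apply: eq; rewrite [RHS]rank_sum_id//; exact: rank_sum_in.
    move=> [c _ cE]; exists (y - rank_sum e e y + \sum_i c i *: e i) => //=.
    rewrite (linD hF.1) (F0 (y - _)) (linB (rank_sum_bounded e e).1).
    rewrite (rank_sum_id he (rank_sum_in e e y)) subrr (lin0 hF.1) add0r -addrA.
    rewrite (lin_sum hF.1) -big_split -[RHS](subrK (rank_sum e e y) y); congr (_ + _).
    by rewrite -cE; apply: eq_bigr => i _; rewrite (linZ hF.1) scalerDr.
  have [c c0 hc] := bounded_bound (rank_sum_bounded e e).
  apply/closedP => x hx; move: cS.1 => /closedP; apply => r r0.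
  have [y ly xy] := hx _ (divr_gt0 r0 c0).
  exists (rank_sum e e y) => //; rewrite -(linB (rank_sum_bounded e e).1).
  by rewrite (le_trans (hc _))// mulrC -ler_pdivlMr.
pose M : 'M[R[i]]_n := \matrix_(i, j) <|e i + F (e i), e j|>.
exists (n - \rank M)%N.
split; first exact: nullspace_matrix he hF.1 eF.
rewrite range_orthoC// adjoint_add//; last exact: bounded_id.
rewrite adjoint_id; have := nullspace_matrix he (adjoint_linear hF) eF'.
(* The matrix of the adjoint is the conjugate transpose, which has the same rank; this equality is
   the vanishing of the index. *)
congr (has_dim _ (n - _)); rewrite -[RHS]mxrank_tr -[RHS](mxrank_map (Num.conj : {rmorphism R[i] -> R[i]})).
congr (\rank _); apply/matrixP => i j; rewrite !mxE.
transitivity (Num.conj <|e j + F (e j), e i|>); last by [].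
by rewrite -ipC ipDl ipDr adjPr.
Qed.

Lemma below_sub_small C : bounded_op C -> bound_by C 2^-1 -> bounded_below (id \+ C) setT 2^-1.
Proof.
move=> hC hc x _ /=; have := hc x; have := nrmB (x + C x) (C x).
rewrite addrK; lra.
Qed.

Lemma small_perturbation C : bounded_op C -> bound_by C 2^-1 -> invertible_op (id \+ C).
Proof.
move=> hC hc; have hT : bounded_op (id \+ C) by exact: bounded_add bounded_id hC.
apply: (lax_milgram hT) (below_sub_small hC hc) _ => [|x]; first by rewrite invr_gt0.
rewrite adjoint_add//; last exact: bounded_id.
rewrite adjoint_id /= => Tx; apply/nrm_eq0/eqP; rewrite eq_le nrm_ge0 andbT.
have := below_sub_small (adjoint_bounded hC) (adjoint_bound hC hc) (I : setT x).
by rewrite /= Tx nrm0; lra.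
Qed.

(* [1 + C = Z (1 + F)] with [Z] a small perturbation of [1] and [F] of finite rank,
   so the two dimensions are coranks of a square matrix and of its adjoint. *)
Lemma fredholm_alternative C : fapprox C -> closed (range (id \+ C)) /\
  exists n, has_dim (nullspace (id \+ C)) n /\ has_dim (orthogonal_to (range (id \+ C))) n.
Proof.
move=> [hC aC]; have [|F0 fF0 hF0] := aC 2^-1; first by rewrite invr_gt0.
have hD : bounded_op (C \- F0) := bounded_sub hC fF0.1.
set Z := id \+ (C \- F0); have iZ : invertible_op Z by exact: small_perturbation.
have hZ := iZ.1.
pose F := op_inv Z \o F0.
have fF : finrank F by apply: finrank_compl => //; exact: op_inv_bounded.
have hT : bounded_op (id \+ F) by exact: bounded_add bounded_id fF.1.
have E : id \+ C = Z \o (id \+ F).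
  apply/funext => x; rewrite /= (linD hZ.1) op_invKr// /Z /=.
  by rewrite -addrA subrK.
have [cF [n [k1 k2]]] := fredholm_finrank fF.
have RE : range (id \+ C) = Z @` range (id \+ F).
  rewrite E; apply/seteqP; split=> [_ [x _ <-]|_ [_ [x _ <-] <-]]; last by exists x.
  by exists ((id \+ F) x) => //; exists x.
split.
  rewrite RE; apply: (@below_image_closed _ _ _ _ 2^-1) => //; last first.
    by move=> x _; exact: below_sub_small.
  by split=> //; exact: range_subspace hT.1.
exists n; split.
  suff -> : nullspace (id \+ C) = nullspace (id \+ F) by [].
  rewrite E; apply/seteqP; split=> x; rewrite /nullspace /=.
    by move=> h; rewrite -[LHS](op_invK _ iZ) h (lin0 (op_inv_bounded iZ).1).
  by move=> ->; rewrite (lin0 hZ.1).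
have iB := op_inv_bounded iZ; have aB := adjoint_bounded iB.
have ZK x : adjoint (op_inv Z) (adjoint Z x) = x.
  by apply: ip_extr => z; rewrite -adjP// -adjP// op_invKr.
have ZKr x : adjoint Z (adjoint (op_inv Z) x) = x.
  by apply: ip_extr => z; rewrite -adjP// -adjP// op_invK.
(* Since [1 + C = Z (1 + F)], orthogonality to the range is transported by the inverse of the
   adjoint of [Z], which is injective and preserves dimension. *)
suff -> : orthogonal_to (range (id \+ C)) = adjoint (op_inv Z) @` orthogonal_to (range (id \+ F)).
  apply: has_dim_image k2 => [|x _ h]; first exact: aB.1.
  by rewrite -(ZKr x) h (lin0 (adjoint_bounded hZ).1).
apply/seteqP; split=> y.
  move=> hy; exists (adjoint Z y); last exact: ZK.
  move=> z Rz; rewrite -adjPr//; apply: hy; rewrite RE; by exists z.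
move=> [z hz <-] w; rewrite RE => -[v Rv <-].
by rewrite -adjPr// op_invK// hz.
Qed.

Lemma fredholm_invertible C : fapprox C -> (forall x, x + C x = 0 -> x = 0) ->
  invertible_op (id \+ C).
Proof.
move=> fC inj; have [cR [n [k1 k2]]] := fredholm_alternative fC.
have hT : bounded_op (id \+ C) := bounded_add bounded_id fC.1.
have n0 : n = 0%N by apply: (has_dim0 k1) => x; exact: inj.
apply: bijective_invertible => // y.
have hR : closed_subspace (range (id \+ C)) by split=> //; exact: range_subspace hT.1.
have : range (id \+ C) y.
  rewrite -(ortho_ortho hR) => x; rewrite n0 in k2 => /(has_dim_zero k2) ->.
  exact: ip0r.
by case=> x _ <-; exists x.
Qed.

(** The correction maps the kernel isometrically onto the orthogonal complement of the range. In a
    null vector the two summands are orthogonal, so both vanish, and [x] is a kernel vector with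
    zero coefficients. *)
Lemma rank_sum_fill C n (k d : 'I_n -> H) : fapprox C ->
  orthon k -> nullspace (id \+ C) = lspan k ->
  orthon d -> orthogonal_to (range (id \+ C)) = lspan d ->
  invertible_op (id \+ (C \+ rank_sum k d)).
Proof.
move=> fC hk kE hd dE; apply: fredholm_invertible.
  by apply: fapprox_add => //; apply/finrank_fapprox/finrank_rank_sum.
move=> x /=; rewrite addrA => h.
have o : <|rank_sum k d x, x + C x|> = 0.
  have : lspan d (rank_sum k d x) by exact: rank_sum_in.
  by rewrite -dE; apply; exists x.
have W0 : rank_sum k d x = 0.
  have E : x + C x = - rank_sum k d x by apply/eqP; rewrite -addr_eq0 h.
  by apply: ip_eq0; move: o; rewrite E ipNr => /eqP; rewrite oppr_eq0 => /eqP.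
have : lspan k x by rewrite -kE /nullspace /= -h W0 addr0.
move=> lx; rewrite -(rank_sum_id hk lx) /rank_sum big1// => i _.
have -> : <|x, k i|> = 0; last by rewrite scale0r.
by rewrite -(orthon_coef (fun i => <|x, k i|>) i hd) -/(rank_sum k d x) W0 ip0l.
Qed.

End Fredholm.

(** * Positive square roots, absolute values and isometric factors *)

Section SquareRoot.
Context {R : realType} {H : hilbertType R}.
Implicit Types (x y z : H) (a b : R[i]) (A B T X Y Z : H -> H).

Lemma tendsD (u v : nat -> H) x y : tends u x -> tends v y ->
  tends (fun n => u n + v n) (x + y).
Proof.
move=> ux vy e e0; have e2 : 0 < e / 2 by rewrite divr_gt0.
have [N hN] := ux _ e2; have [M hM] := vy _ e2; exists (maxn N M) => n.
rewrite geq_max => /andP[/hN h1 /hM h2].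
by rewrite opprD addrACA (le_trans (nrmD _ _))// [e]splitr lerD.
Qed.

Lemma tends_cst x : tends (fun=> x) x.
Proof. by move=> e e0; exists 0%N => n _; rewrite subrr nrm0 ltW. Qed.

Lemma tends_eq (u v : nat -> H) x : (forall n, u n = v n) -> tends u x -> tends v x.
Proof. by move=> uv ux e /ux[N hN]; exists N => n; rewrite -uv; exact: hN. Qed.

Lemma tends_shift (u : nat -> H) x : tends u x -> tends (fun n => u n.+1) x.
Proof. by move=> ux e /ux[N hN]; exists N => n Nn; apply: hN; exact: leqW. Qed.

Lemma tends_ip_eq (u v : nat -> H) x y x' y' : tends u x -> tends v y ->
  (forall n, <|u n, y'|> = <|x', v n|>) -> <|x, y'|> = <|x', y|>.
Proof.
move=> ux vy h; apply/eqP; rewrite -subr_eq0; apply/eqP/cabs_eq0/eqP.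
rewrite eq_le cabs_ge0 andbT.
apply: (@le_eps_scaled _ _ _ (nrm x' + nrm y')) => [|e e0]; first by rewrite addr_ge0 ?nrm_ge0.
have [N hN] := ux _ e0; have [M hM] := vy _ e0; set n := maxn N M.
have -> : <|x, y'|> - <|x', y|> = <|x', v n - y|> - <|u n - x, y'|>.
  by rewrite ipBl ipBr h opprB [RHS]addrC addrA subrK.
rewrite add0r (le_trans (cabsD _ _))// cabsN mulrDl lerD//.
  rewrite (le_trans (cauchy_schwarz _ _))// ler_wpM2l ?nrm_ge0//.
  by rewrite hM// leq_maxr.
rewrite (le_trans (cauchy_schwarz _ _))// mulrC ler_wpM2l ?nrm_ge0//.
by rewrite hN// leq_maxl.
Qed.

Lemma mono_cauchy (s : nat -> R) (M : R) : (forall n, s n <= s n.+1) ->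
  (forall n, s n <= M) -> forall e : R, 0 < e ->
  exists N, forall n, (N <= n)%N -> s n - s N <= e.
Proof.
move=> smono sM e e0.
have hs : has_sup (range s) by split; [exists (s 0%N), 0%N|exists M => _ [n _ <-]].
have [_ [N _ <-] hN] := sup_adherent e0 hs.
exists N => n _; have : s n <= sup (range s) by apply: ub_le_sup; [exact: hs.2|exists n].
by move: hN; lra.
Qed.

Lemma mono_le (s : nat -> R) : (forall n, s n <= s n.+1) ->
  forall m n, (m <= n)%N -> s m <= s n.
Proof.
move=> h m n /subnKC <-; elim: (n - m)%N => [|k ih]; first by rewrite addn0.
by rewrite addnS (le_trans ih).
Qed.

Lemma tends_of_mono (u : nat -> H) (s : nat -> R) (M : R) :
  (forall n, s n <= s n.+1) -> (forall n, s n <= M) ->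
  (forall m n, (m <= n)%N -> nrm (u n - u m) ^+ 2 <= s n - s m) ->
  exists x, tends u x.
Proof.
move=> smono sM hu; apply: nrm_complete => e e0.
have [N hN] := mono_cauchy smono sM (exprn_gt0 2 (divr_gt0 e0 (ltr0n _ 2))).
exists N => m n Nm Nn; rewrite (le_trans (nrm_triB _ (u N) _))// [e]splitr.
have h k : (N <= k)%N -> nrm (u k - u N) <= e / 2.
  move=> Nk; apply: le_nrm_sqr; first by rewrite divr_ge0// ltW.
  exact: le_trans (hu _ _ Nk) (hN _ Nk).
by rewrite lerD ?h// nrmBC h.
Qed.

Lemma limit_op (U : nat -> H -> H) (c : R) : (forall n, linear (U n)) -> 0 <= c ->
  (forall n x, nrm (U n x) <= c * nrm x) ->
  (forall x, exists y, tends (U ^~ x) y) ->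
  exists T, [/\ bounded_op T, bound_by T c & forall x, tends (U ^~ x) (T x)].
Proof.
move=> lU c0 hc /choice[T hT]; have bT : bound_by T c.
  by move=> x; rewrite -[T x]subr0; apply: (tends_le (N := 0%N) (hT x)) => n _; rewrite subr0.
exists T; split=> //; apply: bounded_opE bT => a x y.
apply: tends_unique (hT _) _; apply: tends_eq (tendsD (tends_op (bounded_scale a bounded_id) (hT x)) (hT y)).
by move=> n /=; rewrite lU.
Qed.

Lemma conj_i : Num.conj 'i%C = - 'i%C :> R[i].
Proof. by apply/eqP; rewrite eq_complex /= oppr0 !eqxx. Qed.

(** Polarization at [x + y] and [x + 'i y] gives two relations between [<T x, y>] and [<T y, x>]. *)
Lemma quad_zero T : linear T -> (forall x, <|T x, x|> = 0) -> forall x, T x = 0.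
Proof.
move=> lT h x; apply: ip_ext => y; rewrite ip0l.
have h1 : <|T x, y|> + <|T y, x|> = 0.
  by have := h (x + y); rewrite (linD lT) ipDl !ipDr !h addr0 add0r.
have h2 : - 'i%C * <|T x, y|> + 'i%C * <|T y, x|> = 0.
  have := h (x + 'i%C *: y); rewrite (linD lT) (linZ lT) ipDl !ipDr !ipZl !ipZr !h.
  by rewrite !mulr0 addr0 add0r conj_i.
have i0 : 'i%C != 0 :> R[i] by rewrite eq_complex /= oner_eq0 andbF.
have h3 : <|T y, x|> = <|T x, y|>.
  apply: (mulfI i0); apply/eqP; rewrite -subr_eq0 addrC -mulNr; exact/eqP.
by move: h1; rewrite h3 -mulr2n => /eqP; rewrite mulrn_eq0 => /eqP.
Qed.

Lemma positive_adjoint T : positive_op T -> adjoint T = T.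
Proof.
move=> [hT pT]; have hD := bounded_sub hT (adjoint_bounded hT).
have h : forall x, (T \- adjoint T) x = 0.
  apply: quad_zero => [|x /=]; first exact: hD.1.
  rewrite ipBl -[X in _ - X]adjPr// [X in _ - X]ipC.
  by rewrite (geC0_conj (pT x)) subrr.
by apply/funext => x; apply/eqP; rewrite eq_sym -subr_eq0; apply/eqP/h.
Qed.

Lemma positive_sym T x y : positive_op T -> <|T x, y|> = <|x, T y|>.
Proof. by move=> pT; rewrite adjP ?positive_adjoint//; case: pT. Qed.

Lemma ge0_complex (z : R[i]) : 0 <= complex.Re z -> Num.conj z = z -> 0 <= z.
Proof.
case: z => u v /= u0 [] h; rewrite lecE /= u0 andbT; apply/eqP.
by move: h; lra.
Qed.

(* The fixed point of [S = (X + S^2) / 2] is [1 - sqrt (1 - X)]; the increments of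
   the operator iteration are dominated by those of the scalar one at [X = 1]. *)
Fixpoint sqrt_iter X (n : nat) : H -> H :=
  if n is m.+1 then 2^-1%:C \*: (X \+ (sqrt_iter X m \o sqrt_iter X m)) else fun=> 0.

Fixpoint sqrt_scal (n : nat) : R := if n is m.+1 then (1 + sqrt_scal m ^+ 2) / 2 else 0.

Lemma sqrt_scal_bounds n : 0 <= sqrt_scal n <= 1.
Proof.
elim: n => [|n /andP[h0 h1]] /=; first by rewrite lexx ler01.
have : sqrt_scal n ^+ 2 <= 1 by rewrite expr_le1.
by have := sqr_ge0 (sqrt_scal n); move=> ? ?; apply/andP; split; lra.
Qed.

Lemma sqrt_scal_mono n : sqrt_scal n <= sqrt_scal n.+1.
Proof. by rewrite /=; have := sqr_ge0 (sqrt_scal n - 1); rewrite sqrrB1; lra. Qed.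

(** Every iterate is a polynomial in [X], so whatever commutes with [X] commutes with the limit. The
    commutation clause is what later lets projections pass through square roots. *)
Lemma sqrt_one_minus X : bounded_op X -> adjoint X = X -> bound_by X 1 ->
  exists Y, [/\ positive_op Y, Y \o Y = id \- X &
    forall Z, bounded_op Z -> Z \o X = X \o Z -> Z \o Y = Y \o Z].
Proof.
move=> hX sX X1; pose U := sqrt_iter X; pose s := sqrt_scal.
have US n x : U n.+1 x = 2^-1%:C *: (X x + U n (U n x)) by [].
have half : 0 <= 2^-1 :> R by rewrite invr_ge0.
have bU n : bounded_op (U n).
  elim: n => [|n ih]; first exact: bounded_cst0.
  by apply: bounded_scale; apply: bounded_add => //; exact: bounded_comp.
have cU n : bound_by (U n) (s n).
  elim: n => [|n ih] x; first by rewrite nrm0 mul0r.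
  rewrite US nrmZ cabs_pos// /s /= -/s mulrC [in leRHS]mulrAC ler_wpM2r//.
  rewrite (le_trans (nrmD _ _))// mulrDl lerD//.
  rewrite (le_trans (ih _))// expr2 -mulrA ler_wpM2l//.
  by case/andP: (sqrt_scal_bounds n).
have sU n : adjoint (U n) = U n.
  elim: n => [|n ih]; apply: adjoint_uniq => // x y; first by rewrite ip0l ip0r.
  by rewrite !US ipZl ipZr conjR ipDl ipDr !adjP// sX ih.
have dU n x : nrm (U n.+1 x - U n x) <= (s n.+1 - s n) * nrm x.
  elim: n x => [|n ih] x.
    rewrite subr0 (le_trans (cU 1%N x))// ler_wpM2r ?nrm_ge0//.
    by rewrite {3}/s /= subr0.
  (* The difference of the squares of [U n.+1] and [U n] is telescoped, in the same way as for the
     scalar sequence that dominates it. *)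
  have -> : U n.+2 x - U n.+1 x = 2^-1%:C *: (U n.+1 (U n.+1 x - U n x) +
      (U n.+1 (U n x) - U n (U n x))).
    rewrite (linB (bU n.+1).1) addrA subrK US (US n) -scalerBr opprD addrACA.
    by rewrite subrr add0r.
  rewrite nrmZ cabs_pos//.
  have [/andP[p0 p1] /andP[q0 q1]] := (sqrt_scal_bounds n, sqrt_scal_bounds n.+1).
  have h1 : nrm (U n.+1 (U n.+1 x - U n x)) <= s n.+1 * ((s n.+1 - s n) * nrm x).
    by rewrite (le_trans (cU _ _))// ler_wpM2l.
  have h2 : nrm (U n.+1 (U n x) - U n (U n x)) <= (s n.+1 - s n) * (s n * nrm x).
    by rewrite (le_trans (ih _))// ler_wpM2l ?cU// subr_ge0 sqrt_scal_mono.
  have -> : s n.+2 - s n.+1 = 2^-1 * (s n.+1 * (s n.+1 - s n) + (s n.+1 - s n) * s n).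
    have sE k : s k.+1 = (1 + s k ^+ 2) / 2 by [].
    by rewrite (sE n.+1) [X in _ - X = _]sE; field.
  rewrite -mulrA ler_wpM2l// (le_trans (nrmD _ _))// mulrDl lerD//.
    by rewrite -mulrA.
  by rewrite -mulrA.
have dU2 m n x : (m <= n)%N -> nrm (U n x - U m x) <= (s n - s m) * nrm x.
  move=> /subnKC <-; elim: (n - m)%N => [|k ih].
    by rewrite addn0 !subrr nrm0 mul0r.
  rewrite addnS (le_trans (nrm_triB _ (U (m + k)%N x) _))//.
  rewrite (le_trans (lerD (dU _ _) ih))// -mulrDl ler_wpM2r ?nrm_ge0//.
  by rewrite addrA subrK.
have s1 n : s n <= 1 by case/andP: (sqrt_scal_bounds n).
have cvU x : exists y, tends (U ^~ x) y.
  apply: nrm_complete => e e0; have x1 : 0 < nrm x + 1 by rewrite ltr_wpDl ?nrm_ge0.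
  have [N hN] := mono_cauchy sqrt_scal_mono s1 (divr_gt0 (divr_gt0 e0 (ltr0n _ 2)) x1).
  have h k : (N <= k)%N -> nrm (U k x - U N x) <= e / 2.
    move=> Nk; rewrite (le_trans (dU2 _ _ _ Nk))//.
    rewrite (@le_trans _ _ (e / 2 / (nrm x + 1) * (nrm x + 1)))//; last by rewrite divfK// gt_eqF.
    rewrite ler_pM ?nrm_ge0 ?hN ?lerDl// subr_ge0; exact: (mono_le sqrt_scal_mono).
  exists N => m n Nm Nn; rewrite (le_trans (nrm_triB _ (U N x) _))// [e]splitr.
  by rewrite lerD ?h// nrmBC h.
have cU1 n x : nrm (U n x) <= 1 * nrm x.
  by rewrite (le_trans (cU _ _))// ler_wpM2r ?nrm_ge0.
have [S [bS S1 tS]] := limit_op (fun n => (bU n).1) ler01 cU1 cvU.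
have sS : adjoint S = S.
  apply: adjoint_uniq => // x y; apply: tends_ip_eq (tS x) (tS y) _ => n.
  by rewrite adjP// sU.
have SE x : S x = 2^-1%:C *: (X x + S (S x)).
  apply: tends_unique (tends_shift (tS x)) _.
  have hh : tends (fun n => U n (U n x)) (S (S x)).
    move=> e e0; have e2 : 0 < e / 2 by rewrite divr_gt0.
    have [N hN] := tS x _ e2; have [M hM] := tS (S x) _ e2.
    exists (maxn N M) => n; rewrite geq_max => /andP[/hN h1 /hM h2].
    rewrite (le_trans (nrm_triB _ (U n (S x)) _))// [e]splitr lerD//.
    by rewrite -(linB (bU n).1) (le_trans (cU1 _ _))// mul1r.
  exact: tends_op (bounded_scale 2^-1%:C bounded_id) (tendsD (tends_cst (X x)) hh).
(* Equivalently [(1 - S)^2 = 1 - X]. *)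
have E x : S x + S x = X x + S (S x).
  rewrite {1 2}SE -scalerDl -rmorphD /=.
  by rewrite (_ : 2^-1 + 2^-1 = 1 :> R) ?scale1r//; lra.
have hY : bounded_op (id \- S) := bounded_sub bounded_id bS.
exists (id \- S); split.
- split=> // x /=; apply: ge0_complex.
    rewrite ipBl ReD ReN ip_nrm /= subr_ge0 (le_trans (Re_le_cabs _))//.
    rewrite (le_trans (cauchy_schwarz _ _))// expr2 ler_wpM2r ?nrm_ge0//.
    by rewrite (le_trans (S1 x))// mul1r.
  by rewrite -ipC ipBl ipBr adjP// sS.
- apply/funext => x /=; rewrite (linB bS.1).
  have -> : S (S x) = S x + S x - X x by rewrite E addrAC subrr add0r.
  by rewrite opprB [_ - X x - _]addrAC addrK addrA subrK.
- move=> Z hZ ZX; have ZXx x : Z (X x) = X (Z x) by have := congr1 (@^~ x) ZX.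
  have ZU n x : Z (U n x) = U n (Z x).
    elim: n x => [|n ih] x; first exact: (lin0 hZ.1).
    by rewrite !US (linZ hZ.1) (linD hZ.1) ZXx !ih.
  apply/funext => x /=; rewrite (linB hZ.1); congr (_ - _).
  apply: tends_unique (tends_op hZ (tS x)) _.
  by apply: tends_eq (tS (Z x)) => n /=; rewrite ZU.
Qed.

Lemma operator_root A : bounded_op A ->
  exists T, [/\ positive_op T, T \o T = adjoint A \o A &
    forall Z, bounded_op Z -> Z \o (adjoint A \o A) = (adjoint A \o A) \o Z ->
      Z \o T = T \o Z].
Proof.
move=> hA; have [c c0 hc] := bounded_bound hA; have hA' := adjoint_bounded hA.
have cA := adjoint_bound hA hc.
(* Scaling by [c^-2] puts [k A^* A] between 0 and 1, so that [X = 1 - k A^* A] is a contraction; the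
   root is scaled back by [c]. *)
pose k : R := c ^- 2; have k0 : 0 < k by rewrite invr_gt0 exprn_gt0.
pose Q := adjoint A \o A; have hQ : bounded_op Q by exact: bounded_comp.
have sQ x y : <|Q x, y|> = <|x, Q y|> by rewrite /Q /= -adjPr// adjP.
pose X := id \- (k%:C \*: Q); have hX : bounded_op X.
  exact: bounded_sub bounded_id (bounded_scale _ hQ).
have sX : adjoint X = X.
  by apply: adjoint_uniq => // x y; rewrite /X /= ipBl ipBr ipZl ipZr conjR sQ.
have X1 : bound_by X 1.
  move=> x; rewrite mul1r; apply: le_nrm_sqr; first exact: nrm_ge0.
  rewrite nrm_sqB nrmZ cabs_pos ?(ltW k0)// ipZr conjR ReM_real -sQ /Q /= -adjPr// Re_ip.
  have h : nrm (adjoint A (A x)) ^+ 2 <= c ^+ 2 * nrm (A x) ^+ 2.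
    by rewrite -exprMn ler_pXn2r ?nnegrE ?nrm_ge0 ?mulr_ge0 ?nrm_ge0 ?(ltW c0)//; exact: cA.
  have {}h : (k * nrm (adjoint A (A x))) ^+ 2 <= k * nrm (A x) ^+ 2.
    by rewrite exprMn expr2 -mulrA ler_pM2l// /k mulrC ler_pdivrMr ?exprn_gt0// mulrC.
  have := mulr_ge0 (ltW k0) (sqr_ge0 (nrm (A x))); move: h; lra.
have [Y [pY YY cY]] := sqrt_one_minus hX sX X1.
have hY := pY.1.
exists (c%:C \*: Y); split.
- split; first exact: bounded_scale.
  by move=> x /=; rewrite ipZl mulr_ge0 ?ler0c ?(ltW c0)//; exact: pY.2.
- apply/funext => x /=; rewrite (linZ hY.1) scalerA.
  have -> : Y (Y x) = (id \- X) x by rewrite -YY.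
  rewrite /X /= subKr scalerA -!rmorphM /k /= -expr2 mulfV ?scale1r//.
  by rewrite expf_neq0// gt_eqF.
- move=> Z hZ ZQ; have ZY : Z \o Y = Y \o Z.
    apply: cY => //; apply/funext => x; rewrite /X /= (linB hZ.1) (linZ hZ.1).
    by have /= -> := congr1 (@^~ x) ZQ.
  apply/funext => x /=; rewrite (linZ hZ.1); congr (_ *: _).
  by have := congr1 (@^~ x) ZY.
Qed.

Lemma opabsP A : bounded_op A ->
  positive_op (opabs A) /\ opabs A \o opabs A = adjoint A \o A.
Proof.
move=> hA; apply: (@getPex _ [set T | positive_op T /\ T \o T = adjoint A \o A]).
by have [T [pT TT _]] := operator_root hA; exists T.
Qed.

Lemma opabs_bounded A : bounded_op A -> bounded_op (opabs A).
Proof. by move=> /opabsP[[]]. Qed.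

Lemma opabs_sq A x : bounded_op A -> opabs A (opabs A x) = adjoint A (A x).
Proof. by move=> /opabsP[_ h]; have := congr1 (@^~ x) h. Qed.

Lemma root_nrm T A x : positive_op T -> bounded_op A -> T \o T = adjoint A \o A ->
  nrm (T x) = nrm (A x).
Proof.
move=> pT hA TT; apply/eqP; rewrite -(@eqrXn2 _ 2)// ?nrm_ge0//; apply/eqP.
have /= h := congr1 (@^~ x) TT.
by rewrite -!Re_ip (positive_sym _ _ pT) h -adjP.
Qed.

Lemma opabs_nrm A x : bounded_op A -> nrm (opabs A x) = nrm (A x).
Proof. by move=> hA; have [p q] := opabsP hA; exact: root_nrm. Qed.

Lemma opabs_null A x : bounded_op A -> (opabs A x = 0) <-> (A x = 0).
Proof.
move=> hA; split=> h; apply: nrm_eq0; [rewrite -opabs_nrm// h|rewrite opabs_nrm// h];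
  exact: nrm0.
Qed.

(** [A x |-> B x] is well defined and isometric on [R(A)]; it extends to the closure by continuity
    and by 0 to the orthogonal complement. *)
Lemma isometric_factor A B : bounded_op A -> bounded_op B ->
  (forall x, nrm (A x) = nrm (B x)) -> exists2 V, bounded_op V & V \o A = B.
Proof.
move=> hA hB AB; have hK := norm_closure_closed (range_subspace hA.1).
have AB' x y : nrm (B x - B y) = nrm (A x - A y).
  by rewrite -(linB hA.1) -(linB hB.1) AB.
pose p := orthoproj (norm_closure (range A)); have hp : bounded_op p by exact: orthoproj_bounded.
(* The closure of the graph of [A x |-> B x], precomposed with the projection onto the closure of
   [R(A)]. *)
pose rel y z := forall e : R, 0 < e -> exists x, nrm (A x - p y) <= e /\ nrm (B x - z) <= e.
have relE y : exists z, rel y z.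
  have /choice[x hx] : forall n : nat, exists x, nrm (A x - p y) <= n.+1%:R^-1.
    move=> n; have [|_ [x _ <-] h] := orthoproj_in y hK n.+1%:R^-1; first by rewrite invr_gt0.
    by exists x; rewrite nrmBC.
  have [z tz] : exists z, tends (B \o x) z.
    apply: nrm_complete => e e0; have e2 : 0 < e / 2 by rewrite divr_gt0.
    have [N hN] := small_invn e2; exists N => m n Nm Nn /=.
    rewrite AB' (le_trans (nrm_triB _ (p y) _))// [e]splitr lerD//.
      by rewrite (le_trans (hx _))// hN.
    by rewrite nrmBC (le_trans (hx _))// hN.
  exists z => e e0; have [N hN] := small_invn e0; have [M hM] := tz _ e0.
  exists (x (maxn N M)); split; last by rewrite hM// leq_maxr.
  by rewrite (le_trans (hx _))// hN// leq_maxl.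
have rel_uniq y z z' : rel y z -> rel y z' -> z = z'.
  move=> h h'; apply/eqP; rewrite -subr_eq0; apply/eqP/nrm_eq0/eqP.
  rewrite eq_le nrm_ge0 andbT; apply: (@le_eps_scaled _ _ _ 4) => // e e0.
  have [x [h1 h2]] := h _ e0; have [x' [h3 h4]] := h' _ e0.
  have := nrm_triB z (B x) z'; have := nrm_triB (B x) (B x') z'.
  rewrite AB'; have := nrm_triB (A x) (p y) (A x').
  by rewrite [nrm (p y - A x')]nrmBC [nrm (z - B x)]nrmBC; move: h1 h2 h3 h4; lra.
have [V hV] := choice relE.
have relA x : rel (A x) (B x).
  move=> e e0; exists x; rewrite /p orthoproj_id ?subrr ?nrm0 ?ltW//.
  by apply: sub_norm_closure; exists x.
exists V; last by apply/funext => x /=; apply: rel_uniq (relA x).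
apply: (@bounded_opE _ _ _ 1) => [a y y'|y].
  apply: rel_uniq (hV _) _ => e e0.
  have a1 : 0 < cabs a + 1 by rewrite ltr_wpDl ?cabs_ge0.
  have e1 : 0 < e / 2 / (cabs a + 1) by rewrite !divr_gt0.
  have e2 : 0 < e / 2 by rewrite divr_gt0.
  have [x [h1 h2]] := hV y _ e1; have [x' [h3 h4]] := hV y' _ e2.
  have k (u : H) : nrm u <= e / 2 / (cabs a + 1) -> nrm (a *: u) <= e / 2.
    move=> hu; rewrite nrmZ (@le_trans _ _ ((cabs a + 1) * nrm u))//.
      by rewrite ler_wpM2r ?nrm_ge0// lerDl.
    by rewrite mulrC -ler_pdivlMr.
  exists (a *: x + x'); rewrite hA.1 hB.1 hp.1.
  by split; rewrite opprD addrACA -scalerBr (le_trans (nrmD _ _))// [e]splitr lerD// k.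
rewrite mul1r; apply: (@le_eps_scaled _ _ _ 2) => // e e0.
have [x [h1 h2]] := hV y _ e0.
have p1 : nrm (p y) <= nrm y.
  apply: le_nrm_sqr; first exact: nrm_ge0.
  rewrite -[in leRHS](subrK (p y) y) [leRHS]pythagoras ?lerDr ?sqr_ge0//.
  by rewrite orthoproj_orth//; exact: orthoproj_in.
have := nrmB (B x) (B x - V y); have := nrmD (A x - p y) (p y).
by rewrite subrK subKr -AB; move: h1 h2 p1; lra.
Qed.

(** [U = X + 'i Y] with [Y = sqrt (1 - X^2)], which commutes with [X]. Being an average of
    unitaries, a self-adjoint contraction inherits estimates that are invariant under unitaries. *)
Lemma contraction_unitary X : bounded_op X -> adjoint X = X -> bound_by X 1 ->
  exists U, [/\ bounded_op U, adjoint U \o U = id, U \o adjoint U = id &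
    forall x, X x = 2^-1%:C *: (U x + adjoint U x)].
Proof.
move=> hX sX X1; have hXX : bounded_op (X \o X) by exact: bounded_comp.
have [||Y [pY YY cY]] := sqrt_one_minus hXX.
- by rewrite adjoint_comp// sX.
- by move=> x; rewrite mul1r /= (le_trans (X1 _))// mul1r (le_trans (X1 _))// mul1r.
have hY := pY.1; have sY := positive_adjoint pY.
have XY x : X (Y x) = Y (X x) by have := congr1 (@^~ x) (cY X hX erefl).
have YYx x : Y (Y x) = x - X (X x) by have := congr1 (@^~ x) YY.
pose U := X \+ ('i%C \*: Y); pose U' := X \- ('i%C \*: Y).
have hU : bounded_op U by apply: bounded_add => //; exact: bounded_scale.
have UE : adjoint U = U'.
  apply: adjoint_uniq => // x y; rewrite /U /U' /= ipDl ipBr ipZl ipZr !adjP// sX sY.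
  by rewrite conj_i mulNr opprK.
have ii : 'i%C * 'i%C = -1 :> R[i] by rewrite -expr2 sqr_i.
exists U; rewrite UE; split=> //.
- apply/funext => x; rewrite /U /U' /= (linD hX.1) (linD hY.1) (linZ hX.1) (linZ hY.1).
  rewrite scalerDr scalerA ii scaleN1r YYx XY opprB.
  by rewrite addrACA subrr addr0 addrC subrK.
- apply/funext => x; rewrite /U /U' /= (linB hX.1) (linB hY.1) (linZ hX.1) (linZ hY.1).
  rewrite scalerBr scalerA ii scaleN1r YYx XY opprK.
  by rewrite addrA subrK addrC subrK.
- move=> x; rewrite /U /U' /= addrACA subrr addr0 -mulr2n -[X x *+ 2]scaler_nat scalerA.
  by rewrite -(rmorph_nat (real_complex R)) -rmorphM /= mulVf ?scale1r.
Qed.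

End SquareRoot.

(** * Operator ideals: adjoints and finite-rank members *)

Section Ideals.
Context {R : realType} {H : hilbertType R}.
Implicit Types (x y z : H) (a b : R[i]) (A B T X Y Z : H -> H) (J : set (H -> H)).

Lemma ideal_bounded J A : op_ideal J -> J A -> bounded_op A.
Proof. by case=> h _ _ _ _; exact: h. Qed.

Lemma ideal_add J A B : op_ideal J -> J A -> J B -> J (A \+ B).
Proof. by case=> _ _ h _ _; exact: h. Qed.

Lemma ideal_compl J A T : op_ideal J -> bounded_op T -> J A -> J (T \o A).
Proof. by case=> _ _ _ h _ hT hA; exact: h. Qed.

Lemma ideal_compr J A T : op_ideal J -> J A -> bounded_op T -> J (A \o T).
Proof. by case=> _ _ _ _ h hA hT; exact: h. Qed.

Lemma ideal_scale J A a : op_ideal J -> J A -> J (a \*: A).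
Proof.
move=> hJ JA; have -> : a \*: A = (a \*: id) \o A by [].
by apply: ideal_compl => //; exact: bounded_scale bounded_id.
Qed.

Lemma ideal_sub J A B : op_ideal J -> J A -> J B -> J (A \- B).
Proof.
by move=> hJ JA JB; rewrite sub_funE; apply: ideal_add => //; exact: ideal_scale.
Qed.

(** With [T = V |T|] and [|T| = W T], the adjoint is [|T| V^* = W T V^*]. *)
Lemma ideal_adjoint J T : op_ideal J -> J T -> J (adjoint T).
Proof.
move=> hJ JT; have hT := ideal_bounded hJ JT; have hN := opabs_bounded hT.
have E x : nrm (opabs T x) = nrm (T x) by rewrite opabs_nrm.
have [V hV VT] := isometric_factor hN hT E.
have [W hW WT] := isometric_factor hT hN (fun x => esym (E x)).
have [pN _] := opabsP hT.
have -> : adjoint T = W \o T \o adjoint V.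
  by rewrite -{1}VT adjoint_comp// positive_adjoint// WT.
exact: ideal_compr hJ (ideal_compl hJ hW JT) (adjoint_bounded hV).
Qed.

(** A member [T] with [T x0 <> 0], squeezed between two rank-one operators, yields an arbitrary
    rank-one operator. *)
Lemma ideal_rank_sum J n (u v : 'I_n -> H) : op_ideal J -> J <> [set (fun=> 0)] ->
  J (rank_sum u v).
Proof.
move=> hJ J0; have [T [JT [x0 Tx0]]] : exists T, J T /\ exists x0, T x0 <> 0.
  apply: contrapT => /forallNP h; apply: J0; apply/seteqP; split=> T; last by move=> ->; case: hJ.
  move=> JT; apply/funext => x; apply: contrapT => Tx; apply: (h T); split=> //.
  by exists x.
have hT := ideal_bounded hJ JT.
pose rk1 (u v : H) := rank_sum (fun _ : 'I_1 => u) (fun _ : 'I_1 => v).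
have rk1E u' v' x : rk1 u' v' x = <|x, u'|> *: v' by rewrite /rk1 /rank_sum big_ord_recl big_ord0 addr0.
have J1 u' v' : J (rk1 u' v').
  have nC : (nrm (T x0) ^+ 2)%:C != 0 :> R[i].
    by rewrite realC_neq0// expf_neq0// gt_eqF// nrm_gt0.
  have -> : rk1 u' v' = rk1 (T x0) ((nrm (T x0) ^+ 2)%:C^-1 *: v') \o (T \o rk1 u' x0).
    apply/funext => x /=; rewrite !rk1E (linZ hT.1) ipZl ip_nrm scalerA.
    by rewrite mulfK.
  apply: ideal_compl => //; first exact: rank_sum_bounded.
  by apply: ideal_compr => //; exact: rank_sum_bounded.
have [_ J00 _ _ _] := hJ.
elim: n u v => [|n ih] u v.
  by rewrite (_ : rank_sum u v = fun=> 0)//; apply/funext => x; rewrite /rank_sum big_ord0.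
have -> : rank_sum u v = rk1 (u ord0) (v ord0) \+ rank_sum (u \o lift ord0) (v \o lift ord0).
  by apply/funext => x; rewrite /= rk1E /rank_sum big_ord_recl.
exact: ideal_add.
Qed.

End Ideals.

(** * Operators defined by orthogonal series, and an orthonormal expansion of a separable space *)

Section SeriesOperator.
Context {R : realType} {H : hilbertType R}.
Implicit Types (x y z : H) (a b : R[i]) (h g e : nat -> H).

(* Zero terms are allowed, so Gram-Schmidt needs no selection of independent vectors. *)
Definition suborthonormal h :=
  (forall i j, i != j -> <|h i, h j|> = 0) /\ forall i, nrm (h i) <= 1.

Definition psum h g x (n : nat) := \sum_(0 <= k < n) <|x, h k|> *: g k.

Lemma psumS h g x n : psum h g x n.+1 = psum h g x n + <|x, h n|> *: g n.
Proof. by rewrite /psum big_nat_recr. Qed.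

Lemma psum_linear h g n : linear (psum h g ^~ n).
Proof.
move=> a x y; rewrite /psum scaler_sumr -big_split; apply: eq_bigr => i _ /=.
by rewrite ipDl ipZl scalerDl scalerA.
Qed.

Lemma psum_orth h g x n y : (forall i, (i < n)%N -> <|g i, y|> = 0) ->
  <|psum h g x n, y|> = 0.
Proof.
move=> o; rewrite /psum ip_suml big_nat big1// => i /andP[_ ik].
by rewrite ipZl o// mulr0.
Qed.

Definition bessel_sum h x (n : nat) : R := \sum_(0 <= k < n) cabs <|x, h k|> ^+ 2.

Lemma bessel_sumS h x n : bessel_sum h x n.+1 = bessel_sum h x n + cabs <|x, h n|> ^+ 2.
Proof. by rewrite /bessel_sum big_nat_recr. Qed.

Lemma bessel_sum_mono h x n : bessel_sum h x n <= bessel_sum h x n.+1.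
Proof. by rewrite bessel_sumS lerDl sqr_ge0. Qed.

Lemma psum_diff h g x (M : R) m n : 0 <= M ->
  (forall i j, i != j -> <|g i, g j|> = 0) -> (forall i, nrm (g i) <= M) ->
  (m <= n)%N ->
  nrm (psum h g x n - psum h g x m) ^+ 2 <= M ^+ 2 * (bessel_sum h x n - bessel_sum h x m).
Proof.
move=> M0 og gM /subnKC <-; elim: (n - m)%N => [|k ih].
  by rewrite addn0 !subrr nrm0 expr0n mulr0.
rewrite addnS psumS bessel_sumS addrAC pythagoras; last first.
  rewrite ipZr ipBl !psum_orth ?subrr ?mulr0// => i ik; apply: og; rewrite ltn_eqF//.
  by rewrite (leq_trans ik)// leq_addr.
rewrite addrAC mulrDr lerD// nrmZ exprMn mulrC ler_wpM2r ?sqr_ge0//.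
by rewrite ler_pXn2r ?nnegrE ?nrm_ge0.
Qed.

Lemma psum_nrm h g x (M : R) n : 0 <= M ->
  (forall i j, i != j -> <|g i, g j|> = 0) -> (forall i, nrm (g i) <= M) ->
  nrm (psum h g x n) ^+ 2 <= M ^+ 2 * bessel_sum h x n.
Proof.
move=> M0 og gM; have := psum_diff h x M0 og gM (leq0n n).
by rewrite [psum h g x 0]/psum [bessel_sum h x 0]/bessel_sum !big_geq// !subr0.
Qed.

Lemma psum_Re h x n : complex.Re <|x, psum h h x n|> = bessel_sum h x n.
Proof.
by rewrite /psum ip_sumr Re_sum; apply: eq_bigr => k _; rewrite ipZr mulconjC.
Qed.

Lemma psum_residual h x n : suborthonormal h ->
  nrm (x - psum h h x n) ^+ 2 <= nrm x ^+ 2 - bessel_sum h x n.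
Proof.
move=> [oh h1]; rewrite nrm_sqB psum_Re; have := psum_nrm h x n ler01 oh h1.
by rewrite expr1n mul1r; lra.
Qed.

Lemma bessel h x n : suborthonormal h -> bessel_sum h x n <= nrm x ^+ 2.
Proof.
move=> hh; have := psum_residual x n hh; have := sqr_ge0 (nrm (x - psum h h x n)); lra.
Qed.

(** Orthogonality of [g] and Bessel's inequality for [h] make the partial sums Cauchy and bounded by
    [M * nrm x]. *)
Lemma series_operator h g (M : R) : suborthonormal h -> 0 <= M ->
  (forall i j, i != j -> <|g i, g j|> = 0) -> (forall i, nrm (g i) <= M) ->
  exists2 X, bounded_op X & forall x, tends (psum h g x) (X x).
Proof.
move=> hh M0 og gM.
have [X [bX _ tX]] : exists X, [/\ bounded_op X, bound_by X M & forall x, tends (psum h g x) (X x)].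
  apply: (@limit_op _ _ (fun n x => psum h g x n)) => //.
  - by move=> n; exact: psum_linear.
  - move=> n x; apply: le_nrm_sqr; first by rewrite mulr_ge0 ?nrm_ge0.
    rewrite (le_trans (psum_nrm h x n M0 og gM))//.
    by rewrite exprMn ler_wpM2l ?sqr_ge0// bessel.
  - move=> x; apply: (@tends_of_mono _ _ _ (fun n => M ^+ 2 * bessel_sum h x n) (M ^+ 2 * nrm x ^+ 2)).
    + by move=> n; rewrite ler_wpM2l ?sqr_ge0// bessel_sum_mono.
    + by move=> n; rewrite ler_wpM2l ?sqr_ge0// bessel.
    + by move=> m n mn; rewrite -mulrBr psum_diff.
by exists X.
Qed.

Lemma psum_fix h g e n k : (forall i j, i != j -> <|e i, h j|> = 0) ->
  (k < n)%N -> psum h g (e k) n = <|e k, h k|> *: g k.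
Proof.
move=> o kn; rewrite /psum (big_cat_nat _ (n := k.+1))//= big_nat_recr//=.
rewrite [X in X + _ + _]big_nat_cond big1 ?add0r; last first.
  by move=> i /andP[/andP[_ ik] _]; rewrite o ?scale0r// gtn_eqF.
rewrite big_nat_cond big1 ?addr0// => i /andP[/andP[ki _] _].
by rewrite o ?scale0r// ltn_eqF.
Qed.

Lemma separable_orthonormal : separable_space H ->
  exists2 h : nat -> H, suborthonormal h & forall x, tends (psum h h x) x.
Proof.
move=> [D cD dD].
have [d hd] : exists d : nat -> H, forall x, D x -> exists n, d n = x.
  have /countable_injP[f fI] := cD.
  (* Outside the image of [f] the sequence takes a default value; it only has to reach every point
     of [D]. *)
  exists (fun n => get [set y | D y /\ f y = n]) => x Dx; exists (f x).
  have [Dy fy] := getPex (ex_intro [set y | D y /\ f y = f x] x (conj Dx erefl)).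
  by apply: fI; rewrite ?inE.
pose sp n := lspan (fun i : 'I_n => d i).
have sp_closed n : closed_subspace (sp n) by exact: lspan_closed.
have sp_mem n k : (k < n)%N -> sp n (d k) by move=> kn; exact: (lspan_mem (fun i : 'I_n => d i) (Ordinal kn)).
have sp_mono m n : (m <= n)%N -> sp m `<=` sp n.
  by move=> mn; apply: lspan_min => [|i]; [exact: (sp_closed n).2|apply: sp_mem; exact: leq_trans mn].
pose w n := d n - orthoproj (sp n) (d n).
pose h n := (nrm (w n))^-1%:C *: w n.
have w_in n : sp n.+1 (w n).
  apply: subspaceB (sp_closed _).2 _ _; first exact: sp_mem.
  by apply: (sp_mono n) => //; exact: orthoproj_in.
have h_in n : sp n.+1 (h n) by exact: subspaceZ (sp_closed _).2 (w_in n).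
have h_orth n y : sp n y -> <|h n, y|> = 0.
  by move=> ny; rewrite ipZl orthoproj_orth ?mulr0.
have wh n : w n = (nrm (w n))%:C *: h n.
  have [w0|w0] := eqVneq (nrm (w n)) 0; first by rewrite w0 scale0r (nrm_eq0 w0).
  by rewrite /h scalerA -rmorphM mulfV// scale1r.
have hn n : w n = 0 \/ nrm (h n) = 1.
  have [w0|w0] := eqVneq (nrm (w n)) 0; first by left; exact: nrm_eq0.
  by right; rewrite nrmZ cabs_pos ?invr_ge0 ?nrm_ge0// mulVf.
have oh : suborthonormal h.
  split=> [i j|i]; last first.
    case: (hn i) => [w0|->]; last by rewrite lexx.
    by rewrite /h w0 scaler0 nrm0 ler01.
  rewrite neq_ltn => /orP[ij|ij]; last by apply: h_orth; exact: (sp_mono j.+1).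
  by apply: ip_eq0C; apply: h_orth; exact: (sp_mono i.+1).
exists h => // x.
have fix_h k n : (k < n)%N -> psum h h (h k) n = h k.
  move=> kn; rewrite psum_fix//; last exact: oh.1.
  case: (hn k) => [w0|h1]; first by rewrite /h w0 scaler0 ip0l scale0r.
  by rewrite ip_nrm h1 expr1n scale1r.
have fix_sp m : forall n, (m <= n)%N -> forall y, sp m y -> psum h h y n = y.
  elim: m => [|m ih] n mn y.
    by move=> [c _ <-]; rewrite big_ord0 (lin0 (psum_linear h h n)).
  move=> [c _ <-]; rewrite (lin_sum (psum_linear h h n)); apply: eq_bigr => i _.
  rewrite (linZ (psum_linear h h n)); congr (_ *: _).
  have := ltn_ord i; rewrite ltnS leq_eqVlt => /orP[/eqP ->|im]; last first.
    by apply: ih; [exact: ltnW|exact: sp_mem].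
  have -> : d m = w m + orthoproj (sp m) (d m) by rewrite subrK.
  rewrite (linD (psum_linear h h n)); congr (_ + _).
    by rewrite wh (linZ (psum_linear h h n)) fix_h.
  by apply: ih; [exact: ltnW|exact: orthoproj_in].
(* The partial sum is the projection onto [sp n], hence the best approximation there; density of [D]
   then gives convergence. *)
have best n y : sp n y -> nrm (x - psum h h x n) <= nrm (x - y).
  move=> ny; apply: le_nrm_sqr; first exact: nrm_ge0.
  have -> : x - y = (x - y) - psum h h (x - y) n + psum h h (x - y) n by rewrite subrK.
  have E : x - y - psum h h (x - y) n = x - psum h h x n.
    rewrite (linB (psum_linear h h n)) (fix_sp n n (leqnn n) y ny) opprB addrA.
    by rewrite subrK.
  rewrite E [leRHS]pythagoras ?lerDl ?sqr_ge0//.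
  have o i : (i < n)%N -> <|x - psum h h x n, h i|> = 0.
    move=> ik.
    rewrite ipBl; apply/eqP; rewrite subr_eq0; apply/eqP.
    rewrite /psum ip_suml (big_cat_nat _ (n := i.+1))//= big_nat_recr//=.
    rewrite [X in X + _ + _]big_nat_cond big1 ?add0r; last first.
      by move=> j /andP[/andP[_ ij] _]; rewrite ipZl oh.1 ?mulr0// ltn_eqF.
    rewrite [X in _ + X]big_nat_cond big1 ?addr0; last first.
      by move=> j /andP[/andP[ij _] _]; rewrite ipZl oh.1 ?mulr0// gtn_eqF.
    rewrite ipZl; case: (hn i) => [w0|h1]; first by rewrite /h w0 scaler0 ip0l ip0r mulr0.
    by rewrite ip_nrm h1 expr1n mulr1.
  by apply: ip_eq0C; apply: psum_orth => i ik; apply: ip_eq0C; exact: o.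
move=> r r0; have rC : 0 < r%:C :> R[i] by rewrite ltcR.
have [y [/= xy Dy]] := dD (ball x r%:C)^° (ex_intro _ x (nbhsx_ballx x _ rC)) (open_interior _).
move: xy => /interior_subset; rewrite -ball_normE /ball_ /= nrmE ltcR => /ltW xy.
have [k dk] := hd _ Dy; exists k.+1 => n kn; rewrite nrmBC (le_trans (best n y _))//.
by rewrite -dk; exact: sp_mem.
Qed.

End SeriesOperator.

(** * Proper ideals consist of compact operators *)

Section Calkin.
Context {R : realType} {H : hilbertType R}.
Implicit Types (x y z : H) (T : H -> H) (J : set (H -> H)).

(** Each new vector is taken orthogonal to the previous [y] and to their images under [T^* T]; the
    latter makes [T v] orthogonal to [T y]. *)
Lemma not_fapprox_sequence T : bounded_op T -> ~ fapprox T ->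
  exists2 c : R, 0 < c & exists e : nat -> H, [/\ forall i, nrm (e i) = 1,
    forall i j, i != j -> <|e i, e j|> = 0,
    forall i j, i != j -> <|T (e i), T (e j)|> = 0 & forall i, c <= nrm (T (e i))].
Proof.
move=> hT nT; have hT' := adjoint_bounded hT.
have [c [c0 hc]] : exists c : R, 0 < c /\ forall F, finrank F -> ~ bound_by (T \- F) c.
  apply: contrapT => /forallNP h; apply: nT; split=> // c c0; apply: contrapT => k.
  by apply: (h c); split=> // F fF bF; apply: k; exists F.
exists c => //.
have /choice[f hf] : forall s : seq H, exists v, [/\ nrm v = 1, c <= nrm (T v) &
    forall y, y \in s -> <|v, y|> = 0 /\ <|T v, T y|> = 0].
  move=> s; pose g (i : 'I_(size s)) := nth 0 s i.
  pose v (i : 'I_(size s + size s)) :=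
    match fintype.split i with inl i => g i | inr i => adjoint T (T (g i)) end.
  have [m [e [he lE _]]] := gram_schmidt v.
  have hP := rank_sum_bounded e e.
  have fT : finrank (T \o rank_sum e e) := finrank_compl hT (finrank_rank_sum e e).
  (* [T] composed with the projection onto the span of the forbidden vectors has finite rank, so it
     is not [c]-close to [T]; the residual of a witness is the new direction. *)
  have /existsNP[x /negP] := hc _ fT; rewrite -ltNge /= => hx.
  pose w := x - rank_sum e e x.
  have o : orthogonal_to (lspan v) w.
    by rewrite -lE; apply: orthogonal_to_lspan => i; exact: rank_sum_orth.
  have wx : nrm w <= nrm x.
    apply: le_nrm_sqr; first exact: nrm_ge0.
    rewrite -[in leRHS](subrK (rank_sum e e x) x) [leRHS]pythagoras ?lerDl ?sqr_ge0//.
    by apply: o; rewrite -lE; exact: rank_sum_in.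
  have Tw : c * nrm w < nrm (T w).
    by rewrite /w (linB hT.1) (le_lt_trans _ hx)// ler_pM2l.
  have w0 : 0 < nrm w.
    apply: nrm_gt0 => w0; move: Tw; rewrite w0 (lin0 hT.1) nrm0 mulr0.
    by rewrite ltxx.
  exists ((nrm w)^-1%:C *: w); split.
  - by rewrite nrmZ cabs_pos ?invr_ge0 ?nrm_ge0// mulVf// gt_eqF.
  - rewrite (linZ hT.1) nrmZ cabs_pos ?invr_ge0 ?nrm_ge0// mulrC.
    by rewrite ler_pdivlMr// ltW.
  - move=> y ys.
    have [j ->] : exists j, y = g j.
      by move: (ys); rewrite -index_mem => ys'; exists (Ordinal ys'); rewrite /g /= nth_index.
    rewrite (linZ hT.1) !ipZl adjP//; split; rewrite o ?mulr0//.
      by have := lspan_mem v (lshift _ j); rewrite /v (unsplitK (inl j)).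
    by have := lspan_mem v (rshift _ j); rewrite /v (unsplitK (inr j)).
pose fix hist n : seq H := if n is m.+1 then f (hist m) :: hist m else [::].
pose e n := f (hist n).
have mem_hist k n : (k < n)%N -> e k \in hist n.
  elim: n => // n ih; rewrite ltnS leq_eqVlt /= inE => /orP[/eqP ->|/ih ->].
    by rewrite eqxx.
  by rewrite orbT.
have o i j : (i < j)%N -> <|e j, e i|> = 0 /\ <|T (e j), T (e i)|> = 0.
  by move=> ij; have [_ _] := hf (hist j); apply; exact: mem_hist.
exists e; split.
- by move=> i; have [] := hf (hist i).
- by move=> i j; rewrite neq_ltn => /orP[/o[/ip_eq0C]|/o[]].
- by move=> i j; rewrite neq_ltn => /orP[/o[_ /ip_eq0C]|/o[]].
- by move=> i; have [] := hf (hist i).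
Qed.

Lemma calkin J : separable_space H -> proper_op_ideal J -> J `<=` fapprox.
Proof.
move=> sH [hJ _ JB] T JT; apply: contrapT => nT; apply: JB.
have hT := ideal_bounded hJ JT.
have [c c0 [e [e1 oe oT cT]]] := not_fapprox_sequence hT nT.
have [h hh th] := separable_orthonormal sH.
have [X hX tX] : exists2 X, bounded_op X & forall x, tends (psum h e x) (X x).
  by apply: (@series_operator _ _ h e 1) => // i; rewrite e1.
have T0 i : 0 < nrm (T (e i)) by exact: lt_le_trans (cT i).
(* [t] is orthonormal and [g] carries the remaining factor, so that [Y (T (e k)) = h k]; the lower
   bound [c] keeps [g] bounded by [c^-1]. *)
pose t i := (nrm (T (e i)))^-1%:C *: T (e i).
pose g i := (nrm (T (e i)))^-1%:C *: h i.
have [Y hY tY] : exists2 Y, bounded_op Y & forall x, tends (psum t g x) (Y x).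
  apply: (@series_operator _ _ t g c^-1) => //; last 3 first.
  - by rewrite invr_ge0 ltW.
  - by move=> i j ij; rewrite ipZl ipZr hh.1 ?mulr0.
  - move=> i; rewrite nrmZ cabs_pos ?invr_ge0 ?nrm_ge0// -[leRHS]mulr1.
    rewrite ler_pM ?invr_ge0 ?nrm_ge0//; last exact: hh.2.
    by rewrite lef_pV2 ?posrE.
  split=> [i j ij|i]; first by rewrite ipZl ipZr oT ?mulr0.
  by rewrite nrmZ cabs_pos ?invr_ge0 ?nrm_ge0// mulVf ?lexx// gt_eqF.
have YT k : Y (T (e k)) = h k.
  apply: tends_unique (tY _) _ => r r0; exists k.+1 => n kn.
  rewrite (@psum_fix _ _ t g (T \o e))//=; last first.
    by move=> i j ij; rewrite ipZr oT ?mulr0.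
  rewrite ipZr conjR ip_nrm -rmorphM /g scalerA -rmorphM /=.
  have -> : (nrm (T (e k)))^-1 * nrm (T (e k)) ^+ 2 * (nrm (T (e k)))^-1 = 1.
    by field; exact: lt0r_neq0 (T0 k).
  by rewrite scale1r subrr nrm0 ltW.
have YTX : Y \o (T \o X) = id.
  apply/funext => x /=; apply: tends_unique (tends_op hY (tends_op hT (tX x))) _.
  apply: tends_eq (th x) => n /=; rewrite /psum (lin_sum hT.1) (lin_sum hY.1).
  by apply: eq_bigr => k _; rewrite (linZ hT.1) (linZ hY.1) YT.
have Jid : J id by rewrite -YTX; apply: ideal_compl => //; exact: ideal_compr.
apply/seteqP; split=> A; first exact: ideal_bounded.
by move=> hA; have := ideal_compl hJ hA Jid.
Qed.

End Calkin.

(* Pairing with an arbitrary vector turns an identity of vectors into a scalar one. *)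
Ltac vector_ring :=
  apply: ip_ext => ?; rewrite ?(ipDl, ipBl, ipNl, ipZl, ip0l); ring.

(** * Null projections, essential codimension and the equivalence of (i), (ii) and (iii) *)

Section Equivalence.
Context {R : realType} {H : hilbertType R}.
Implicit Types (x y z : H) (A B C G K T U P Q : H -> H) (M N : set H) (J : set (H -> H)).

Lemma congr_op (A B : H -> H) x : A = B -> A x = B x.
Proof. by move=> ->. Qed.

(** [B Q = 0] gives [(1 - P) Q = A^+ (A - B) Q], which is in [J]; so is [(1 - Q) P] by symmetry, and
    [P - Q] is the adjoint of the latter minus the former. *)
Lemma null_proj_diff J A B : op_ideal J -> closed_range_op A -> closed_range_op B ->
  J (A \- B) -> J (orthoproj (nullspace A) \- orthoproj (nullspace B)).
Proof.
move=> hJ hA hB JAB; set P := orthoproj (nullspace A); set Q := orthoproj (nullspace B).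
have half A' B' : closed_range_op A' -> closed_range_op B' -> J (A' \- B') ->
    J ((id \- orthoproj (nullspace A')) \o orthoproj (nullspace B')).
  move=> hA' hB' JAB'; have [Ap [hAp ApA _]] := pseudo_inverse hA'.
  have cB := nullspace_closed hB'.1; have hQ := orthoproj_bounded cB.
  have -> : (id \- orthoproj (nullspace A')) \o orthoproj (nullspace B') =
      Ap \o ((A' \- B') \o orthoproj (nullspace B')).
    apply/funext => x /=; rewrite -ApA; congr (Ap _).
    have -> : B' (orthoproj (nullspace B') x) = 0 by exact: (orthoproj_in x cB).
    by rewrite subr0.
  by apply: ideal_compl => //; exact: ideal_compr.
have hP : bounded_op P by exact/orthoproj_bounded/nullspace_closed/hA.1.
have hQ : bounded_op Q by exact/orthoproj_bounded/nullspace_closed/hB.1.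
have JBA : J (B \- A).
  have -> : B \- A = -1 \*: (A \- B) by apply/funext => x /=; rewrite scaleN1r opprB.
  exact: ideal_scale.
have h1 := half _ _ hA hB JAB; have h2 := ideal_adjoint hJ (half _ _ hB hA JBA).
have -> : P \- Q = adjoint ((id \- Q) \o P) \- ((id \- P) \o Q).
  have hQ' : bounded_op (id \- Q) by exact: bounded_sub bounded_id hQ.
  rewrite adjoint_comp// adjoint_sub//; last exact: bounded_id.
  rewrite adjoint_id !adjoint_orthoproj; [|exact: nullspace_closed hB.1|exact: nullspace_closed hA.1].
  apply/funext => x; rewrite /= -/P -/Q (linB hP.1); vector_ring.
exact: ideal_sub.
Qed.

Lemma orth_projection_orthoproj M : closed_subspace M -> orth_projection (orthoproj M).
Proof.
by move=> hM; split; [exact: orthoproj_bounded|exact: orthoproj_idem|exact: adjoint_orthoproj].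
Qed.

Lemma Gl_inv_diff J K : op_ideal J -> Gl_ideal J K -> J (op_inv K \- id).
Proof.
move=> hJ [iK JK]; have hK := op_inv_bounded iK.
have -> : op_inv K \- id = -1 \*: (op_inv K \o (K \- id)).
  apply/funext => x /=; rewrite (linB hK.1) op_invK// scaleN1r opprB.
  by [].
by apply: ideal_scale => //; exact: ideal_compl.
Qed.

Lemma image_closed K M : invertible_op K -> closed_subspace M -> closed_subspace (K @` M).
Proof.
move=> iK [cM sM]; have hK := iK.1; have hL := op_inv_bounded iK.
have [c c0 hc] := bounded_bound hL; split.
  apply: (@below_image_closed _ _ _ _ c^-1) => //; first by rewrite invr_gt0.
  by move=> x _; rewrite ler_pdivrMl// -{1}(op_invK x iK).
split; first by exists 0; [exact: sM.1|exact: (lin0 hK.1)].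
move=> a _ _ [x Mx <-] [y My <-]; exists (a *: x + y); last by rewrite hK.1.
exact: sM.2.
Qed.

Lemma ess_codim_image J K M : op_ideal J -> J `<=` fapprox -> Gl_ideal J K ->
  closed_subspace M -> ess_codim (orthoproj M) (orthoproj (K @` M)) 0.
Proof.
move=> hJ Jc GK hM; have [iK _] := GK; have hN := image_closed iK hM.
set N := K @` M in hN *; set P := orthoproj M; set Q := orthoproj N; set L := op_inv K.
have hL : bounded_op L := op_inv_bounded iK.
have hQ : bounded_op Q := orthoproj_bounded hN.
have QN y : N y -> Q y = y by move=> Ny; exact: orthoproj_id.
have NQ y : N (Q y) by exact: orthoproj_in.
have ML y : N y -> M (L y) by move=> [x Mx <-]; rewrite /L op_invK.
have NK x : M x -> N (K x) by move=> Mx; exists x.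
have Qsym x y : <|Q x, y|> = <|x, Q y|> by exact: orthoproj_sym.
(* [1 + C] is the compression [Q L] on [N] and the identity on its orthogonal complement, so the
   alternative on the whole of [H] applies. *)
pose C := Q \o ((L \- id) \o Q).
have fC : fapprox C.
  apply: Jc; apply: ideal_compl => //; apply: ideal_compr => //; exact: Gl_inv_diff.
have CN y : N y -> y + C y = Q (L y).
  by move=> Ny; rewrite /C /= (QN y Ny) (linB hQ.1) (QN y Ny) addrC subrK.
have [cS [n [k1 k2]]] := fredholm_alternative fC.
set S := id \+ C in cS k1 k2.
have hS : bounded_op S by exact: bounded_add bounded_id fC.1.
have kS : nullspace S = [set y | N y /\ Q (L y) = 0].
  apply/seteqP; split=> y; rewrite /nullspace /S /=; last by case=> Ny; rewrite CN.
  move=> Sy; have Ny : N y.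
    have -> : y = - C y by apply/eqP; rewrite -addr_eq0; apply/eqP.
    by apply: subspaceN hN.2 _; exact: NQ.
  by split=> //; rewrite -CN.
have rS : range S `&` N = Q @` M.
  apply/seteqP; split=> [y [[z _ <-] Ny]|_ [x Mx <-]].
    have Nz : N z.
      have -> : z = S z - C z by rewrite /S /= addrK.
      by apply: subspaceB hN.2 Ny _; exact: NQ.
    by exists (L z); [exact: ML|rewrite /S /= CN].
  split=> //; exists (K x) => //; rewrite /S /= CN; last exact: NK.
  by rewrite /L op_invK.
(* Together with [kS] this identifies the two intersections that define the essential codimension
   with the kernel of [S], up to [L], and the complement of its range; their dimensions agree. *)
have oS : orthogonal_to (range S) = [set y | N y /\ orthogonal_to M y].
  apply/seteqP; split=> y.
    move=> hy; have Ny : N y.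
      rewrite -(ortho_ortho hN) => z oz; apply: hy; exists z => //.
      have Qz : Q z = 0 by exact: orthoproj0.
      by rewrite /S /C /= Qz (lin0 hL.1) subrr (lin0 hQ.1) addr0.
    split=> // x Mx; have : <|y, Q x|> = 0 by apply: hy; have [] : (range S `&` N) (Q x) by rewrite rS; exists x.
    by rewrite -Qsym (QN y Ny).
  move=> [Ny oy] _ [z _ <-]; rewrite /S /C /= ipDr -Qsym (QN y Ny) ipBr.
  by rewrite (oy (L (Q z)) (ML _ (NQ z))) sub0r -Qsym (QN y Ny) subrr.
have rP : range P = M := range_orthoproj hM.
have rQ : range Q = N := range_orthoproj hN.
have nP : nullspace P = orthogonal_to M := nullspace_orthoproj hM.
have dP : has_dim (nullspace Q `&` range P) n.
  have -> : nullspace Q `&` range P = L @` nullspace S.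
    rewrite rP kS; apply/seteqP; split=> [x [Qx Mx]|_ [y [Ny Qy] <-]].
      by exists (K x); rewrite /L ?op_invK//; split; [exact: NK|rewrite op_invK].
    by split=> //; exact: ML.
  apply: has_dim_image k1 => [|x _ Lx]; first exact: hL.1.
  by rewrite -(op_invKr x iK) -/L Lx (lin0 iK.1.1).
have dQ : has_dim (range Q `&` nullspace P) n.
  have -> : range Q `&` nullspace P = orthogonal_to (range S) by rewrite rQ nP oS.
  exact: k2.
split; last by exists n, n; split=> //; rewrite subrr.
split; [exact: orth_projection_orthoproj|exact: orth_projection_orthoproj|].
have QPM : (Q \o P) @` M = Q @` M.
  by apply/seteqP; split=> _ [x Mx <-]; exists x; rewrite //= /P orthoproj_id.
rewrite rP rQ; split.
- by move=> _ [x _ <-]; exact: NQ.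
- exists n; have -> : M `&` nullspace (Q \o P) = nullspace Q `&` range P => //.
  rewrite rP; apply/seteqP; split=> x; rewrite /nullspace /= => -[].
    by move=> Mx; rewrite /P orthoproj_id.
  by move=> Qx Mx; rewrite /P orthoproj_id.
- rewrite QPM -rS; apply: closedI => //; exact: hN.1.
- exists (orthogonal_to (range S)); first by exists n.
  move=> y Ny; have hR : closed_subspace (range S) by split=> //; exact: range_subspace hS.1.
  pose p := orthoproj (range S) y; have Rp : range S p by exact: orthoproj_in.
  have oq : orthogonal_to (range S) (y - p) by move=> z; exact: orthoproj_orth.
  have Np : N p.
    have -> : p = y - (y - p) by rewrite subKr.
    by apply: subspaceB hN.2 Ny _; move: oq; rewrite oS => -[].
  have : (Q @` M) p by rewrite -rS.
  by move=> [x Mx xp]; exists x => //=; rewrite /P orthoproj_id// xp.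
Qed.

(** The two factors are removed one at a time in [A - B], and [N(B) = K (N(A))]. *)
Lemma multiplicative_ess_codim J A B G K : op_ideal J -> J `<=` fapprox ->
  bounded_op A -> Gl_ideal J G -> Gl_ideal J K -> B = G \o A \o op_inv K ->
  J (A \- B) /\ ess_codim (orthoproj (nullspace A)) (orthoproj (nullspace B)) 0.
Proof.
move=> hJ Jc hA GG GK BE; have [iG JG] := GG; have [iK JK] := GK.
have hL := op_inv_bounded iK; split.
  have -> : A \- B = (-1 \*: (A \o (op_inv K \- id))) \- ((G \- id) \o (A \o op_inv K)).
    apply/funext => x; rewrite BE /= scaleN1r (linB hA.1) !opprB addrA.
    by rewrite subrK.
  apply: ideal_sub => //.
    by apply: ideal_scale => //; apply: ideal_compl => //; exact: Gl_inv_diff.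
  by apply: ideal_compr => //; exact: bounded_comp.
suff -> : nullspace B = K @` nullspace A.
  exact: ess_codim_image hJ Jc GK (nullspace_closed hA).
apply/seteqP; split=> [x|_ [x Ax <-]].
  rewrite /nullspace BE /= => h; exists (op_inv K x); last by rewrite op_invKr.
  by rewrite /nullspace /= -(op_invK (A _) iG) h (lin0 (op_inv_bounded iG).1).
by rewrite /nullspace BE /= op_invK// Ax (lin0 iG.1.1).
Qed.

Lemma invertible_below G : invertible_op G -> exists2 c : R, 0 < c & bounded_below G setT c.
Proof.
move=> iG; have [c c0 hc] := bounded_bound (op_inv_bounded iG).
exists c^-1; first by rewrite invr_gt0.
by move=> x _; rewrite ler_pdivrMl// -{1}(op_invK x iG).
Qed.

Lemma positive_invertible T (c : R) : positive_op T -> 0 < c -> bounded_below T setT c ->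
  invertible_op T.
Proof.
move=> pT c0 hc; apply: (lax_milgram pT.1 c0 hc) => x.
rewrite positive_adjoint// => Tx; apply/nrm_eq0/eqP.
by rewrite eq_le nrm_ge0 andbT -(ler_pM2l c0) mulr0 (le_trans (hc _ I))// Tx nrm0.
Qed.

Lemma positive_Re T x : positive_op T -> 0 <= complex.Re <|T x, x|>.
Proof. by move=> [_ pT]; have := pT x; rewrite lecE => /andP[_]. Qed.

Lemma positive_add1_invertible T : positive_op T -> invertible_op (id \+ T).
Proof.
move=> pT; have hT := pT.1.
have p1 : positive_op (id \+ T).
  split; first exact: bounded_add bounded_id hT.
  by move=> x /=; rewrite ipDl addr_ge0 ?pT.2// ip_nrm ler0c sqr_ge0.
apply: (positive_invertible p1 ltr01) => x _; rewrite mul1r.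
apply: le_nrm_sqr; first exact: nrm_ge0.
rewrite /= nrm_sqD -(positive_sym _ _ pT); have := positive_Re x pT.
by have := sqr_ge0 (nrm (T x)); lra.
Qed.

Lemma unitary_part J G P Q : op_ideal J -> Gl_ideal J G -> bounded_op P -> bounded_op Q ->
  adjoint P = P -> adjoint Q = Q -> G \o P = Q \o G ->
  exists2 U, U_ideal J U & U \o P = Q \o U.
Proof.
move=> hJ [iG JG] hP hQ sP sQ GP; have hG := iG.1; have hG' := adjoint_bounded hG.
have [T [pT TT cT]] := operator_root hG.
have hT := pT.1; have sT := positive_adjoint pT.
have [c c0 hc] := invertible_below iG.
have iT : invertible_op T.
  apply: (positive_invertible pT c0) => x _.
  by rewrite (root_nrm x pT hG TT) hc.
have PG : P \o adjoint G = adjoint G \o Q.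
  by rewrite -{1}sP -adjoint_comp// GP adjoint_comp// sQ.
(* [G P = Q G] and its adjoint show that [P] commutes with [G^* G], hence with its root. *)
have PT : P \o T = T \o P.
  apply: cT => //; apply/funext => x /=.
  rewrite [LHS](congr_op _ PG) /=; congr (adjoint G _).
  by rewrite -[RHS]/((G \o P) x) GP.
have hS := op_inv_bounded iT.
pose S := op_inv T; pose U := G \o S; have hU : bounded_op U by exact: bounded_comp.
have sS : adjoint S = S.
  apply: adjoint_uniq => // x y.
  have := positive_sym (S x) (S y) pT.
  by rewrite /S !op_invKr.
have UU : adjoint U \o U = id.
  rewrite adjoint_comp// sS; apply/funext => x /=.
  rewrite -[adjoint G _]/((adjoint G \o G) (S x)) -TT /= /S op_invKr//.
  by rewrite op_invK.
have UU' : U \o adjoint U = id.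
  apply/funext => y; have [x <-] : exists x, U x = y.
    by exists (T (op_inv G y)); rewrite /U /S /= op_invK// op_invKr.
  by rewrite /= -[adjoint U (U x)]/((adjoint U \o U) x) UU.
exists U; last first.
  apply/funext => x; rewrite /U /=.
  have -> : S (P x) = P (S x).
    rewrite -{1}(op_invKr x iT) -/S -[P (T _)]/((P \o T) (S x)) PT /=.
    by rewrite /S op_invK.
  by rewrite -[G (P _)]/((G \o P) (S x)) GP.
split=> //; pose C := G \- id.
have JTT : J (T \o T \- id).
  have -> : T \o T \- id = C \+ (adjoint C \o G).
    apply/funext => x; rewrite adjoint_sub//; last exact: bounded_id.
    rewrite adjoint_id /C /= (congr_op x TT : T (T x) = adjoint G (G x)).
    vector_ring.
  apply: ideal_add => //; apply: ideal_compr => //; exact: ideal_adjoint.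
have iT1 := positive_add1_invertible pT.
have JT : J (T \- id).
  (* Here the root is compared with 1, with which it commutes, so the difference of squares
     factors. *)
  have -> : T \- id = op_inv (id \+ T) \o (T \o T \- id).
    apply/funext => x; rewrite -[LHS](op_invK _ iT1) /=; congr (op_inv _ _).
    rewrite (linB hT.1); vector_ring.
  by apply: ideal_compl => //; exact: op_inv_bounded.
have -> : U \- id = (C \- (T \- id)) \o S.
  apply/funext => x; rewrite /U /C /= -{2}(op_invKr x iT) -/S; vector_ring.
by apply: ideal_compr => //; exact: ideal_sub.
Qed.

Lemma ortho_sum0 x y : x + y = 0 -> <|x, y|> = 0 -> x = 0.
Proof.
move=> xy o; apply: ip_eq0; have -> : <|x, x|> = <|x, x + y|> by rewrite ipDr o addr0.
by rewrite xy ip0r.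
Qed.

Lemma rank_sum0 n (u v : 'I_n -> H) x i : orthon v -> rank_sum u v x = 0 -> <|x, u i|> = 0.
Proof.
by move=> hv h; rewrite -(orthon_coef (fun i => <|x, u i|>) i hv) -/(rank_sum u v x) h ip0l.
Qed.

Lemma lspan_coef0 n (u : 'I_n -> H) x : orthon u -> lspan u x ->
  (forall i, <|x, u i|> = 0) -> x = 0.
Proof.
move=> hu lx h; rewrite -(rank_sum_id hu lx) /rank_sum big1// => i _.
by rewrite h scale0r.
Qed.

Lemma projections_unitarily_equivalent J M N n : op_ideal J -> J `<=` fapprox ->
  J <> [set (fun=> 0)] -> closed_subspace M -> closed_subspace N ->
  J (orthoproj M \- orthoproj N) ->
  has_dim (nullspace (orthoproj N) `&` range (orthoproj M)) n ->
  has_dim (range (orthoproj N) `&` nullspace (orthoproj M)) n ->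
  exists2 U, U_ideal J U & orthoproj N = U \o orthoproj M \o adjoint U.
Proof.
move=> hJ Jc J0 hM hN JD; rewrite !range_orthoproj// !nullspace_orthoproj//.
move=> /has_dim_orthon[k hk kE] /has_dim_orthon[d hd dE].
set P := orthoproj M in JD *; set Q := orthoproj N in JD *.
have hP : bounded_op P := orthoproj_bounded hM.
have hQ : bounded_op Q := orthoproj_bounded hN.
have kM i : orthogonal_to N (k i) /\ M (k i).
  by have := lspan_mem k i; rewrite -kE.
have dN i : N (d i) /\ orthogonal_to M (d i).
  by have := lspan_mem d i; rewrite -dE.
pose D := P \- Q; pose W := rank_sum k d \+ rank_sum d k.
(* [Q P + (1 - Q)(1 - P) - 1 = Q (P - Q) - (P - Q) P], which displays the factors in [J]. *)
pose C := ((Q \o D) \- (D \o P)) \+ W.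
have JC : J C.
  apply: ideal_add => //; last by apply: ideal_add => //; exact: ideal_rank_sum.
  by apply: ideal_sub => //; [exact: ideal_compl|exact: ideal_compr].
have hC := ideal_bounded hJ JC.
pose G := id \+ C.
have QQ x : Q (Q x) = Q x by rewrite [LHS](congr_op x (orthoproj_idem hN)).
have PP x : P (P x) = P x by rewrite [LHS](congr_op x (orthoproj_idem hM)).
have GE x : G x = (Q (P x) + rank_sum k d x) + ((x - P x) - Q (x - P x) + rank_sum d k x).
  rewrite /G /C /D /W /= PP !(linB hQ.1) QQ.
  vector_ring.
have Psym x y : <|P x, y|> = <|x, P y|> by exact: orthoproj_sym.
have Qsym x y : <|Q x, y|> = <|x, Q y|> by exact: orthoproj_sym.
have Pk i : P (k i) = k i by apply: orthoproj_id => //; exact: (kM i).2.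
have Qd i : Q (d i) = d i by apply: orthoproj_id => //; exact: (dN i).1.
have Pd i : P (d i) = 0 by apply: orthoproj0 => //; exact: (dN i).2.
have Qk i : Q (k i) = 0 by apply: orthoproj0 => //; exact: (kM i).1.
have PW x : P (rank_sum k d x) = 0.
  by rewrite (lin_sum hP.1) big1// => i _; rewrite (linZ hP.1) Pd scaler0.
have QW x : Q (rank_sum k d x) = rank_sum k d x.
  by rewrite (lin_sum hQ.1); apply: eq_bigr => i _; rewrite (linZ hQ.1) Qd.
have PV x : P (rank_sum d k x) = rank_sum d k x.
  by rewrite (lin_sum hP.1); apply: eq_bigr => i _; rewrite (linZ hP.1) Pk.
have QV x : Q (rank_sum d k x) = 0.
  by rewrite (lin_sum hQ.1) big1// => i _; rewrite (linZ hQ.1) Qk scaler0.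
(* [u] lies in [R(Q)] and [v] in its complement, so both vanish. In each, the swap is orthogonal to
   the rest: [Q P x = 0] puts [P x] in the span of [k], where the swap is injective; then [x] is
   treated likewise in the span of [d]. *)
have inj x : x + C x = 0 -> x = 0.
  rewrite -[x + C x]/(G x) GE; set u := Q (P x) + _; set v := _ + rank_sum d k x.
  have Qu : Q u = u by rewrite /u (linD hQ.1) QQ QW.
  have Qv : Q v = 0 by rewrite /v (linD hQ.1 _ (rank_sum d k x)) (linB hQ.1 (x - P x)) QQ subrr add0r QV.
  move=> uv; have ou : <|u, v|> = 0 by rewrite -Qu Qsym Qv ip0r.
  have u0 := ortho_sum0 uv ou; have v0 : v = 0 by move: uv; rewrite u0 add0r.
  have o1 : <|Q (P x), rank_sum k d x|> = 0 by rewrite Qsym QW Psym PW ip0r.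
  have QPx := ortho_sum0 u0 o1.
  have W0 : rank_sum k d x = 0 by move: u0; rewrite /u QPx add0r.
  have Px : P x = 0.
    apply: (lspan_coef0 hk) => [|i]; last by rewrite Psym Pk; exact: rank_sum0 hd W0.
    rewrite -kE; split; last exact: orthoproj_in.
    by rewrite -[P x]subr0 -QPx => y Ny; exact: orthoproj_orth.
  have o2 : <|x - Q x, rank_sum d k x|> = 0.
    by rewrite ipBl Qsym QV ip0r subr0 -PV -Psym Px ip0l.
  have v0' : x - Q x + rank_sum d k x = 0 by move: v0; rewrite /v Px subr0.
  have Qx := ortho_sum0 v0' o2.
  have V0 : rank_sum d k x = 0 by move: v0'; rewrite Qx add0r.
  apply: (lspan_coef0 hd) => [|i]; last exact: rank_sum0 hk V0.
  rewrite -dE; split.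
    by move/eqP: Qx; rewrite subr_eq0 => /eqP ->; exact: orthoproj_in.
  by rewrite -[x]subr0 -Px => y My; exact: orthoproj_orth.
have GP : G \o P = Q \o G.
  apply/funext => x; rewrite /= !GE PP subrr (lin0 hQ.1).
  rewrite (linD hQ.1 (_ + rank_sum k d x)) (linD hQ.1 (Q (P x))) QQ QW.
  rewrite (linD hQ.1 _ (rank_sum d k x)) (linB hQ.1 (x - P x)) QQ QV subrr addr0.
  have -> : rank_sum k d (P x) = rank_sum k d x.
    by apply: eq_bigr => i _; rewrite Psym Pk.
  have -> : rank_sum d k (P x) = 0.
    by rewrite /rank_sum big1// => i _; rewrite Psym Pd ip0r scale0r.
  by rewrite subrr !addr0.
have iG : invertible_op G by apply: fredholm_invertible => //; exact: Jc.
have GlG : Gl_ideal J G.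
  split=> //; have -> : G \- id = C by apply/funext => x /=; rewrite /G /= addrAC subrr add0r.
  exact: JC.
have [U JU UP] := unitary_part hJ GlG hP hQ (adjoint_orthoproj hM) (adjoint_orthoproj hN) GP.
exists U => //; rewrite UP; have [[_ _ UU] _] := JU.
by apply/funext => x /=; have /= -> := congr_op x UU.
Qed.

Lemma left_equivalent J A B : op_ideal J -> J `<=` fapprox -> J <> [set (fun=> 0)] ->
  closed_range_op A -> closed_range_op B -> nullspace A = nullspace B -> J (A \- B) ->
  exists2 G, Gl_ideal J G & B = G \o A.
Proof.
move=> hJ Jc J0 hA hB NAB JAB.
have [Ap [hAp ApA AAp]] := pseudo_inverse hA.
have [Bp [hBp BpB BBp]] := pseudo_inverse hB.
have cA : closed_subspace (range A) by split; [exact: hA.2|exact: range_subspace hA.1.1].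
have cB : closed_subspace (range B) by split; [exact: hB.2|exact: range_subspace hB.1.1].
set P := orthoproj (range A) in AAp; set Q := orthoproj (range B) in BBp.
have hP : bounded_op P := orthoproj_bounded cA.
have hQ : bounded_op Q := orthoproj_bounded cB.
have hP' : bounded_op (id \- P) := bounded_sub bounded_id hP.
have PA x : P (A x) = A x by apply: orthoproj_id => //; exists x.
have QB x : Q (B x) = B x by apply: orthoproj_id => //; exists x.
have JBA : J (B \- A).
  have -> : B \- A = -1 \*: (A \- B) by apply/funext => x /=; rewrite scaleN1r opprB.
  exact: ideal_scale.
(* [(1 - P) A = 0], so [(1 - P) Q = (1 - P) B B^+] only sees [B - A]. *)
have JPQ : J ((id \- P) \o Q).
  have -> : (id \- P) \o Q = (id \- P) \o ((B \- A) \o Bp).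
    apply/funext => x /=; rewrite -BBp (linB hP.1) PA; vector_ring.
  by apply: ideal_compl => //; exact: ideal_compr.
have JQP : J (Q \o (id \- P)).
  have := ideal_adjoint hJ JPQ; rewrite adjoint_comp// adjoint_sub//; last exact: bounded_id.
  by rewrite adjoint_id !adjoint_orthoproj.
pose C := ((B \- A) \o Ap) \- (Q \o (id \- P)).
have JC : J C by apply: ideal_sub => //; exact: ideal_compr.
have SE x : x + C x = B (Ap x) + (x - P x - Q (x - P x)).
  rewrite /C /= AAp; vector_ring.
have QQ x : Q (Q x) = Q x by rewrite [LHS](congr_op x (orthoproj_idem cB)).
have Qsym x y : <|Q x, y|> = <|x, Q y|> by exact: orthoproj_sym.
(* The two summands lie in [R(B)] and its complement, so [B A^+ x = 0]; equality of the nullspaces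
   turns this into [P x = A A^+ x = 0]. Hence the kernel is orthogonal to [R(A)] and the correction
   vanishes there. *)
have kerP x : x + C x = 0 -> P x = 0.
  rewrite SE => h; have o : <|B (Ap x), x - P x - Q (x - P x)|> = 0.
    by rewrite -QB Qsym (linB hQ.1) QQ subrr ip0r.
  have : nullspace B (Ap x) := ortho_sum0 h o.
  by rewrite -NAB /nullspace /= AAp.
have [_ [n []]] := fredholm_alternative (Jc _ JC).
move=> /has_dim_orthon[k hk kE] /has_dim_orthon[d hd dE].
exists (id \+ (C \+ rank_sum k d)).
  split; first exact: rank_sum_fill (Jc _ JC) hk kE hd dE.
  have -> : (id \+ (C \+ rank_sum k d)) \- id = C \+ rank_sum k d.
    by apply/funext => x /=; rewrite addrAC subrr add0r.
  by apply: ideal_add => //; exact: ideal_rank_sum.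
apply/funext => x /=; rewrite addrA SE PA subrr (lin0 hQ.1) subrr addr0 ApA.
have -> : rank_sum k d (A x) = 0.
  rewrite /rank_sum big1// => i _.
  have Pk : P (k i) = 0.
    by apply: kerP; have := lspan_mem k i; rewrite -kE.
  by rewrite -PA (orthoproj_sym (A x) (k i) cA) -/P Pk ip0r scale0r.
rewrite addr0 (linB hB.1.1).
have -> : B (orthoproj (nullspace A) x) = 0.
  by rewrite NAB; exact: (orthoproj_in x (nullspace_closed hB.1)).
by rewrite subr0.
Qed.

Lemma unitary_equivalent J A B U : op_ideal J -> J `<=` fapprox -> J <> [set (fun=> 0)] ->
  closed_range_op A -> closed_range_op B -> J (A \- B) -> U_ideal J U ->
  orthoproj (nullspace B) = U \o orthoproj (nullspace A) \o adjoint U ->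
  exists G K, [/\ Gl_ideal J G, Gl_ideal J K & B = G \o A \o op_inv K].
Proof.
move=> hJ Jc J0 hA hB JAB [[hU UU UU'] JU] BE.
have cA := nullspace_closed hA.1; have cB := nullspace_closed hB.1.
have UUx x : adjoint U (U x) = x by rewrite [LHS](congr_op x UU).
have UUx' x : U (adjoint U x) = x by rewrite [LHS](congr_op x UU').
have isU : is_inverse U (adjoint U) by split=> //; exact: adjoint_bounded.
have iU : invertible_op U by split=> //; exists (adjoint U).
have NE : nullspace A = nullspace (B \o U).
  apply/seteqP; split=> x.
    move=> Ax; rewrite /nullspace /=; have := orthoproj_in (U x) cB.
    by rewrite BE /= UUx orthoproj_id.
  move=> BUx; have BUx' : nullspace B (U x) by exact: BUx.
  have := orthoproj_id cB BUx'; rewrite BE /= UUx => h.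
  by rewrite -(UUx x) -h UUx; exact: orthoproj_in.
have hBU : closed_range_op (B \o U).
  split; first exact: bounded_comp hB.1 hU.
  rewrite (_ : range (B \o U) = range B); first exact: hB.2.
  apply/seteqP; split=> [_ [x _ <-]|_ [x _ <-]]; first by exists (U x).
  by exists (adjoint U x) => //=; rewrite UUx'.
have JBU : J (A \- (B \o U)).
  have -> : A \- (B \o U) = (A \- B) \- (B \o (U \- id)).
    apply/funext => x /=; rewrite (linB hB.1.1); vector_ring.
  by apply: ideal_sub => //; apply: ideal_compl => //; exact: hB.1.
have [G GG GE] := left_equivalent hJ Jc J0 hA hBU NE JBU.
exists G, U; split=> //.
rewrite (op_inv_uniq isU iU) -GE; apply/funext => x /=.
by rewrite UUx'.
Qed.

End Equivalence.

(** * Eigenvectors of positive compact operators and existence of singular values *)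

Section Spectral.
Context {R : realType} {H : hilbertType R}.
Implicit Types (x y z : H) (A B D E T X : H -> H) (M : set H).

(** The inequality [T^2 <= l T] on an invariant subspace, from positivity of [T] at the vector
    [x - T x / l]. *)
Lemma positive_quad T M (l : R) x : positive_op T -> 0 < l -> is_subspace M ->
  (forall y, M y -> M (T y)) -> (forall y, M y -> nrm (T y) <= l * nrm y) -> M x ->
  nrm (T x) ^+ 2 <= l * complex.Re <|T x, x|>.
Proof.
move=> pT l0 sM MT hl Mx; have lT := pT.1.1.
pose t : R := l^-1; have t0 : 0 < t by rewrite invr_gt0.
have := positive_Re (x - t%:C *: T x) pT.
rewrite (linB lT) (linZ lT) ipBl !ipBr !ipZl !ipZr conjR.
rewrite (positive_sym (T x) x pT) !(ReD, ReN, ReM_real) !Re_ip => h.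
have h2 : complex.Re <|T (T x), T x|> <= l * nrm (T x) ^+ 2.
  rewrite (le_trans (Re_le_cabs _))// (le_trans (cauchy_schwarz _ _))//.
  by rewrite expr2 mulrA ler_wpM2r ?nrm_ge0// hl//; exact: MT.
have tl : t * l = 1 by rewrite mulVf// gt_eqF.
have h3 : t * (t * complex.Re <|T (T x), T x|>) <= t * nrm (T x) ^+ 2.
  by rewrite ler_pM2l// (le_trans (ler_wpM2l (ltW t0) h2))// mulrA tl mul1r.
rewrite -(ler_pM2l t0) [leRHS]mulrA tl mul1r.
by move: h h3; lra.
Qed.

(** [(l - T)^2 <= l^2 - T^2]: a lower bound for either of [T] and [l - T] pushes the norm of the
    other strictly below [l]. *)
Lemma shift_bound T M (l : R) x : positive_op T -> 0 < l -> is_subspace M ->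
  (forall y, M y -> M (T y)) -> (forall y, M y -> nrm (T y) <= l * nrm y) -> M x ->
  nrm (l%:C *: x - T x) ^+ 2 <= l ^+ 2 * nrm x ^+ 2 - nrm (T x) ^+ 2.
Proof.
move=> pT l0 sM MT hl Mx; have := positive_quad pT l0 sM MT hl Mx.
rewrite nrm_sqB nrmZ cabs_pos ?(ltW l0)// ipZl ReM_real exprMn -(positive_sym _ _ pT).
by lra.
Qed.

(* If the norm [l] of [T] on [M] were not an eigenvalue, [1 - T / l] would be bounded
   below on [M], which by [shift_bound] makes the norm smaller than [l]. *)
Lemma top_eigenvector T M : positive_op T -> fapprox T -> closed_subspace M ->
  (forall x, M x -> M (T x)) ->
  exists l : R, [/\ 0 <= l, forall x, M x -> nrm (T x) <= l * nrm x &
    0 < l -> exists u, [/\ M u, nrm u = 1 & T u = l%:C *: u]].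
Proof.
move=> pT fT hM MT; have hT := pT.1; have [c c0 hc] := bounded_bound hT.
pose V := [set nrm (T x) | x in [set x | M x /\ nrm x <= 1]].
have V0 : V 0 by exists 0; [split; [exact: hM.2.1|rewrite nrm0 ler01]|rewrite (lin0 hT.1) nrm0].
have ubV : ubound V c.
  by move=> _ [x [_ x1] <-]; rewrite (le_trans (hc _))// ler_piMr// ltW.
have hV : has_sup V by split; [exists 0|exists c].
pose l := sup V.
have l0 : 0 <= l by apply: ub_le_sup => //; exact: hV.2.
have lM x : M x -> nrm (T x) <= l * nrm x.
  move=> Mx; have [->|/eqP/nrm_gt0 x0] := eqVneq x 0; first by rewrite (lin0 hT.1) nrm0 mulr0.
  rewrite -ler_pdivrMr//; apply: ub_le_sup; first exact: hV.2.
  exists ((nrm x)^-1%:C *: x).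
    split; first exact: subspaceZ hM.2 Mx.
    by rewrite nrmZ cabs_pos ?invr_ge0 ?nrm_ge0// mulVf// gt_eqF.
  by rewrite (linZ hT.1) nrmZ cabs_pos ?invr_ge0 ?nrm_ge0// mulrC.
exists l; split=> // lp.
pose P := orthoproj M; have hP : bounded_op P := orthoproj_bounded hM.
(* Projecting first extends [1 - T / l] from [M] to [H] by the identity on the complement, so that
   [fredholm_invertible] applies. *)
pose C := (- l^-1)%:C \*: (T \o P).
have fC : fapprox C by apply: fapprox_scale; exact: fapprox_compr.
have CE x : x + C x = l^-1%:C *: (l%:C *: x - T (P x)).
  rewrite /C /= scalerBr scalerA -rmorphM mulVf ?gt_eqF// scale1r rmorphN.
  by rewrite scaleNr.
apply: contrapT => noev.
have inj x : x + C x = 0 -> x = 0.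
  rewrite CE => /eqP; rewrite scaler_eq0 (negbTE (realC_neq0 _)) ?invr_neq0 ?gt_eqF//=.
  rewrite subr_eq0 => /eqP lx; apply: contrapT => /nrm_gt0 x0; apply: noev.
  have Mx : M x.
    have -> : x = l^-1%:C *: (l%:C *: x) by rewrite scalerA -rmorphM mulVf ?gt_eqF// scale1r.
    by rewrite lx; apply: subspaceZ hM.2 _; apply: MT; exact: orthoproj_in.
  exists ((nrm x)^-1%:C *: x); split.
  - exact: subspaceZ hM.2 Mx.
  - by rewrite nrmZ cabs_pos ?invr_ge0 ?nrm_ge0// mulVf// gt_eqF.
  - have Tx : T x = l%:C *: x by rewrite lx /P orthoproj_id.
    by rewrite (linZ hT.1) Tx !scalerA mulrC.
have [b' b'0 hb'] := invertible_below (fredholm_invertible fC inj).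
(* The bound is reduced below 1 so that [r = sqrt (1 - b^2)] is a genuine root; the norm of [T] on
   [M] is then at most [l * r < l]. *)
have [b [b0 b_lt1 bb]] : exists b : R, [/\ 0 < b, b < 1 & b <= b'].
  have b1 : 0 < 1 + b' by rewrite addr_gt0.
  exists (b' / (1 + b')); split; first by rewrite divr_gt0.
    by rewrite ltr_pdivrMr// mul1r ltrDr.
  by rewrite ler_pdivrMr// ler_peMr ?ltW// ltrDl.
have b2 : 0 <= 1 - b ^+ 2 by rewrite subr_ge0 expr_le1// ltW.
pose r := Num.sqrt (1 - b ^+ 2); have r0 : 0 <= r by exact: sqrtr_ge0.
have r1 : r < 1.
  by rewrite -(@ltr_pXn2r _ 2)// ?nnegrE// sqr_sqrtr// expr1n gtrBl exprn_gt0.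
have h x : M x -> nrm (T x) <= l * r * nrm x.
  move=> Mx; apply: le_nrm_sqr; first by rewrite !mulr_ge0 ?nrm_ge0.
  have := le_trans (ler_wpM2r (nrm_ge0 x) bb) (hb' x I).
  rewrite /= CE [P x](orthoproj_id hM Mx) nrmZ cabs_pos ?invr_ge0// ler_pdivlMl// => h.
  have := shift_bound pT lp hM.2 MT lM Mx.
  have : (l * (b * nrm x)) ^+ 2 <= nrm (l%:C *: x - T x) ^+ 2.
    have p : 0 <= l * (b * nrm x) by exact: mulr_ge0 (ltW lp) (mulr_ge0 (ltW b0) (nrm_ge0 x)).
    by rewrite ler_pXn2r ?nnegrE ?nrm_ge0.
  have r2 : r ^+ 2 = 1 - b ^+ 2 by rewrite sqr_sqrtr.
  by rewrite !exprMn r2; lra.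
have : l <= l * r.
  apply: ge_sup => [|_ [x [Mx x1] <-]]; first by exists 0.
  by rewrite (le_trans (h _ Mx))// ler_piMr// mulr_ge0.
by rewrite ler_pMr// leNgt r1.
Qed.


(** Each step takes a top eigenvector on the complement of the earlier ones. Once the remaining norm
    is 0, zero vectors pad the sequence, whence the norm clause. *)
Lemma greedy_eigenvectors T : positive_op T -> fapprox T ->
  exists (s : nat -> R) (u : nat -> H), [/\ forall n, 0 <= s n,
    forall n, T (u n) = (s n)%:C *: u n,
    forall i j, i != j -> <|u i, u j|> = 0,
    forall n, nrm (u n) = (0 < s n)%R%:R &
    forall n x, (forall k, (k < n)%N -> <|x, u k|> = 0) -> nrm (T x) <= s n * nrm x].
Proof.
move=> pT fT; have hT := pT.1.
pose M (w : seq H) := orthogonal_to [set y | y \in w].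
pose eig (w : seq H) := forall y, y \in w -> exists l : R, T y = l%:C *: y.
have MT w : eig w -> forall x, M w x -> M w (T x).
  move=> ew x Mx y yw; have [l Ty] := ew _ yw.
  by rewrite (positive_sym _ _ pT) Ty ipZr (Mx _ yw) mulr0.
have /choice[F hF] : forall w : seq H, exists p : R * H, eig w -> [/\ 0 <= p.1,
    T p.2 = p.1%:C *: p.2, M w p.2, nrm p.2 = (0 < p.1)%R%:R &
    forall x, M w x -> nrm (T x) <= p.1 * nrm x].
  move=> w; have [ew|] := pselect (eig w); last by exists (0, 0).
  have [l [l0 lM hu]] := top_eigenvector pT fT (orthogonal_to_closed _) (MT w ew).
  have [lp|lp] := ltP 0 l.
    by have [u [Mu nu Tu]] := hu lp; exists (l, u); rewrite lp.
  exists (l, 0) => _; split=> //=.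
  - by rewrite (lin0 hT.1) scaler0.
  - by move=> y _; rewrite ip0l.
  - by rewrite nrm0 ltNge lp.
pose fix hist n : seq H := if n is m.+1 then (F (hist m)).2 :: hist m else [::].
have eh n : eig (hist n).
  elim: n => [|n ih] y /=; first by rewrite in_nil.
  rewrite inE => /orP[/eqP ->|]; last exact: ih.
  by have [_ Ty _ _ _] := hF _ ih; exists (F (hist n)).1.
pose u n := (F (hist n)).2.
have mem_hist k n : (k < n)%N -> u k \in hist n.
  elim: n => // n ih; rewrite ltnS leq_eqVlt /= inE => /orP[/eqP ->|/ih ->].
    by rewrite eqxx.
  by rewrite orbT.
have histE n y : y \in hist n -> exists2 k, (k < n)%N & y = u k.
  elim: n => // n ih /=; rewrite inE => /orP[/eqP ->|/ih[k kn ->]]; first by exists n.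
  by exists k => //; exact: ltnW.
exists (fun n => (F (hist n)).1), u; split=> [n|n|i j|n|n x hx].
- by have [] := hF _ (eh n).
- by have [] := hF _ (eh n).
- rewrite neq_ltn => /orP[ij|ij].
    apply: ip_eq0C; have [_ _ h _ _] := hF _ (eh j); apply: h; exact: mem_hist.
  by have [_ _ h _ _] := hF _ (eh i); apply: h; exact: mem_hist.
- by have [] := hF _ (eh n).
- have [_ _ _ _ h] := hF _ (eh n); apply: h => y /histE[k kn ->]; exact: hx.
Qed.

Lemma orthon_bessel n (e : 'I_n -> H) x : orthon e ->
  \sum_i cabs <|x, e i|> ^+ 2 <= nrm x ^+ 2.
Proof.
move=> he; have h : complex.Re <|x, rank_sum e e x|> = \sum_i cabs <|x, e i|> ^+ 2.
  by rewrite ip_sumr Re_sum; apply: eq_bigr => i _; rewrite ipZr mulconjC.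
have o : orthogonal_to (lspan e) (x - rank_sum e e x).
  by apply: orthogonal_to_lspan => i; exact: rank_sum_orth.
have h2 : nrm (rank_sum e e x) ^+ 2 = \sum_i cabs <|x, e i|> ^+ 2.
  have : <|x - rank_sum e e x, rank_sum e e x|> = 0 by apply: o; exact: rank_sum_in.
  by rewrite ipBl => /eqP; rewrite subr_eq0 -h => /eqP ->; rewrite Re_ip.
rewrite -h2 -[x in leRHS](subrK (rank_sum e e x)) [leRHS]pythagoras ?lerDr ?sqr_ge0//.
by apply: o; exact: rank_sum_in.
Qed.

(** A finite-rank approximant [F] is Hilbert-Schmidt: the squares of the [nrm (F (u n))] have
    partial sums bounded by [K], so they cannot all stay above a positive constant. *)
Lemma suborthonormal_small T (u : nat -> H) (l : R) : fapprox T -> suborthonormal u ->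
  0 < l -> exists n, nrm (T (u n)) < l.
Proof.
move=> [hT aT] hu l0; apply: contrapT => /forallNP h.
have l2 : 0 < l / 2 by rewrite divr_gt0.
have [F /[dup] [[hF _]] /finrankE[m [e [he FE]]] hTF] := aT _ l2.
have Fu n : (l / 2) ^+ 2 <= nrm (F (u n)) ^+ 2.
  rewrite ler_pXn2r ?nnegrE ?nrm_ge0 ?(ltW l2)//.
  have := h n => /negP; rewrite -leNgt => h1.
  have := hTF (u n); have := hu.2 n; have := nrm_triB (T (u n)) (F (u n)) 0.
  rewrite !subr0 /= => h2 h3 h4.
  have h5 : l / 2 * nrm (u n) <= l / 2 by rewrite ler_piMr// ltW.
  by move: h1 h2 h4 h5; lra.
pose K := \sum_i nrm (adjoint F (e i)) ^+ 2.
have hK N : \sum_(0 <= n < N) nrm (F (u n)) ^+ 2 <= K.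
  have E n : nrm (F (u n)) ^+ 2 = \sum_i cabs <|adjoint F (e i), u n|> ^+ 2.
    have -> : nrm (F (u n)) ^+ 2 = complex.Re <|F (u n), rank_sum e e (F (u n))|>.
      rewrite rank_sum_id// ?Re_ip// FE; exact: rank_sum_in.
    rewrite ip_sumr Re_sum; apply: eq_bigr => i _.
    by rewrite ipZr mulconjC /= adjP// ipC cabsJ.
  under eq_bigr do rewrite E.
  rewrite exchange_big; apply: ler_sum => i _; exact: bessel.
have [N hN] : exists N : nat, K / (l / 2) ^+ 2 < N%:R.
  by exists (Num.truncn (K / (l / 2) ^+ 2)).+1; exact: truncnS_gt.
have := hK N; apply/negP; rewrite -ltNge.
move: hN; rewrite ltr_pdivrMr ?exprn_gt0// => /lt_le_trans; apply.
rewrite mulr_natl -[N in leLHS]subn0 -sumr_const_nat; apply: ler_sum => n _; exact: Fu.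
Qed.

Lemma opabs_fapprox E : fapprox E -> fapprox (opabs E).
Proof.
move=> fE; have hE := fE.1; have hN := opabs_bounded hE.
have eq x : nrm (E x) = nrm (opabs E x) by rewrite opabs_nrm.
by have [W hW <-] := isometric_factor hE hN eq; exact: fapprox_compl.
Qed.

Lemma eigen_ortho T (l m : R) x y : positive_op T -> l != m ->
  T x = l%:C *: x -> T y = m%:C *: y -> <|x, y|> = 0.
Proof.
move=> pT lm Tx Ty; have := positive_sym x y pT.
rewrite Tx Ty ipZl ipZr conjR => /eqP; rewrite -subr_eq0 -mulrBl -rmorphB mulf_eq0.
by rewrite (negbTE (realC_neq0 _)) ?subr_eq0//= => /eqP.
Qed.

Lemma sing_val_exists E : fapprox E -> exists s, is_sing_val E s.
Proof.
move=> fE; have [pT _] := opabsP fE.1; have fT := opabs_fapprox fE.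
set T := opabs E in pT fT; have hT := pT.1.
have [s [u [s0 Tu ou nu bu]]] := greedy_eigenvectors pT fT.
have un n : nrm (u n) = 1 \/ u n = 0 /\ s n = 0.
  have := nu n; have [p|p] := ltP 0 (s n); first by left.
  by move=> /nrm_eq0 ->; right; split=> //; apply/eqP; rewrite eq_le p s0.
have uu : suborthonormal u.
  by split=> // i; case: (un i) => [->|[-> _]]; rewrite ?lexx// nrm0.
have nTu n : nrm (T (u n)) = s n.
  rewrite Tu nrmZ cabs_pos//; case: (un n) => [->|[-> ->]]; rewrite ?mulr1//.
  by rewrite mul0r.
have mono n : s n.+1 <= s n.
  rewrite -nTu (le_trans (bu n _ _))//; last by rewrite ler_piMr// uu.2.
  by move=> k kn; apply: ou; rewrite gtn_eqF// (ltn_trans kn).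
exists s; split=> //.
  move=> m n /subnKC <-; elim: (n - m)%N => [|k ih]; first by rewrite addn0.
  by rewrite addnS (le_trans (mono _)).
move=> l l0; have [N hN] := suborthonormal_small fT uu l0; rewrite nTu in hN.
have sN n : (N <= n)%N -> s n < l.
  move=> /subnKC <-; apply: le_lt_trans hN; elim: (n - N)%N => [|k ih]; first by rewrite addn0.
  by rewrite addnS (le_trans (mono _)).
have fin : finite_set [set n | s n = l].
  apply: (@sub_finite_set _ _ `I_N) (finite_II N) => n /= sl.
  by rewrite ltnNge; apply/negP => /sN; rewrite sl ltxx.
have [d hd] := fin; exists d => //.
have /card_set_bijP[g [g1 g2 g3]] := card_esym hd.
have sg (i : 'I_d) : s (g i) = l by apply: g1; exact: ltn_ord.
pose e (i : 'I_d) := u (g i).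
have he : orthon e.
  move=> i j; have [<-|ij] := eqVneq i j.
    rewrite ip_nrm; case: (un (g i)) => [->|[_]]; first by rewrite expr1n.
    by rewrite sg => h; move: l0; rewrite h ltxx.
  apply: ou; apply/eqP => gij; move/eqP: ij; apply; apply: val_inj => /=.
  by apply: g2 gij; rewrite inE /= ltn_ord.
apply/has_dim_orthon; exists e => //.
apply/seteqP; split=> x /= Tx; last first.
  move: Tx => [c _ <-]; rewrite -/T (lin_sum hT.1) scaler_sumr; apply: eq_bigr => i _.
  by rewrite (linZ hT.1) Tu sg !scalerA mulrC.
rewrite -/T in Tx; pose y := x - rank_sum e e x.
suff y0 : y = 0.
  by move/eqP: y0; rewrite subr_eq0 => /eqP ->; exact: rank_sum_in.
have Ty : T y = l%:C *: y.
  rewrite (linB hT.1) Tx scalerBr; congr (_ - _); rewrite (lin_sum hT.1) scaler_sumr.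
  by apply: eq_bigr => i _; rewrite (linZ hT.1) Tu sg !scalerA mulrC.
apply: contrapT => /nrm_gt0 yp.
(* A residual orthogonal to the first [N] eigenvectors satisfies [nrm (T y) <= s N * nrm y], which
   contradicts [T y = l y] because [s N < l]. *)
have o k : (k < N)%N -> <|y, u k|> = 0.
  move=> _; have [kl|kl] := eqVneq (s k) l; last first.
    by apply: (eigen_ortho pT _ Ty (Tu k)); rewrite eq_sym.
  have [i id gi] := g3 k kl; rewrite -gi.
  exact: (rank_sum_orth x (Ordinal id) he).
have := bu N y o; rewrite Ty nrmZ cabs_pos ?(ltW l0)//.
by rewrite ler_pM2r// leNgt hN.
Qed.

End Spectral.

(** * Ky Fan norms, majorization and differences of positive square roots *)

Section KyFan.
Context {R : realType} {H : hilbertType R}.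
Implicit Types (x y z : H) (A B D E T X : H -> H) (s : nat -> R).

Definition singular_vectors E s (u : nat -> H) :=
  [/\ forall n, opabs E (u n) = (s n)%:C *: u n,
    forall i j, i != j -> <|u i, u j|> = 0,
    forall n, nrm (u n) = (0 < s n)%R%:R &
    forall n x, (forall k, (k < n)%N -> <|x, u k|> = 0) -> nrm (E x) <= s n * nrm x].

(** [sing_val] is chosen by [get] and known only through [is_sing_val], so the eigenvectors are
    rebuilt from the eigenspaces: the indices [n] with [s n = l] are matched with an orthonormal
    basis for [l]. *)
Lemma singular_vectors_exist E s : fapprox E -> is_sing_val E s ->
  exists u, singular_vectors E s u.
Proof.
move=> fE [s0 smono sdim]; have [pT _] := opabsP fE.1; have fT := opabs_fapprox fE.
have hT := pT.1; have nT x := opabs_nrm x fE.1.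
set T := opabs E in pT fT hT nT *.
have /choice[G hG] : forall l : R, exists g : nat -> H, 0 < l ->
    [/\ forall n, s n = l -> T (g n) = l%:C *: g n /\ nrm (g n) = 1,
      forall i j, i != j -> s i = l -> s j = l -> <|g i, g j|> = 0 &
      forall x, T x = l%:C *: x -> (forall n, s n = l -> <|x, g n|> = 0) -> x = 0].
  move=> l; have [l0|] := pselect (0 < l); last by exists (fun=> 0).
  have [d /has_dim_orthon[e he eE] /card_set_bijP[f [f1 f2 f3]]] := sdim l l0.
  exists (fun n => if insub (f n) is Some i then e i else 0) => _.
  have fE' n : s n = l -> exists2 i : 'I_d, insub (f n) = Some i & f n = i.
    move=> sn; have fn : (f n < d)%N by exact: f1.
    by exists (Ordinal fn); rewrite // insubT.
  split=> [n sn|i j ij si sj|x Tx hx].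
  - have [i -> _] := fE' _ sn; split; last exact: orthon_nrm.
    have : lspan e (e i) by exact: lspan_mem.
    by rewrite -eE.
  - have [i' -> fi] := fE' _ si; have [j' -> fj] := fE' _ sj.
    rewrite he (_ : i' == j' = false)//; apply/eqP => ij'; move/eqP: ij; apply.
    by apply: f2; rewrite ?inE// fi fj ij'.
  - apply: (lspan_coef0 he) => [|i]; first by rewrite -eE.
    have [n sn fn] := f3 i (ltn_ord i); rewrite -(hx n sn).
    by rewrite fn valK.
pose u n := if 0 < s n then G (s n) n else 0.
have Tu n : T (u n) = (s n)%:C *: u n.
  rewrite /u; case: ifPn => [p|_]; last by rewrite (lin0 hT.1) scaler0.
  by have [h _ _] := hG _ p; have [] := h n erefl.
have nu n : nrm (u n) = (0 < s n)%R%:R.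
  rewrite /u; case: ifPn => [p|_]; last by rewrite nrm0.
  by have [h _ _] := hG _ p; have [] := h n erefl.
have ou i j : i != j -> <|u i, u j|> = 0.
  move=> ij; have [sij|sij] := eqVneq (s i) (s j); last exact: (eigen_ortho pT sij).
  rewrite /u sij; case: ifPn => [p|_]; last by rewrite ip0l.
  by have [_ h _] := hG _ p; apply: h.
exists u; split=> // n x hx; rewrite -nT.
pose M := orthogonal_to [set y | exists2 k, (k < n)%N & y = u k].
have hM : closed_subspace M by exact: orthogonal_to_closed.
have MT y : M y -> M (T y).
  move=> My _ [k kn ->]; rewrite (positive_sym _ _ pT) Tu ipZr My ?mulr0//.
  by exists k.
have [l [l0 lM hv]] := top_eigenvector pT fT hM MT.
have Mx : M x by move=> _ [k kn ->]; exact: hx.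
rewrite (le_trans (lM _ Mx))// ler_wpM2r ?nrm_ge0//.
have [lp|lp] := ltP 0 l; last by rewrite (le_trans lp).
(* If the norm [l] on [M] exceeded [s n], every index of value [l] would lie below [n]; a top
   eigenvector in [M] would be orthogonal to its whole eigenspace. *)
rewrite leNgt; apply/negP => sl.
have [v [Mv nv Tv]] := hv lp; have [_ _ h] := hG _ lp.
have v0 : v = 0.
  apply: h => // k sk; have := Mv (u k); rewrite /u sk lp; apply.
  exists k; last by rewrite /u sk lp.
  by rewrite ltnNge; apply/negP => /smono; rewrite sk leNgt sl.
by move: nv; rewrite v0 nrm0 => /esym/eqP; rewrite oner_eq0.
Qed.

(* The [n]-th Ky Fan norm of [D] is at most [c]. *)
Definition kf_bound n D (c : R) := forall e f : 'I_n -> H, orthon e -> orthon f ->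
  \sum_i complex.Re <|D (e i), f i|> <= c.

(** The left singular vector; the convention [0^-1 = 0] makes it 0 where [s n = 0]. *)
Definition left_vector E s (u : nat -> H) n := (s n)^-1%:C *: E (u n).

Lemma singular_vectors_sq E s u n x : bounded_op E -> singular_vectors E s u ->
  <|E (u n), E x|> = (s n ^+ 2)%:C * <|u n, x|>.
Proof.
move=> hE [Tu _ _ _]; rewrite adjPr// -opabs_sq// Tu (linZ (opabs_bounded hE).1) Tu.
by rewrite scalerA ipZl -rmorphM -expr2.
Qed.

Lemma left_vector_eq E s u n : bounded_op E -> (forall n, 0 <= s n) ->
  singular_vectors E s u -> E (u n) = (s n)%:C *: left_vector E s u n.
Proof.
move=> hE s0 [_ _ nu _]; rewrite /left_vector scalerA -rmorphM /=.
have [sn|sn] := eqVneq (s n) 0; last by rewrite mulfV// scale1r.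
by rewrite sn mul0r scale0r (nrm_eq0 (_ : nrm (u n) = 0)) ?(lin0 hE.1)// nu sn ltxx.
Qed.

Lemma left_vector_nrm E s u n : bounded_op E -> singular_vectors E s u ->
  nrm (left_vector E s u n) = (0 < s n)%R%:R.
Proof.
move=> hE hu; apply/eqP; rewrite -(@eqrXn2 _ 2)// ?nrm_ge0// -Re_ip; apply/eqP.
rewrite /left_vector ipZl ipZr conjR (singular_vectors_sq _ _ hE hu) ip_nrm.
have [_ _ -> _] := hu; rewrite -!rmorphM /=.
case: ltP => [p|_]; last by rewrite expr0n !mulr0.
rewrite expr1n mulr1; field; exact: lt0r_neq0.
Qed.

Lemma left_vector_orth E s u i j : bounded_op E -> singular_vectors E s u -> i != j ->
  <|left_vector E s u i, left_vector E s u j|> = 0.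
Proof.
move=> hE hu ij; rewrite /left_vector ipZl ipZr (singular_vectors_sq _ _ hE hu).
by have [_ -> //] := hu; rewrite !mulr0.
Qed.

Lemma left_vector_suborthonormal E s u : bounded_op E -> singular_vectors E s u ->
  suborthonormal (left_vector E s u).
Proof.
move=> hE hu; split=> [i j ij|i]; first exact: left_vector_orth.
by rewrite left_vector_nrm//; case: ltP => _; rewrite ?lexx ?ler01.
Qed.

Lemma singular_suborthonormal E s u : singular_vectors E s u -> suborthonormal u.
Proof.
by move=> [_ ou nu _]; split=> // i; rewrite nu; case: ltP => _; rewrite ?lexx ?ler01.
Qed.

(* Ky Fan's maximum principle: [E - E_n], where
   [E_n = sum_(k < n) (s k - s n) <., u k> v k], has norm at most [s n]. *)
Lemma ky_fan_upper E s u n : bounded_op E -> (forall n, 0 <= s n) ->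
  (forall m n, (m <= n)%N -> s n <= s m) -> singular_vectors E s u ->
  kf_bound n E (\sum_(i < n) s i).
Proof.
move=> hE s0 smono hu e f he hf.
have [Tu ou nu bu] := hu; pose v := left_vector E s u.
have vv : suborthonormal v := left_vector_suborthonormal hE hu.
have uu : suborthonormal u := singular_suborthonormal hu.
pose En x := \sum_(k < n) ((s k - s n)%:C * <|x, u k|>) *: v k.
have Ebound x : nrm (E x - En x) <= s n * nrm x.
  apply: le_nrm_sqr; first by rewrite mulr_ge0 ?nrm_ge0.
  pose p := psum u u x n; pose q := psum u v x n; pose x' := x - p.
  have ox' k : (k < n)%N -> <|x', u k|> = 0.
    move=> kn; have puk : <|p, u k|> = <|x, u k|>.
      rewrite /p /psum big_mkord ip_suml (bigD1 (Ordinal kn))//= big1 ?addr0.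
        rewrite ipZl ip_nrm nu; case: ltP => [_|sk]; first by rewrite expr1n mulr1.
        have -> : u k = 0 by apply: nrm_eq0; rewrite nu ltNge sk.
        by rewrite ip0r mul0r.
      by move=> i ik; rewrite ipZl ou ?mulr0.
    by rewrite ipBl puk subrr.
  have Ep : E p = En x + (s n)%:C *: q.
    rewrite /p /q /psum !big_mkord (lin_sum hE.1) scaler_sumr -big_split /=.
    apply: eq_bigr => k _; rewrite (linZ hE.1) (left_vector_eq k hE s0 hu) -/v.
    by rewrite !scalerA -scalerDl rmorphB; congr (_ *: _); ring.
  (* The truncation caps the first [n] singular values at [s n]; the two summands are orthogonal,
     and Bessel's inequality bounds them together. *)
  have -> : E x - En x = (s n)%:C *: q + E x' by rewrite (linB hE.1) Ep; vector_ring.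
  have oq : <|(s n)%:C *: q, E x'|> = 0.
    rewrite ipZl psum_orth ?mulr0// => k kn.
    by rewrite ipZl (singular_vectors_sq _ _ hE hu) (ip_eq0C (ox' k kn)) !mulr0.
  rewrite (pythagoras oq) nrmZ cabs_pos// !exprMn.
  have q1 : nrm q ^+ 2 <= bessel_sum u x n.
    by have := psum_nrm u x n ler01 vv.1 vv.2; rewrite expr1n mul1r.
  have q2 : nrm (E x') ^+ 2 <= s n ^+ 2 * nrm x' ^+ 2.
    by rewrite -exprMn ler_pXn2r ?nnegrE ?nrm_ge0 ?mulr_ge0 ?nrm_ge0//; exact: bu.
  have q3 := psum_residual x n uu.
  have q4 : s n ^+ 2 * nrm x' ^+ 2 <= s n ^+ 2 * (nrm x ^+ 2 - bessel_sum u x n).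
    by rewrite ler_wpM2l ?sqr_ge0.
  have q5 : s n ^+ 2 * nrm q ^+ 2 <= s n ^+ 2 * bessel_sum u x n.
    by rewrite ler_wpM2l ?sqr_ge0.
  by move: q2 q4 q5; lra.
(* The product of the two coefficients is bounded by the mean of their squares, so that summing over
   [i] leaves two Bessel sums, each at most 1. *)
have step i : complex.Re <|E (e i), f i|> <=
    \sum_(k < n) (s k - s n) * ((cabs <|u k, e i|> ^+ 2 + cabs <|v k, f i|> ^+ 2) / 2) + s n.
  have -> : <|E (e i), f i|> = <|En (e i), f i|> + <|E (e i) - En (e i), f i|>.
    by rewrite ipBl addrC subrK.
  rewrite ReD lerD//; last first.
    rewrite (le_trans (Re_le_cabs _))// (le_trans (cauchy_schwarz _ _))//.
    by rewrite (orthon_nrm _ hf) mulr1 (le_trans (Ebound _))// (orthon_nrm _ he) mulr1.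
  rewrite ip_suml Re_sum; apply: ler_sum => k _.
  rewrite ipZl -mulrA ReM_real ler_wpM2l ?subr_ge0 ?smono//; first exact: ltnW.
  rewrite (le_trans (Re_le_cabs _))// cabsM ipC cabsJ.
  by have := sqr_ge0 (cabs <|u k, e i|> - cabs <|v k, f i|>); rewrite sqrrB; lra.
apply: (le_trans (ler_sum _ (fun i _ => step i))); rewrite big_split /= exchange_big /=.
rewrite [X in _ + X]sumr_const card_ord.
have -> : \sum_(i < n) s i = \sum_(i < n) (s i - s n) + s n *+ n.
  by rewrite sumrB sumr_const card_ord subrK.
rewrite lerD2r; apply: ler_sum => k _; rewrite -mulr_sumr.
rewrite ler_piMr ?subr_ge0 ?smono//; first exact: ltnW.
rewrite -mulr_suml big_split /= ler_pdivrMr// mul1r.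
have h1 := orthon_bessel (u k) he; have h2 := orthon_bessel (v k) hf.
have h3 : nrm (u k) ^+ 2 <= 1 by rewrite expr_le1// ?nrm_ge0// uu.2.
have h4 : nrm (v k) ^+ 2 <= 1 by rewrite expr_le1// ?nrm_ge0// vv.2.
by move: h1 h2 h3 h4; lra.
Qed.

(** The sum is attained at the right and left singular vectors when all the values are positive.
    Vanishing values have zero vectors and are dropped, which is why bounds at all smaller orders
    are assumed. *)
Lemma ky_fan_lower D s u n (c : R) : bounded_op D -> (forall n, 0 <= s n) ->
  (forall m n, (m <= n)%N -> s n <= s m) -> singular_vectors D s u ->
  (forall m, (m <= n)%N -> exists2 b, b <= c & kf_bound m D b) ->
  \sum_(i < n) s i <= c.
Proof.
move=> hD s0 smono hu; elim: n => [|n ih] hb.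
  have [b bc /(_ (fun=> 0) (fun=> 0))] := hb 0%N (leqnn _).
  by rewrite !big_ord0 => h; apply: le_trans bc; apply: h; case.
have [sn|sn] := ltP 0 (s n); last first.
  rewrite big_ord_recr /= (_ : s n = 0) ?addr0; last by apply/eqP; rewrite eq_le sn s0.
  by apply: ih => m mn; apply: hb; exact: leqW.
have [b bc hbn] := hb n.+1 (leqnn _); apply: le_trans bc.
have sp (i : 'I_n.+1) : 0 < s i.
  by apply: (lt_le_trans sn); apply: smono; rewrite -ltnS.
have [Tu ou nu _] := hu; pose v := left_vector D s u.
have orth (w : nat -> H) : (forall i j, i != j -> <|w i, w j|> = 0) ->
    (forall k, nrm (w k) = (0 < s k)%R%:R) -> orthon (fun i : 'I_n.+1 => w i).
  move=> ow nw i j; have [<-|ij] := eqVneq i j; last exact: ow.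
  by rewrite ip_nrm nw sp expr1n.
have := hbn _ _ (orth u ou nu) (orth v (fun i j => left_vector_orth hD hu) (fun k => left_vector_nrm k hD hu)).
apply: le_trans; apply: ler_sum => i _.
rewrite (left_vector_eq i hD s0 hu) -/v ipZl ip_nrm left_vector_nrm// sp expr1n mulr1.
by [].
Qed.

Lemma majorized_of_kf D E : fapprox D -> fapprox E ->
  (forall n c, kf_bound n E c -> kf_bound n D c) ->
  weakly_majorized (sing_val D) (sing_val E).
Proof.
move=> fD fE h n.
have sD : is_sing_val D (sing_val D) := getPex (sing_val_exists fD).
have sE : is_sing_val E (sing_val E) := getPex (sing_val_exists fE).
have [u hu] := singular_vectors_exist fD sD; have [w hw] := singular_vectors_exist fE sE.
have [sD0 sDm _] := sD; have [sE0 sEm _] := sE.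
apply: (ky_fan_lower fD.1 sD0 sDm hu) => m mn.
exists (\sum_(i < m) sing_val E i); last by apply: h; exact: ky_fan_upper fE.1 sE0 sEm hw.
rewrite -(subnKC mn) big_split_ord /= lerDl sumr_ge0// => i _.
Qed.

Lemma kf_bound_add n A B (a b : R) : kf_bound n A a -> kf_bound n B b ->
  kf_bound n (A \+ B) (a + b).
Proof.
move=> hA hB e f he hf; under eq_bigr do rewrite /= ipDl ReD.
by rewrite big_split lerD ?hA ?hB.
Qed.

Lemma kf_bound_scale n A (a r : R) : 0 <= r -> kf_bound n A a ->
  kf_bound n (r%:C \*: A) (r * a).
Proof.
move=> r0 hA e f he hf; under eq_bigr do rewrite /= ipZl ReM_real.
by rewrite -mulr_sumr ler_wpM2l ?hA.
Qed.

Lemma orthon_isometry n U (e : 'I_n -> H) : bounded_op U -> adjoint U \o U = id ->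
  orthon e -> orthon (U \o e).
Proof.
move=> hU UU he i j /=; rewrite adjP//.
by have /= -> := congr_op (e j) UU; exact: he.
Qed.

Lemma kf_bound_comp n D X (c : R) : linear D -> bounded_op X -> adjoint X = X -> bound_by X 1 ->
  kf_bound n D c -> kf_bound n (X \o D) c /\ kf_bound n (D \o X) c.
Proof.
move=> lD hX sX X1 hD; have [U [hU UU UU' XE]] := contraction_unitary hX sX X1.
have hV := adjoint_bounded hU.
have VV : adjoint (adjoint U) \o adjoint U = id by rewrite adjointK.
have half (p q : R) : p <= c -> q <= c -> 2^-1 * (p + q) <= c by lra.
split=> e f he hf.
  have -> : \sum_i complex.Re <|(X \o D) (e i), f i|> = 2^-1 *
     (\sum_i complex.Re <|D (e i), (adjoint U \o f) i|> + \sum_i complex.Re <|D (e i), (U \o f) i|>).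
    rewrite -big_split mulr_sumr; apply: eq_bigr => i _ /=.
    by rewrite XE ipZl ReM_real ipDl ReD (adjP _ _ hU) (adjP _ _ hV) adjointK.
  by apply: half; apply: hD => //; exact: orthon_isometry.
have -> : \sum_i complex.Re <|(D \o X) (e i), f i|> = 2^-1 *
   (\sum_i complex.Re <|D ((U \o e) i), f i|> + \sum_i complex.Re <|D ((adjoint U \o e) i), f i|>).
  rewrite -big_split mulr_sumr; apply: eq_bigr => i _ /=.
  by rewrite XE (linZ lD) (linD lD) ipZl ReM_real ipDl ReD.
by apply: half; apply: hD => //; exact: orthon_isometry.
Qed.

(** For the least bound [c] the hypothesis reads [c <= a + q * c]. *)
Lemma kf_bound_contract n D (a q : R) : 0 <= q -> q < 1 -> (exists c, kf_bound n D c) ->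
  (forall c, kf_bound n D c -> kf_bound n D (a + q * c)) -> kf_bound n D (a / (1 - q)).
Proof.
move=> q0 q1 [c0 hc0] h e f he hf.
pose V := [set x | exists e f : 'I_n -> H, [/\ orthon e, orthon f &
  x = \sum_i complex.Re <|D (e i), f i|>]].
have Vef : V (\sum_i complex.Re <|D (e i), f i|>) by exists e, f.
have hV : has_sup V.
  split; first by eexists; exact: Vef.
  by exists c0 => _ [e' [f' [he' hf' ->]]]; exact: hc0.
have bV : kf_bound n D (sup V).
  by move=> e' f' he' hf'; apply: ub_le_sup; [exact: hV.2|exists e', f'].
have : sup V <= a + q * sup V.
  apply: ge_sup; first by eexists; exact: Vef.
  by move=> _ [e' [f' [he' hf' ->]]]; exact: h.
rewrite ler_pdivlMr ?subr_gt0// => hs.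
have : (\sum_i complex.Re <|D (e i), f i|>) * (1 - q) <= sup V * (1 - q).
  by rewrite ler_wpM2r ?bV// subr_ge0 ltW.
by move: hs; lra.
Qed.

Lemma kf_bound_exists n D : bounded_op D -> exists c, kf_bound n D c.
Proof.
move=> hD; have [c c0 hc] := bounded_bound hD; exists (\sum_(i < n) c) => e f he hf.
apply: ler_sum => i _; rewrite (le_trans (Re_le_cabs _))// (le_trans (cauchy_schwarz _ _))//.
by rewrite (orthon_nrm _ hf) mulr1 (le_trans (hc _))// (orthon_nrm _ he) mulr1.
Qed.

(** [D] is the fixed point of [C |-> E + X C + C Y], which contracts by [r] and preserves [fapprox];
    the iterates from 0 approximate [D]. *)
Lemma fapprox_contract D E X Y (r : R) : bounded_op D -> fapprox E -> bounded_op X ->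
  bounded_op Y -> 0 <= r -> r < 1 -> bound_by X (r / 2) -> bound_by Y (r / 2) ->
  (forall x, D x = E x + (X (D x) + D (Y x))) -> fapprox D.
Proof.
move=> hD fE hX hY r0 r1 Xr Yr DE; have [c c0 hc] := bounded_bound hD.
have approx k : exists2 C, fapprox C & bound_by (D \- C) (r ^+ k * c).
  elim: k => [|k [C fC hC]].
    exists (fun=> 0) => [|x]; last by rewrite /= subr0 expr0 mul1r.
    apply: finrank_fapprox; split; first exact: bounded_cst0.
    by exists 0%N, (fun=> 0) => x; exact: (lspan_sub _).1.
  exists (E \+ ((X \o C) \+ (C \o Y))).
    by do 2!apply: fapprox_add => //; [exact: fapprox_compl|exact: fapprox_compr].
  move=> x; have -> : (D \- (E \+ ((X \o C) \+ (C \o Y)))) x = X (D x - C x) + (D (Y x) - C (Y x)).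
    rewrite /= {1}DE (linB hX.1); vector_ring.
  have p : 0 <= r ^+ k * c by rewrite mulr_ge0 ?exprn_ge0// ltW.
  have r2 : 0 <= r / 2 by rewrite divr_ge0.
  have h1 := le_trans (Xr (D x - C x)) (ler_wpM2l r2 (hC x)).
  have h2 := le_trans (hC (Y x)) (ler_wpM2l p (Yr x)).
  by rewrite (le_trans (nrmD _ _))// (le_trans (lerD h1 h2))// exprS; lra.
apply: fapprox_limit => // e e0.
have ec : 0 < e / c by rewrite divr_gt0.
have r1' : `|r| < 1 by rewrite ger0_norm.
have /cvgrPdist_le /(_ _ ec) [N _ hN] := cvg_expr r1'.
have := hN N (leqnn _); rewrite sub0r normrN ger0_norm ?exprn_ge0// ler_pdivlMr// => hr.
have [C fC hC] := approx N; exists C => // x.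
by rewrite (le_trans (hC x))// ler_wpM2r ?nrm_ge0.
Qed.

(* With [D = a - b] and [E = a^2 - b^2 = a D + D b], the identity
   [2 mu D = E + (mu - a) D + D (mu - b)] and the bounds [|mu - a|, |mu - b| < mu]
   compare the Ky Fan norms of [D] with those of [E]. *)
Lemma ideal_square_root_diff J A B (d : R) : op_ideal J -> J `<=` fapprox -> am_closed J ->
  positive_op A -> positive_op B -> 0 < d -> bounded_below A setT d -> bounded_below B setT d ->
  J ((A \o A) \- (B \o B)) -> J (A \- B).
Proof.
move=> hJ Jc amJ pA pB d0 Ad Bd JE.
have hA := pA.1; have hB := pB.1; have sA := positive_adjoint pA; have sB := positive_adjoint pB.
have [ca ca0 hca] := bounded_bound hA; have [cb cb0 hcb] := bounded_bound hB.
(* [mu] dominates the norms of [A] and [B] and exceeds [d]; by [shift_bound], [mu - A] and [mu - B]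
   then have norm at most [r = sqrt (mu^2 - d^2) < mu]. *)
pose mu := ca + cb + d; have mu0 : 0 < mu by rewrite !addr_gt0.
have dmu : d < mu by rewrite ltrDr addr_gt0.
pose r := Num.sqrt (mu ^+ 2 - d ^+ 2).
have r2 : r ^+ 2 = mu ^+ 2 - d ^+ 2.
  by rewrite sqr_sqrtr// subr_ge0 ler_pXn2r ?nnegrE ?(ltW d0) ?(ltW mu0) ?(ltW dmu).
have r0 : 0 < r by rewrite sqrtr_gt0 subr_gt0 ltr_pXn2r ?nnegrE ?(ltW d0) ?(ltW mu0).
have rmu : r < mu.
  by rewrite -(@ltr_pXn2r _ 2)// ?nnegrE ?(ltW r0) ?(ltW mu0)// r2 gtrBl exprn_gt0.
pose S T := mu%:C \*: id \- T.
have hS T : bounded_op T -> bounded_op (S T).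
  by move=> hT; apply: bounded_sub => //; exact: bounded_scale bounded_id.
have sS T : bounded_op T -> adjoint T = T -> adjoint (S T) = S T.
  move=> hT sT; apply: adjoint_uniq => [|x y]; first exact: hS.
  by rewrite /S /= ipBl ipBr ipZl ipZr conjR adjP// sT.
have bS T (c : R) : positive_op T -> bound_by T c -> c <= mu -> bounded_below T setT d -> bound_by (S T) r.
  move=> pT Tc cmu Td x; apply: le_nrm_sqr; first by rewrite mulr_ge0 ?nrm_ge0 ?ltW.
  have bT y : setT y -> nrm (T y) <= mu * nrm y.
    by move=> _; rewrite (le_trans (Tc y))// ler_wpM2r ?nrm_ge0.
  have sT : is_subspace [set: H] by [].
  have := @shift_bound _ _ T setT mu x pT mu0 sT (fun _ _ => I) bT I.
  have : (d * nrm x) ^+ 2 <= nrm (T x) ^+ 2.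
    by rewrite ler_pXn2r ?nnegrE ?nrm_ge0 ?mulr_ge0 ?nrm_ge0 ?(ltW d0)//; exact: Td.
  by rewrite !exprMn r2 /S /=; lra.
have bA : bound_by (S A) r.
  by apply: (bS A ca pA hca _ Ad); rewrite /mu -addrA lerDl addr_ge0 ?ltW.
have bB : bound_by (S B) r.
  by apply: (bS B cb pB hcb _ Bd); rewrite /mu addrAC lerDr addr_ge0 ?ltW.
set E := (A \o A) \- (B \o B) in JE; pose D := A \- B.
have hD : bounded_op D by exact: bounded_sub.
have DE x : D x = (2 * mu)^-1%:C *: E x +
    ((2 * mu)^-1%:C *: S A (D x) + D ((2 * mu)^-1%:C *: S B x)).
  rewrite (linZ hD.1) -!scalerDr /E /S /D /= (linB hA.1 (A x)) (linB hA.1 (mu%:C *: x)).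
  rewrite (linB hB.1 (mu%:C *: x)) (linZ hA.1) (linZ hB.1).
  rewrite [X in _ = _ *: X](_ : _ = (2 * mu)%:C *: (A x - B x)); last first.
    by rewrite rmorphM rmorph_nat; vector_ring.
  by rewrite scalerA -rmorphM mulVf ?scale1r// gt_eqF// mulr_gt0.
have m20 : 0 < (2 * mu)^-1 by rewrite invr_gt0 mulr_gt0.
have q0 : 0 <= r / mu by rewrite divr_ge0 ?ltW.
have q1 : r / mu < 1 by rewrite ltr_pdivrMr// mul1r.
have bq T : bound_by T r -> bound_by ((2 * mu)^-1%:C \*: T) (r / mu / 2).
  move=> hT x; rewrite /= nrmZ cabs_pos ?(ltW m20)//.
  rewrite (le_trans (ler_wpM2l (ltW m20) (hT x)))// mulrA.
  by rewrite (_ : (2 * mu)^-1 * r = r / mu / 2)//; field; exact: lt0r_neq0.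
have fE := Jc _ JE.
(* Arithmetic mean closedness compares compact operators only, so compactness of [D] must come
   before majorization. *)
have fD : fapprox D.
  apply: (@fapprox_contract D ((2 * mu)^-1%:C \*: E) ((2 * mu)^-1%:C \*: S A)
    ((2 * mu)^-1%:C \*: S B) (r / mu)) => //; try exact: bq.
  - exact: fapprox_scale.
  - by apply: bounded_scale; exact: hS.
  - by apply: bounded_scale; exact: hS.
(* Solving [c = (2 mu)^-1 c_E + (r / mu) c] gives the factor [k] between the Ky Fan norms of [E] and
   of [D]. *)
pose k : R := (2 * mu)^-1 / (1 - r / mu); have k0 : 0 < k by rewrite divr_gt0 ?subr_gt0.
have kf n c : kf_bound n (k%:C \*: E) c -> kf_bound n D c.
  move=> hc.
  have hE : kf_bound n E (k^-1 * c).
    move=> e f he hf; rewrite ler_pdivlMl// mulr_sumr.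
    have := hc e f he hf; rewrite (eq_bigr (fun i => k * complex.Re <|E (e i), f i|>))// => i _.
    by rewrite /= ipZl ReM_real.
  have -> : c = (2 * mu)^-1 * (k^-1 * c) / (1 - r / mu).
    by rewrite /k; field; rewrite !gt_eqF// subr_gt0.
  apply: kf_bound_contract => //; first exact: kf_bound_exists.
  move=> c' hc'.
  have unitb T : bounded_op T -> bound_by T r -> bound_by (r^-1%:C \*: T) 1.
    move=> hT bT x; rewrite mul1r /= nrmZ cabs_pos ?invr_ge0 ?(ltW r0)//.
    by rewrite ler_pdivrMl//; exact: bT.
  have sc T : bounded_op T -> adjoint T = T -> adjoint (r^-1%:C \*: T) = r^-1%:C \*: T.
    move=> hT sT; apply: adjoint_uniq => [|x y]; first exact: bounded_scale.
    by rewrite /= ipZl ipZr conjR adjP// sT.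
  have [kA _] := kf_bound_comp hD.1 (bounded_scale _ (hS A hA)) (sc _ (hS A hA) (sS A hA sA))
    (unitb _ (hS A hA) bA) hc'.
  have [_ kB] := kf_bound_comp hD.1 (bounded_scale _ (hS B hB)) (sc _ (hS B hB) (sS B hB sB))
    (unitb _ (hS B hB) bB) hc'.
  have h1 := kf_bound_scale (ltW m20) hE.
  have rm : 0 <= (2 * mu)^-1 * r by rewrite mulr_ge0 ?ltW.
  have h2 := kf_bound_scale rm kA; have h3 := kf_bound_scale rm kB.
  have := kf_bound_add h1 (kf_bound_add h2 h3).
  have -> : (2 * mu)^-1 * r * c' + (2 * mu)^-1 * r * c' = r / mu * c'.
    by field; rewrite gt_eqF.
  congr (kf_bound n _ _); apply/funext => x; rewrite [RHS]DE /=.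
  rewrite !(linZ hD.1) !scalerA -!rmorphM; congr (_ + (_%:C *: _ + _%:C *: _)).
    by rewrite -mulrA mulfV ?mulr1// gt_eqF.
  by rewrite -mulrA mulfV ?mulr1// gt_eqF.
have JkE : J (k%:C \*: E) by exact: ideal_scale.
apply: (amJ (k%:C \*: E) D) => //; [exact/fapprox_compact/Jc|exact: fapprox_compact|].
by apply: majorized_of_kf => //; exact: Jc.
Qed.

End KyFan.

(** * Polar decompositions and condition (iv) *)

Section Polar.
Context {R : realType} {H : hilbertType R}.
Implicit Types (x y z : H) (A B T U V P Q : H -> H) (J : set (H -> H)).

(* Adding the projection onto the nullspace makes [|A|] invertible; then
   [V_A = A (|A| + P)^-1]. *)
Definition filled_abs A := opabs A \+ orthoproj (nullspace A).

Section ClosedRangeOperator.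
Variable A : H -> H.
Hypothesis hA : closed_range_op A.
Let P := orthoproj (nullspace A).
Let a := filled_abs A.

Let bA : bounded_op A. Proof. by case: hA. Qed.
Let cN : closed_subspace (nullspace A). Proof. exact: nullspace_closed. Qed.
Let hP : bounded_op P. Proof. exact: orthoproj_bounded. Qed.
Let hN : bounded_op (opabs A). Proof. exact: opabs_bounded. Qed.
Let pN : positive_op (opabs A). Proof. by have [] := opabsP bA. Qed.

Let AP x : A (P x) = 0. Proof. exact: (orthoproj_in x cN). Qed.
Let NP x : opabs A (P x) = 0. Proof. by apply/opabs_null. Qed.
Let Psym x y : <|P x, y|> = <|x, P y|>. Proof. exact: orthoproj_sym. Qed.
Let PP x : P (P x) = P x. Proof. exact: congr_op (orthoproj_idem cN). Qed.
Let PN x : P (opabs A x) = 0.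
Proof. by apply: ip_ext => y; rewrite ip0l Psym (positive_sym _ _ pN) NP ip0r. Qed.

(** The cross terms vanish, so the square contains no absolute value and its variation with [A] is
    controlled algebraically. *)
Lemma filled_abs_sq : filled_abs A \o filled_abs A = (adjoint A \o A) \+ P.
Proof.
apply/funext => x; rewrite /filled_abs /= -/P (linD hN.1) (linD hP.1).
by rewrite NP PN PP addr0 add0r opabs_sq.
Qed.

Lemma filled_abs_positive : positive_op (filled_abs A).
Proof.
split; first exact: bounded_add.
by move=> x; rewrite /filled_abs /= ipDl addr_ge0 ?pN.2// -/P -PP Psym ip_nrm ler0c sqr_ge0.
Qed.

Lemma filled_abs_below : exists2 d : R, 0 < d & bounded_below (filled_abs A) setT d.
Proof.
have [c c0 hc] := closed_range_below bA hA.2.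
(* [|A|] is bounded below by [c] off the nullspace and [P] is the identity on it; [c / (1 + c)] lies
   below both [c] and 1. *)
have [d [d0 d1 dc]] : exists d : R, [/\ 0 < d, d <= 1 & d <= c].
  have c1 : 0 < 1 + c by rewrite addr_gt0.
  exists (c / (1 + c)); split; first by rewrite divr_gt0.
    by rewrite ler_pdivrMr// mul1r lerDr.
  by rewrite ler_pdivrMr// ler_peMr ?(ltW c0)// lerDl ltW.
exists d => // x _; rewrite -(@ler_pXn2r _ 2)// ?nnegrE ?nrm_ge0 ?mulr_ge0 ?nrm_ge0 ?(ltW d0)//.
have o : <|opabs A x, P x|> = 0 by rewrite -Psym PN ip0l.
rewrite /filled_abs /= -/P (pythagoras o) opabs_nrm// exprMn.
have -> : A x = A (x - P x) by rewrite (linB bA.1) AP subr0.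
have o2 : <|x - P x, P x|> = 0 by apply: orthoproj_orth => //; exact: orthoproj_in.
rewrite -[in leLHS](subrK (P x) x) (pythagoras o2) mulrDr lerD//.
  rewrite -exprMn ler_pXn2r ?nnegrE ?nrm_ge0 ?mulr_ge0 ?nrm_ge0 ?(ltW d0)//.
  rewrite (@le_trans _ _ (c * nrm (x - P x)))//; first by rewrite ler_wpM2r ?nrm_ge0.
  by apply: hc => y; exact: orthoproj_orth.
by rewrite ler_piMl ?sqr_ge0// expr_le1// ltW.
Qed.

Lemma filled_abs_invertible : invertible_op (filled_abs A).
Proof.
by have [d d0 hd] := filled_abs_below; exact: positive_invertible filled_abs_positive d0 hd.
Qed.

Let ia := filled_abs_invertible.
Let S := op_inv (filled_abs A).
Let hS : bounded_op S. Proof. exact: op_inv_bounded. Qed.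

Let aP x : a (P x) = P x.
Proof. by rewrite /a /filled_abs /= NP -/P PP add0r. Qed.
Let Pa x : P (a x) = P x.
Proof. by rewrite /a /filled_abs /= (linD hP.1) PN -/P PP add0r. Qed.
Let SP x : S (P x) = P x.
Proof. by rewrite -{1}aP /S op_invK. Qed.
Let PS x : P (S x) = P x.
Proof. by rewrite -Pa /a /S op_invKr. Qed.

Lemma polar_iso_spec : [/\ partial_isometry (polar_iso A),
  A = polar_iso A \o opabs A & nullspace (polar_iso A) = nullspace A].
Proof.
apply: (@getPex _ [set V | [/\ partial_isometry V, A = V \o opabs A & nullspace V = nullspace A]]).
have kS x : nullspace A x -> nullspace (A \o S) x.
  by move=> Nx; rewrite -(orthoproj_id cN Nx) /nullspace /= SP AP.
have kS' x : nullspace (A \o S) x -> nullspace A x.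
  move=> h; have /(orthoproj_id cN) : nullspace A (S x) := h.
  rewrite -/P PS => Px; have -> : x = P x.
    by rewrite -[LHS](op_invKr x ia) -/a -/S -Px aP.
  exact: AP.
have kE : nullspace (A \o S) = nullspace A by apply/seteqP; split=> x; [exact: kS'|exact: kS].
exists (A \o S); split=> //.
  split; first exact: bounded_comp.
  rewrite kE => x ox; have Px : P x = 0 by exact: orthoproj0.
  rewrite !nrmE /= -(opabs_nrm (S x) bA); congr (nrm _)%:C.
  by rewrite -[RHS](op_invKr x ia) /filled_abs /= -/S -/P PS Px addr0.
apply/funext => x /=.
have -> : opabs A x = a x - P x by rewrite /a /filled_abs /= -/P addrK.
by rewrite (linB hS.1) /S op_invK// -/S SP (linB bA.1) AP subr0.
Qed.

(** Uniqueness of the partial isometry: [V] kills [N(A)], so [V (|A| + P) = V |A| = A]. *)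
Lemma polar_isoE : polar_iso A = A \o op_inv (filled_abs A).
Proof.
have [[bV _] AV NV] := polar_iso_spec.
apply/funext => x; rewrite -[in LHS](op_invKr x ia) -/S /= /filled_abs /=.
rewrite (linD bV.1) -/P.
have -> : polar_iso A (P (S x)) = 0.
  have : nullspace A (P (S x)) by exact: AP.
  by rewrite -NV.
by rewrite addr0; exact: congr_op (esym AV).
Qed.

Lemma polar_iso_initial : adjoint (polar_iso A) \o polar_iso A =
  orthoproj (orthogonal_to (nullspace A)).
Proof.
rewrite polar_isoE -/S; apply/funext => x; rewrite orthoprojC// -/P.
apply: ip_extr => y; rewrite /= -(adjP _ _ (bounded_comp bA hS)) /= adjP//.
have -> : adjoint A (A (S x)) = a x - P x.
  have /= := congr_op (S x) filled_abs_sq; rewrite /S op_invKr// -/a => ->.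
  by rewrite -/S -/P PS addrK.
have sa : positive_op a := filled_abs_positive.
rewrite ipBr -(positive_sym _ _ sa) /a /S op_invKr// -/S -Psym PS Psym.
by rewrite ipBr.
Qed.

End ClosedRangeOperator.

Lemma polar_conditions_of_unitary J A B U : op_ideal J -> J `<=` fapprox -> am_closed J ->
  closed_range_op A -> closed_range_op B -> J (A \- B) -> U_ideal J U ->
  orthoproj (nullspace B) = U \o orthoproj (nullspace A) \o adjoint U ->
  [/\ J (opabs A \- opabs B), J (polar_iso A \- polar_iso B) &
    ess_codim (adjoint (polar_iso A) \o polar_iso A) (adjoint (polar_iso B) \o polar_iso B) 0].
Proof.
move=> hJ Jc amJ hA hB JAB [[hU UU UU'] JU] BE.
have hA' := adjoint_bounded hA.1.
have JPQ := null_proj_diff hJ hA hB JAB.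
set P := orthoproj (nullspace A) in BE JPQ; set Q := orthoproj (nullspace B) in BE JPQ.
pose a := filled_abs A; pose b := filled_abs B.
have pa : positive_op a := filled_abs_positive hA.
have pb : positive_op b := filled_abs_positive hB.
have Jsq : J ((a \o a) \- (b \o b)).
  rewrite /a /b !filled_abs_sq// -/P -/Q.
  have -> : ((adjoint A \o A) \+ P) \- ((adjoint B \o B) \+ Q) =
      ((adjoint A \o (A \- B)) \+ (adjoint (A \- B) \o B)) \+ (P \- Q).
    apply/funext => x; rewrite (adjoint_sub hA.1 hB.1) /= (linB hA'.1); vector_ring.
  apply: ideal_add => //; apply: ideal_add => //; first exact: ideal_compl.
  by apply: ideal_compr => //; [exact: ideal_adjoint|exact: hB.1].
have [da da0 hda] := filled_abs_below hA; have [db db0 hdb] := filled_abs_below hB.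
have Jab : J (a \- b).
  apply: (@ideal_square_root_diff _ _ J a b (Num.min da db)) => //.
  - by rewrite lt_min da0.
  - by move=> x xT; rewrite (le_trans _ (hda x xT))// ler_wpM2r ?nrm_ge0// ge_min lexx.
  - by move=> x xT; rewrite (le_trans _ (hdb x xT))// ler_wpM2r ?nrm_ge0// ge_min lexx orbT.
have ia := filled_abs_invertible hA; have ib := filled_abs_invertible hB.
have hia := op_inv_bounded ia; have hib := op_inv_bounded ib.
split.
- have -> : opabs A \- opabs B = (a \- b) \- (P \- Q).
    by apply/funext => x; rewrite /a /b /filled_abs /= -/P -/Q; vector_ring.
  exact: ideal_sub.
- rewrite !polar_isoE//.
  (* The resolvent identity [b^-1 - a^-1 = a^-1 (a - b) b^-1] exposes the factors [A - B] and
     [a - b]. *)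
  have -> : (A \o op_inv (filled_abs A)) \- (B \o op_inv (filled_abs B)) =
      ((A \- B) \o op_inv a) \- (B \o (op_inv a \o ((a \- b) \o op_inv b))).
    apply/funext => x; rewrite /= (linB hia.1) /a /b op_invK// op_invKr// (linB hB.1.1).
    vector_ring.
  apply: ideal_sub => //; first exact: ideal_compr.
  apply: ideal_compl => //; first exact: hB.1.
  by apply: ideal_compl => //; exact: ideal_compr.
rewrite !polar_iso_initial//.
have UUx x : adjoint U (U x) = x by exact: congr_op UU.
have UUx' x : U (adjoint U x) = x by exact: congr_op UU'.
have cA := nullspace_closed hA.1; have cB := nullspace_closed hB.1.
have iU : invertible_op U.
  by split=> //; exists (adjoint U); split=> //; exact: adjoint_bounded.
(* A unitary also matches the orthogonal complements, so the compression argument applies to the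
   initial projections. *)
have -> : orthogonal_to (nullspace B) = U @` orthogonal_to (nullspace A).
  rewrite -!nullspace_orthoproj// -/P -/Q BE; apply/seteqP; split=> [y|_ [x Px <-]].
    rewrite /nullspace /= => h; exists (adjoint U y) => //=.
    by rewrite -(UUx (P _)) h (lin0 (adjoint_bounded hU).1).
  by move: Px; rewrite /nullspace /= UUx => ->; rewrite (lin0 hU.1).
by apply: (ess_codim_image hJ Jc) => //; exact: orthogonal_to_closed.
Qed.

Lemma polar_conditions_sufficient J A B : op_ideal J -> J `<=` fapprox ->
  J <> [set (fun=> 0)] -> closed_range_op A -> closed_range_op B ->
  J (opabs A \- opabs B) -> J (polar_iso A \- polar_iso B) ->
  ess_codim (adjoint (polar_iso A) \o polar_iso A)
    (adjoint (polar_iso B) \o polar_iso B) 0 ->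
  J (A \- B) /\ exists2 U, U_ideal J U &
    orthoproj (nullspace B) = U \o orthoproj (nullspace A) \o adjoint U.
Proof.
move=> hJ Jc J0 hA hB Jabs Jpol; rewrite !polar_iso_initial// => -[_ [m [n [hm hn mn]]]].
have [[_ _] AV _] := polar_iso_spec hA; have [[bVB _] BV _] := polar_iso_spec hB.
have cA := nullspace_closed hA.1; have cB := nullspace_closed hB.1.
have JAB : J (A \- B).
  have -> : A \- B = ((polar_iso A \- polar_iso B) \o opabs A) \+
      (polar_iso B \o (opabs A \- opabs B)).
    apply/funext => x; rewrite {1}AV {1}BV /= (linB bVB.1); vector_ring.
  apply: ideal_add => //; last exact: ideal_compl.
  by apply: ideal_compr => //; exact: opabs_bounded hA.1.
split=> //.
have mnE : m = n by move/eqP: mn; rewrite eq_sym subr_eq0 eqz_nat => /eqP.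
have oA := orthogonal_to_closed (nullspace A); have oB := orthogonal_to_closed (nullspace B).
(* Passing to complementary projections exchanges the two intersections; with index 0 their
   dimensions are equal, so the exchange is harmless. *)
move: hm hn; rewrite !range_orthoproj// !nullspace_orthoproj// !ortho_ortho// mnE => hm hn.
apply: (@projections_unitarily_equivalent _ _ J _ _ n) => //.
- exact: null_proj_diff.
- by rewrite range_orthoproj// nullspace_orthoproj// setIC.
- by rewrite range_orthoproj// nullspace_orthoproj// setIC.
Qed.

End Polar.

Theorem theorem3p7 (R : realType) (H : hilbertType R)
    (Hsep : separable_space H) (Hinf : ~ finite_dim [set: H])
    (A B : H -> H) (hA : closed_range_op A) (hB : closed_range_op B)
    (J : set (H -> H)) (hJ : proper_op_ideal J) :
  [<-> (* (i) *)
       (exists G K : H -> H, [/\ Gl_ideal J G, Gl_ideal J K &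
          B = G \o A \o op_inv K]);
       (* (ii) *)
       (J (A \- B) /\ ess_codim (orthoproj (nullspace A)) (orthoproj (nullspace B)) 0);
       (* (iii) *)
       (J (A \- B) /\ exists2 U : H -> H, U_ideal J U &
          orthoproj (nullspace B) = U \o orthoproj (nullspace A) \o adjoint U)]
  /\
  (am_closed J ->
    ((exists G K : H -> H, [/\ Gl_ideal J G, Gl_ideal J K &
          B = G \o A \o op_inv K])
     <->
     [/\ J (opabs A \- opabs B),
         J (polar_iso A \- polar_iso B) &
         ess_codim (adjoint (polar_iso A) \o polar_iso A)
                   (adjoint (polar_iso B) \o polar_iso B) 0])).
Proof.
have Jc := calkin Hsep hJ; have [iJ J0 _] := hJ.
have i_ii : (exists G K : H -> H, [/\ Gl_ideal J G, Gl_ideal J K & B = G \o A \o op_inv K]) ->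
    J (A \- B) /\ ess_codim (orthoproj (nullspace A)) (orthoproj (nullspace B)) 0.
  by move=> [G [K [GG GK BE]]]; exact: multiplicative_ess_codim iJ Jc hA.1 GG GK BE.
have ii_iii : J (A \- B) /\ ess_codim (orthoproj (nullspace A)) (orthoproj (nullspace B)) 0 ->
    J (A \- B) /\ exists2 U : H -> H, U_ideal J U &
      orthoproj (nullspace B) = U \o orthoproj (nullspace A) \o adjoint U.
  move=> [JAB [_ [m [n [hm hn mn]]]]]; split=> //.
  have mnE : m = n by move/eqP: mn; rewrite eq_sym subr_eq0 eqz_nat => /eqP.
  rewrite mnE in hm.
  apply: (projections_unitarily_equivalent iJ Jc J0 _ _ _ hm hn).
  - exact: nullspace_closed hA.1.
  - exact: nullspace_closed hB.1.
  - exact: null_proj_diff.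
have iii_i : (J (A \- B) /\ exists2 U : H -> H, U_ideal J U &
      orthoproj (nullspace B) = U \o orthoproj (nullspace A) \o adjoint U) ->
    exists G K : H -> H, [/\ Gl_ideal J G, Gl_ideal J K & B = G \o A \o op_inv K].
  by move=> [JAB [U JU BE]]; exact: unitary_equivalent iJ Jc J0 hA hB JAB JU BE.
split; first by tfae.
(* Condition (iv) is tied to (iii): the unitary controls nullspaces and initial spaces at the same
   time. *)
move=> amJ; split=> [/i_ii/ii_iii[JAB [U JU BE]]|[Jabs Jpol hess]].
  exact: polar_conditions_of_unitary iJ Jc amJ hA hB JAB JU BE.
exact/iii_i/(polar_conditions_sufficient iJ Jc J0 hA hB Jabs Jpol hess).
Qed.
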